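(* Let $f\in H(\mathbb{D})$ be such that $\{f(rw):0\le r<1\}$ is unbounded for $m$-almost every $w\in\mathbb{T}$. Then for every $\zeta\in\mathbb{T}$ and every $r>0$, the set $\mathbb{C}\setminus f(D_{\zeta,r})$ is polar, where $D_{\zeta,r}=\{z\in\mathbb{D}:|z-\zeta|<r\}$. In particular, this holds for every $f\in\mathcal{U}_{ae}(\mathbb{D})$.
   Context: $\mathbb{D}$ is the open unit disc, $\mathbb{T}$ the unit circle, $m$ arclength measure on $\mathbb{T}$. For $f\in H(\mathbb{D})$ and $r\in[0,1)$, $f_r(z):=f(rz)$. $\mathcal{U}_{ae}(\mathbb{D})$ is the set of $f\in H(\mathbb{D})$ such that for every $m$-measurable function $\varphi$ on $\mathbb{T}$ there is a sequence $(r_n)$ in $[0,1)$ with $f_{r_n}(\zeta)\to\varphi(\zeta)$ for $m$-almost every $\zeta\in\mathbb{T}$. Polar means of zero logarithmic capacity (in the potential-theoretic sense). *)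

(* Defs.v *)
From HB Require Import structures.
From mathcomp Require Import all_boot all_order all_algebra.
From mathcomp Require Import all_classical all_reals all_analysis.
From mathcomp Require Export complex.
Import Order.TTheory GRing.Theory Num.Theory.
Import numFieldTopology.Exports numFieldNormedType.Exports.

Set Implicit Arguments.
Unset Strict Implicit.
Unset Printing Implicit Defensive.

Local Open Scope classical_set_scope.
Local Open Scope ring_scope.

(** Topology / normed structure of C = R[i] as a normed space over itself
    (the standard one induced by its norm, as for any numFieldType). *)
Section Cinst.
Variable R : rcfType.
HB.instance Definition _ := PseudoPointedMetric.copy R[i] R[i]^o.
HB.instance Definition _ := GRing.ComAlgebra.copy R[i] R[i]^o.
HB.instance Definition _ := Vector.copy R[i] R[i]^o.
HB.instance Definition _ := NormedModule.copy R[i] R[i]^o.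
End Cinst.

Section Defs.
Variable R : realType.
Local Notation C := R[i].

Definition cabs (z : C) : R := complex.Re `|z|.

Definition cR (r : R) : C := Complex r 0.

Definition expi (t : R) : C := Complex (cos t) (sin t).

(** f is holomorphic on the open unit disc D: complex differentiable at every
    point of D (derivable over the scalar field C itself). *)
Definition holomorphic_on_disc (f : C -> C) : Prop :=
  forall z : C, cabs z < 1 -> derivable f z 1.

Definition Dzr (zeta : C) (r : R) : set C :=
  [set z | cabs z < 1 /\ cabs (z - zeta) < r].

(** Arclength measure m on T is the push-forward of Lebesgue measure on
    [0, 2 pi) under t |-> e^{it}.  Hence "P(w) for m-a.e. w in T" reads
    "P(e^{it}) for Lebesgue-a.e. t in [0, 2 pi)". *)
Definition ae_T (P : C -> Prop) : Prop :=
  {ae (@lebesgue_measure R), forall t : R, (0 <= t < 2 * pi) -> P (expi t)}.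

Definition radially_unbounded_ae (f : C -> C) : Prop :=
  ae_T (fun w => ~ exists M : R, forall r : R, 0 <= r < 1 -> cabs (f (cR r * w)) <= M).

(** sigma-algebra of sets measurable for the completion of Lebesgue measure *)
Definition CLtype := ltac:(let t := type of (@completed_lebesgue_measure R) in
                           match t with set ?T -> _ => exact T end).
Definition complete_lebesgue_measurable (A : set R) : Prop :=
  @measurable _ CLtype A.

(** phi : T -> C is m-measurable (m completed arclength measure):
    preimages of open subsets of C are m-measurable, i.e. their pull-backs
    to [0, 2 pi) are (completed-)Lebesgue measurable. *)
Definition m_measurable (phi : C -> C) : Prop :=
  forall U : set C, open U ->
    complete_lebesgue_measurable [set t | 0 <= t < 2 * pi /\ U (phi (expi t))].

Definition Uae (f : C -> C) : Prop :=
  holomorphic_on_disc f /\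
  forall phi : C -> C, m_measurable phi ->
    exists rn : nat -> R, (forall n, 0 <= rn n < 1) /\
      ae_T (fun w => (fun n => f (cR (rn n) * w)) @ \oo --> phi w).

Definition Cborel := g_sigma_algebraType (@open C).

Definition logkernel (z w : C) : \bar R :=
  if z == w then -oo%E else (ln (cabs (z - w)))%:E.

Definition energy (mu : {measure set Cborel -> \bar R}) : \bar R :=
  (\int[mu]_(z in [set: Cborel]) \int[mu]_(w in [set: Cborel]) logkernel z w)%E.

(** Ransford's definition: E is polar iff I(mu) = -oo for every finite Borel
    measure mu <> 0 whose support is a compact subset of E (equivalently:
    mu is carried by some compact K contained in E). *)
Definition polar (E : set C) : Prop :=
  forall mu : {measure set Cborel -> \bar R},
    (mu setT < +oo)%E -> mu setT != 0%E ->
    (exists K : set C, compact K /\ K `<=` E /\ mu (~` K) = 0%E) ->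
    energy mu = -oo%E.

End Defs.

(* Main.v *)
(* Suppose that the complement of the image carried a nonzero measure of finite energy on a
   compact set K.  Some part A of K has positive measure, and the potential of the measure is
   bounded below on A, so p(w) = int_A ln |w - z| dmu(z) is bounded below off K, harmonic there,
   and tends to +oo at infinity.  Hence u(z) = p(f(e^{iz})) is, up to an additive constant, a
   nonnegative harmonic function in a box of the upper half plane resting on the real axis, and
   u is unbounded on almost every vertical line of the box.  This is impossible: for each
   lambda, choose by Vitali's lemma finitely many disjoint intervals centred at t_j, of
   half-length y_j and with total length comparable to that of the base, such that
   u(t_j + i y_j) >= lambda.  By Harnack, u >= c lambda on small discs about these points, while
   the sum of the half-plane Green functions with these poles is bounded outside the discs,
   because it is dominated by the harmonic measure of the disjoint intervals.  The minimum
   principle gives u >= c' lambda at a fixed point of the box, for every lambda.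
   Functions in U_ae are radially unbounded almost everywhere since the constants n are limits
   of dilates. *)
Require Import Defs.
From HB Require Import structures.
From mathcomp Require Import all_boot all_order all_algebra.
From mathcomp Require Import all_classical all_reals all_analysis.
From mathcomp Require Import complex measurable_realfun.
From mathcomp Require Import ring lra.
Import Order.TTheory GRing.Theory Num.Theory.
Import numFieldTopology.Exports numFieldNormedType.Exports.
Set Implicit Arguments. Unset Strict Implicit. Unset Printing Implicit Defensive.
Local Open Scope classical_set_scope.
Local Open Scope ring_scope.

(** * Complex modulus and differentials *)

(** The obstacle is that [u] has no boundary values to integrate: above a good abscissa there is
    only some height at which [u >= lambda], and this height depends on the point in an
    uncontrolled, possibly nonmeasurable way. A finite disjoint family of intervals suffices, and
    taking the height of each pole as the half-length of its interval is what makes the domination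
    by harmonic measure scale-free. Every constant is independent of [lambda], hence the
    contradiction. In the exponential coordinate radii are vertical lines and arcs are real
    intervals, so the covering argument is one-dimensional. The lower bound of the potential off [K]
    comes from comparing a point with a nearly nearest point of [A], at the price of [ln 3] per unit
    of mass. The complex gradient of [p(f)] contains [f'], so harmonicity of the pull-back requires
    that [f'] be differentiable; this is derived from Goursat's theorem through circle means. *)

Section ComplexModulus.
Variable R : realType.
Local Notation C := R[i].
Implicit Types (z w : C) (x y t : R).
Local Notation Re := (@complex.Re R).
Local Notation Im := (@complex.Im R).

Lemma Re_add z w : Re (z + w) = Re z + Re w. Proof. by case: z w => [a b] [c d]. Qed.
Lemma Im_add z w : Im (z + w) = Im z + Im w. Proof. by case: z w => [a b] [c d]. Qed.
Lemma Re_opp z : Re (- z) = - Re z. Proof. by case: z. Qed.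
Lemma Im_opp z : Im (- z) = - Im z. Proof. by case: z. Qed.
Lemma Re_mul z w : Re (z * w) = Re z * Re w - Im z * Im w.
Proof. by case: z w => [a b] [c d]. Qed.
Lemma Im_mul z w : Im (z * w) = Re z * Im w + Im z * Re w.
Proof. by case: z w => [a b] [c d]. Qed.
Definition ReImE := (Re_add, Im_add, Re_opp, Im_opp, Re_mul, Im_mul).

Lemma complex_ext z w : Re z = Re w -> Im z = Im w -> z = w.
Proof. by case: z w => [a b] [c d] /= -> ->. Qed.

Lemma cabsE z : cabs z = Num.sqrt (Re z ^+ 2 + Im z ^+ 2).
Proof. by rewrite /cabs normc_def. Qed.

Lemma cabs_sqr z : cabs z ^+ 2 = Re z ^+ 2 + Im z ^+ 2.
Proof. by rewrite cabsE sqr_sqrtr// addr_ge0 ?sqr_ge0. Qed.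

Lemma normc_cabs z : `|z| = cR (cabs z).
Proof. by rewrite /cabs normc_def. Qed.

Lemma cabs_ge0 z : 0 <= cabs z. Proof. by rewrite cabsE sqrtr_ge0. Qed.

Lemma cabsM z w : cabs (z * w) = cabs z * cabs w.
Proof.
rewrite {1}/cabs normrM !normc_cabs.
by rewrite Re_mul /cR /= mulr0 subr0.
Qed.

Lemma cabsN z : cabs (- z) = cabs z. Proof. by rewrite /cabs normrN. Qed.
Lemma cabsB z w : cabs (z - w) = cabs (w - z). Proof. by rewrite /cabs distrC. Qed.

Lemma cabsD z w : cabs (z + w) <= cabs z + cabs w.
Proof. by have := ler_normD z w; rewrite !normc_cabs lecE /= => /andP[]. Qed.

Lemma cabs0 : cabs (0 : C) = 0. Proof. by rewrite /cabs normr0. Qed.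
Lemma cabs1 : cabs (1 : C) = 1. Proof. by rewrite /cabs normr1. Qed.

Lemma cabs_eq0 z : (cabs z == 0) = (z == 0).
Proof.
apply/eqP/eqP => [z0|->]; last exact: cabs0.
by apply/normr0_eq0; rewrite normc_cabs z0.
Qed.

Lemma cabs_gt0 z : (0 < cabs z) = (z != 0).
Proof. by rewrite lt_def cabs_ge0 andbT cabs_eq0. Qed.

Lemma cabsV z : cabs z^-1 = (cabs z)^-1.
Proof.
have [->|z0] := eqVneq z 0; first by rewrite invr0 cabs0 invr0.
apply: (@mulfI _ (cabs z)); first by rewrite cabs_eq0.
by rewrite -cabsM !divff ?cabs1// cabs_eq0.
Qed.

Lemma cabs_cR x : cabs (cR x) = `|x|.
Proof. by rewrite cabsE /= expr0n addr0 sqrtr_sqr. Qed.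

Lemma normRe z : `|Re z| <= cabs z.
Proof.
rewrite -(ler_pXn2r (ltn0Sn 1)) ?nnegrE ?normr_ge0 ?cabs_ge0//.
by rewrite real_normK ?num_real// cabs_sqr lerDl sqr_ge0.
Qed.

Lemma normIm z : `|Im z| <= cabs z.
Proof.
rewrite -(ler_pXn2r (ltn0Sn 1)) ?nnegrE ?normr_ge0 ?cabs_ge0//.
by rewrite real_normK ?num_real// cabs_sqr lerDr sqr_ge0.
Qed.

Lemma cabs_ReIm z : cabs z <= `|Re z| + `|Im z|.
Proof.
rewrite -(ler_pXn2r (ltn0Sn 1)) ?nnegrE ?addr_ge0 ?normr_ge0 ?cabs_ge0//.
rewrite sqrrD !real_normK ?num_real// cabs_sqr.
rewrite addrAC lerDl mulrn_wge0 ?mulr_ge0//.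
Qed.

Lemma cabs_expi t : cabs (expi t) = 1.
Proof. by rewrite cabsE /= cos2Dsin2 sqrtr1. Qed.

Lemma cRD x y : cR (x + y) = cR x + cR y.
Proof. by apply: complex_ext; rewrite !ReImE /= ?addr0. Qed.
Lemma cRM x y : cR (x * y) = cR x * cR y.
Proof. by apply: complex_ext; rewrite !ReImE /=; ring. Qed.
Lemma cRN x : cR (- x) = - cR x.
Proof. by apply: complex_ext; rewrite !ReImE /= ?oppr0. Qed.

Lemma expiD x y : expi (x + y) = expi x * expi y.
Proof. by apply: complex_ext; rewrite !ReImE /= ?cosD ?sinD //; ring. Qed.

Lemma expi0 : expi (0 : R) = 1.
Proof. by rewrite /expi cos0 sin0. Qed.

End ComplexModulus.

Section Differentials.
Variable R : realType.
Local Notation C := R[i].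
Local Notation Re := (@complex.Re R).
Local Notation Im := (@complex.Im R).

(** Little-o of [h] at 0, without an absolute value on [phi], because it is meant for error terms
    that are already nonnegative. Complex and real differentials are both instances, so one calculus
    of error terms serves both. *)
Definition negligible_increment (phi : C -> R) := forall e : R, 0 < e ->
  exists2 d : R, 0 < d & forall h, cabs h < d -> phi h <= e * cabs h.
Local Notation lo := negligible_increment.

Definition cderiv (f : C -> C) z d := lo (fun h => cabs (f (z + h) - f z - d * h)).
(* [g] encodes the differential [h |-> Re (g * h)] of [u] at [z], i.e. [g = u_x - i u_y]. *)
Definition rgrad (u : C -> R) z g := lo (fun h => `|u (z + h) - u z - Re (g * h)|).

Lemma lo_le (phi psi : C -> R) r : 0 < r ->
  (forall h, cabs h < r -> phi h <= psi h) -> lo psi -> lo phi.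
Proof.
move=> r0 le lop e e0; have [d d0 hd] := lop e e0.
exists (Num.min r d); first by rewrite lt_min r0.
by move=> h; rewrite lt_min => /andP[hr hd']; apply: le_trans (le _ hr) (hd _ hd').
Qed.

Lemma loD (phi psi : C -> R) : lo phi -> lo psi -> lo (fun h => phi h + psi h).
Proof.
move=> l1 l2 e e0; have e2 : 0 < e / 2 by lra.
have [d d0 hd] := l1 _ e2; have [d' d0' hd'] := l2 _ e2.
exists (Num.min d d'); first by rewrite lt_min d0.
move=> h; rewrite lt_min => /andP[a b].
have := hd _ a; have := hd' _ b; lra.
Qed.

Lemma loZ (k : R) (phi : C -> R) : 0 <= k -> lo phi -> lo (fun h => k * phi h).
Proof.
move=> k0 l e e0; have e2 : 0 < e / (k + 1) by apply: divr_gt0 => //; lra.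
have [d d0 hd] := l _ e2; exists d => // h /hd H.
apply: (@le_trans _ _ (k * (e / (k + 1) * cabs h))); first exact: ler_wpM2l.
have -> : k * (e / (k + 1) * cabs h) = e * cabs h * (k / (k + 1)) by field; lra.
apply: ler_piMr; first by rewrite mulr_ge0 ?cabs_ge0 ?ltW.
by rewrite ler_pdivrMr; lra.
Qed.

Lemma lo_sq (k r : R) (phi : C -> R) : 0 < r -> 0 <= k ->
  (forall h, cabs h < r -> phi h <= k * cabs h ^+ 2) -> lo phi.
Proof.
move=> r0 k0 H e e0; exists (Num.min r (e / (k + 1))).
  by rewrite lt_min r0 divr_gt0//; lra.
move=> h; rewrite lt_min => /andP[/H hr]; rewrite ltr_pdivlMr; last lra.
move=> hd; apply: le_trans hr _; rewrite expr2 mulrA ler_wpM2r ?cabs_ge0//.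
have := cabs_ge0 h; nra.
Qed.

Lemma cderiv_lip f z d : cderiv f z d ->
  exists2 r : R, 0 < r & forall h, cabs h < r -> cabs (f (z + h) - f z) <= (cabs d + 1) * cabs h.
Proof.
move=> /(_ 1 ltr01)[r r0 H]; exists r => // h /H {}H.
rewrite -[f (z+h) - f z](subrK (d * h)) (le_trans (cabsD _ _))// cabsM; lra.
Qed.

Lemma cderiv_cont f z d : cderiv f z d ->
  forall e : R, 0 < e -> exists2 r : R, 0 < r & forall h, cabs h < r -> cabs (f (z + h) - f z) < e.
Proof.
move=> /cderiv_lip[r r0 H] e e0.
have k0 : 0 < cabs d + 1 by have := cabs_ge0 d; lra.
exists (Num.min r (e / (cabs d + 1))); first by rewrite lt_min r0 divr_gt0.
move=> h; rewrite lt_min => /andP[/H hr]; rewrite ltr_pdivlMr// => hd.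
by apply: le_lt_trans hr _; rewrite mulrC.
Qed.

Lemma rgrad_lip u z d : rgrad u z d ->
  exists2 r : R, 0 < r & forall h, cabs h < r -> `|u (z + h) - u z| <= (cabs d + 1) * cabs h.
Proof.
move=> /(_ 1 ltr01)[r r0 H]; exists r => // h /H {}H.
rewrite -[u (z+h) - u z](subrK (Re (d * h))) (le_trans (ler_normD _ _))//.
have := normRe (d * h); rewrite cabsM; lra.
Qed.

Lemma cderiv_cst c z : cderiv (fun _ => c) z 0.
Proof.
by apply: (@lo_sq 0 1) => // h _; rewrite subrr mul0r subr0 cabs0 mul0r.
Qed.

Lemma cderiv_id z : cderiv (fun w => w) z 1.
Proof.
apply: (@lo_sq 0 1) => // h _.
have -> : z + h - z - 1 * h = 0 by ring.
by rewrite cabs0 mul0r.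
Qed.

Lemma cderivD f g z a b : cderiv f z a -> cderiv g z b ->
  cderiv (fun w => f w + g w) z (a + b).
Proof.
move=> Hf Hg; apply: (lo_le ltr01) (loD Hf Hg) => h _.
apply: le_trans (cabsD _ _); rewrite le_eqVlt; apply/orP; left; apply/eqP.
by congr cabs; ring.
Qed.

Lemma cderivZ c f z a : cderiv f z a -> cderiv (fun w => c * f w) z (c * a).
Proof.
move=> Hf; apply: (lo_le ltr01) (loZ (cabs_ge0 c) Hf) => h _.
rewrite -cabsM le_eqVlt; apply/orP; left; apply/eqP.
by congr cabs; ring.
Qed.

Lemma cderivN f z a : cderiv f z a -> cderiv (fun w => - f w) z (- a).
Proof.
move=> Hf; apply: (lo_le ltr01) Hf => h _.
rewrite -cabsN le_eqVlt; apply/orP; left; apply/eqP.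
by congr cabs; ring.
Qed.

Lemma cderivB f g z a b : cderiv f z a -> cderiv g z b ->
  cderiv (fun w => f w - g w) z (a - b).
Proof. by move=> Hf Hg; apply: cderivD => //; exact: cderivN. Qed.

Lemma cderivM f g z a b : cderiv f z a -> cderiv g z b ->
  cderiv (fun w => f w * g w) z (a * g z + f z * b).
Proof.
move=> Hf Hg.
have [r1 r10 H1] := cderiv_lip Hf; have [r2 r20 H2] := cderiv_lip Hg.
have r0 : 0 < Num.min r1 r2 by rewrite lt_min r10.
have L : lo (fun h => cabs (f (z+h) - f z) * cabs (g (z+h) - g z)).
  apply: (@lo_sq ((cabs a + 1) * (cabs b + 1)) _ _ r0) => [|h].
    by rewrite mulr_ge0// addr_ge0 ?cabs_ge0.
  rewrite lt_min => /andP[/H1 h1 /H2 h2].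
  have -> : (cabs a + 1) * (cabs b + 1) * cabs h ^+ 2 = ((cabs a + 1) * cabs h) * ((cabs b + 1) * cabs h) by ring.
  by apply: ler_pM; rewrite ?cabs_ge0.
apply: (lo_le ltr01) (loD (loD (loZ (cabs_ge0 (g z)) Hf) (loZ (cabs_ge0 (f z)) Hg)) L) => h _.
rewrite -!cabsM.
apply: le_trans (lerD (cabsD _ _) (lexx _)); apply: le_trans (cabsD _ _).
rewrite le_eqVlt; apply/orP; left; apply/eqP.
by congr cabs; ring.
Qed.

Lemma cderiv_comp f g z a b : cderiv f z a -> cderiv g (f z) b ->
  cderiv (fun w => g (f w)) z (b * a).
Proof.
move=> Hf Hg; have [r r0 H1] := cderiv_lip Hf.
have L : lo (fun h => cabs (g (f (z + h)) - g (f z) - b * (f (z + h) - f z))).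
  move=> e e0.
  have k0 : 0 < cabs a + 1 by have := cabs_ge0 a; lra.
  have [d d0 hd] := Hg _ (divr_gt0 e0 k0).
  exists (Num.min r (d / (cabs a + 1))); first by rewrite lt_min r0 divr_gt0.
  move=> h; rewrite lt_min => /andP[/H1 hr]; rewrite ltr_pdivlMr// => hh.
  have := hd (f (z + h) - f z); rewrite [f z + _]addrC subrK => /(_ _) /le_trans; apply.
    by apply: le_lt_trans hr _; rewrite mulrC.
  by rewrite -mulrA ler_pM2l// mulrC ler_pdivrMr// mulrC.
apply: (lo_le ltr01) (loD L (loZ (cabs_ge0 b) Hf)) => h _.
rewrite -!cabsM; apply: le_trans (cabsD _ _).
rewrite le_eqVlt; apply/orP; left; apply/eqP.
by congr cabs; ring.
Qed.

Lemma cderiv_inv z : z != 0 -> cderiv (fun w => w^-1) z (- (z ^- 2)).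
Proof.
move=> z0; have c0 : 0 < cabs z by rewrite cabs_gt0.
apply: (@lo_sq (2 / cabs z ^+ 3) (cabs z / 2)) => [||h hr].
- by rewrite divr_gt0.
- by rewrite divr_ge0// exprn_ge0 ?cabs_ge0.
have zh : cabs z / 2 <= cabs (z + h).
  by have := cabsD (z + h) (- h); rewrite addrK cabsN; lra.
have zh0 : z + h != 0 by rewrite -cabs_gt0; lra.
have -> : (z + h)^-1 - z^-1 - - z ^- 2 * h = h * h * (z * z * (z + h))^-1.
  by field; rewrite z0 zh0.
rewrite !cabsM cabsV !cabsM mulrC expr2 ler_wpM2r ?mulr_ge0 ?cabs_ge0//.
have A : 0 < cabs z ^+ 3 / 2 by rewrite divr_gt0// exprn_gt0.
have B : 0 < cabs z * cabs z * cabs (z + h) by rewrite !mulr_gt0//; lra.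
rewrite -[2 / _]invf_div lef_pV2 ?posrE//.
rewrite !exprS expr0 mulr1; have := mulr_gt0 c0 c0; nra.
Qed.

Lemma cderiv_rgrad f z d : cderiv f z d -> rgrad (fun w => Re (f w)) z d.
Proof.
apply: (lo_le ltr01) => h _; apply: le_trans (normRe _).
by rewrite !ReImE.
Qed.

Lemma rgradD u v z a b : rgrad u z a -> rgrad v z b -> rgrad (fun w => u w + v w) z (a + b).
Proof.
move=> Hf Hg; apply: (lo_le ltr01) (loD Hf Hg) => h _.
apply: le_trans (ler_normD _ _); rewrite le_eqVlt; apply/orP; left; apply/eqP.
by congr `|_|; rewrite !ReImE; ring.
Qed.

Lemma rgradZ (c : R) u z a : rgrad u z a -> rgrad (fun w => c * u w) z (cR c * a).
Proof.
move=> Hf; apply: (lo_le ltr01) (loZ (normr_ge0 c) Hf) => h _.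
rewrite -normrM le_eqVlt; apply/orP; left; apply/eqP.
by congr `|_|; rewrite !ReImE /=; ring.
Qed.

Lemma rgrad_cst (c : R) z : rgrad (fun _ => c) z 0.
Proof.
by apply: (@lo_sq 0 1) => // h _; rewrite mul0r subr0 subrr normr0 mul0r.
Qed.

Lemma rgrad_comp f u z a b : cderiv f z a -> rgrad u (f z) b ->
  rgrad (fun w => u (f w)) z (b * a).
Proof.
move=> Hf Hg; have [r r0 H1] := cderiv_lip Hf.
have L : lo (fun h => `|u (f (z + h)) - u (f z) - Re (b * (f (z + h) - f z))|).
  move=> e e0.
  have k0 : 0 < cabs a + 1 by have := cabs_ge0 a; lra.
  have [d d0 hd] := Hg _ (divr_gt0 e0 k0).
  exists (Num.min r (d / (cabs a + 1))); first by rewrite lt_min r0 divr_gt0.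
  move=> h; rewrite lt_min => /andP[/H1 hr]; rewrite ltr_pdivlMr// => hh.
  have := hd (f (z + h) - f z); rewrite [f z + _]addrC subrK => /(_ _) /le_trans; apply.
    by apply: le_lt_trans hr _; rewrite mulrC.
  by rewrite -mulrA ler_pM2l// mulrC ler_pdivrMr// mulrC.
apply: (lo_le ltr01) (loD L (loZ (cabs_ge0 b) Hf)) => h _.
rewrite -!cabsM.
apply: le_trans (lerD (lexx _) (normRe _)).
apply: le_trans (ler_normD _ _).
rewrite le_eqVlt; apply/orP; left; apply/eqP.
by congr `|_|; rewrite !ReImE; ring.
Qed.

Lemma is_derive_eps (f : R -> R) (x d : R) :
  (forall e : R, 0 < e -> exists2 r : R, 0 < r & forall h, `|h| < r -> `|f (x + h) - f x - d * h| <= e * `|h|) ->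
  is_derive x 1 f d.
Proof.
move=> H.
have L : h^-1 *: ((f \o shift x) (h *: 1) - f x) @[h --> 0^'] --> d.
  apply/cvgrPdist_le => e e0; have [r r0 hr] := H e e0.
  exists r => //= h; rewrite /= sub0r normrN => hh h0.
  have := hr h hh.
  rewrite /= /GRing.scale /= mulr1 [h + x]addrC => H'.
  have -> : d - h^-1 * (f (x + h) - f x) = - (h^-1 * (f (x + h) - f x - d * h)) by field.
  rewrite normrN normrM normfV mulrC ler_pdivrMr// normr_gt0//.
apply: DeriveDef.
  by apply/cvg_ex; exists d.
exact: (cvg_lim (@norm_hausdorff _ _) L).
Qed.

Lemma derive_eps (f : R -> R) (x d : R) : is_derive x 1 f d ->
  (forall e : R, 0 < e -> exists2 r : R, 0 < r & forall h, `|h| < r -> `|f (x + h) - f x - d * h| <= e * `|h|).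
Proof.
move=> [D <-] e e0.
move: D => /cvg_ex[l L].
have <- : l = 'D_1 f x.
  by apply/esym; exact: (cvg_lim (@norm_hausdorff _ _) L).
move/cvgrPdist_le: L => /(_ e e0)[r /= r0 hr].
exists r => // h hh.
have [->|h0] := eqVneq h 0; first by rewrite addr0 subrr mulr0 subr0 normr0 mulr0.
have := hr h; rewrite /= sub0r normrN => /(_ hh h0).
rewrite /GRing.scale /= mulr1 [h + x]addrC.
have -> : l - h^-1 * (f (x + h) - f x) = - ((f (x + h) - f x - l * h) / h) by field.
by rewrite normrN normrM normfV ler_pdivrMr// normr_gt0.
Qed.

Lemma cderiv_holo (f : C -> C) z : derivable f z 1 -> exists d, cderiv f z d.
Proof.
move=> /cvg_ex[l L]; exists l => e e0.
have ce : 0 < cR e by rewrite ltcE /= eqxx.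
move/cvgrPdist_le : L => /(_ _ ce)[r /= r0 hr].
have [r1 rE] : exists r1, r = cR r1.
  by move: r0; rewrite ltcE /= => /andP[/eqP i0 _]; exists (Re r); case: (r) i0 => a b /= ->.
have r10 : 0 < r1 by move: r0; rewrite rE ltcE /= => /andP[].
exists r1 => // h hh.
have [->|h0] := eqVneq h 0; first by rewrite addr0 subrr mulr0 subr0 cabs0 mulr0.
have := hr h; rewrite /= sub0r normrN rE normc_cabs ltcE /= eqxx => /(_ hh h0).
rewrite /GRing.scale /= mulr1 [h + z]addrC.
have -> : l - h^-1 * (f (z + h) - f z) = - ((f (z + h) - f z - l * h) / h) by field.
by rewrite normrN normc_cabs lecE /= eqxx /= cabsM cabsV ler_pdivrMr// cabs_gt0.
Qed.

Lemma rgrad_line u a e (t : R) g : rgrad u (a + cR t * e) g ->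
  is_derive t 1 (fun s : R => u (a + cR s * e)) (Re (g * e)).
Proof.
move=> H; apply: is_derive_eps => eps e0.
have k0 : 0 < cabs e + 1 by have := cabs_ge0 e; lra.
have [d d0 hd] := H _ (divr_gt0 e0 k0).
exists (d / (cabs e + 1)); first exact: divr_gt0.
move=> h; rewrite ltr_pdivlMr// => hh.
have := hd (cR h * e); rewrite cabsM cabs_cR => H1.
have -> : a + cR (t + h) * e = a + cR t * e + cR h * e by rewrite cRD; ring.
have -> : Re (g * e) * h = Re (g * (cR h * e)) by rewrite !ReImE /=; ring.
have := cabs_ge0 e; have := normr_ge0 h => h0 ce0.
apply: le_trans (H1 _) _; first by nra.
have -> : eps / (cabs e + 1) * (`|h| * cabs e) = eps * `|h| * (cabs e / (cabs e + 1)) by field; lra.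
apply: ler_piMr; first by apply: mulr_ge0 => //; apply: ltW.
by rewrite ler_pdivrMr; lra.
Qed.

End Differentials.

(** * Goursat's theorem *)

Section RealIntegral.
Variable R : realType.
Local Notation leb := (@lebesgue_measure R).

(** The centre [c] is arbitrary because small rectangles and shrinking circles compare an integral
    with that of a constant; [c = 0] gives the plain bound. *)
Lemma Rintegral_near_cst d (T : measurableType d) (mu : {measure set T -> \bar R})
    (D : set T) (f : T -> R) (c M : R) :
  measurable D -> (mu D < +oo)%E -> mu.-integrable D (EFin \o f) ->
  (forall x, D x -> `|f x - c| <= M) ->
  `|\int[mu]_(x in D) f x - c * fine (mu D)| <= M * fine (mu D).
Proof.
move=> mD fD intf H.
have ic k : mu.-integrable D (EFin \o (fun=> k : R)).
  apply: measurable_bounded_integrable => //.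
  exists `|k|; split; first exact: num_real.
  by move=> z kz y _ /=; exact: ltW.
rewrite -!Rintegral_cst// -RintegralB//.
apply: le_trans (le_normr_Rintegral _ _) _ => //.
  by have := integrableB mD intf (ic c); apply: eq_integrable.
apply: le_Rintegral => //.
have := integrable_norm (integrableB mD intf (ic c)).
by apply: eq_integrable.
Qed.

(** Continuity is two-sided even at the end points: the integrands come from functions continuous in
    the plane at every point of a closed path. *)
Definition contOn (a b : R) (f : R -> R) := forall t, a <= t <= b -> {for t, continuous f}.

Lemma contOn_integrable a b f : contOn a b f -> leb.-integrable `[a, b] (EFin \o f).
Proof.
move=> cf; apply: continuous_compact_integrable; first exact: segment_compact.
by apply: continuous_in_subspaceT => t; rewrite inE /= in_itv /= => /cf.
Qed.

Lemma fine_itv (a b : R) : a <= b -> fine (leb `[a, b]) = b - a.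
Proof.
rewrite lebesgue_measure_itv /= lte_fin le_eqVlt => /predU1P[->|->//] /=.
by rewrite ltxx subrr.
Qed.

Lemma itv_fin (a b : R) : (leb `[a, b] < +oo)%E.
Proof. by apply: compact_finite_measure; exact: segment_compact. Qed.

Local Notation I a b f := (\int[leb]_(t in `[a, b]) f t).

Lemma I_near_cst a b f c M : a <= b -> contOn a b f ->
  (forall t, a <= t <= b -> `|f t - c| <= M) ->
  `|I a b f - c * (b - a)| <= M * (b - a).
Proof.
move=> ab cf H; rewrite -fine_itv//.
apply: Rintegral_near_cst; [by []|exact: itv_fin|exact: contOn_integrable|].
by move=> t; rewrite /= in_itv; exact: H.
Qed.

Lemma I_cat a b c f : a <= b -> b <= c -> contOn a c f -> I a c f = I a b f + I b c f.
Proof.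
move=> ab bc cf.
have := @Rintegral_itvB R f (BLeft a) (BRight c) b (contOn_integrable cf).
rewrite Rintegral_itv_obnd_cbnd; last first.
  apply: integrableS (contOn_integrable cf) => //.
  by apply: subset_itvr; rewrite bnd_simp.
by rewrite !bnd_simp => <- //; rewrite subrKC.
Qed.

Lemma I_D a b f g : contOn a b f -> contOn a b g ->
  I a b (fun t => f t + g t) = I a b f + I a b g.
Proof. by move=> cf cg; rewrite RintegralD//; exact: contOn_integrable. Qed.

Lemma I_B a b f g : contOn a b f -> contOn a b g ->
  I a b (fun t => f t - g t) = I a b f - I a b g.
Proof. by move=> cf cg; rewrite RintegralB//; exact: contOn_integrable. Qed.

Lemma I_Z a b k f : contOn a b f -> I a b (fun t => k * f t) = k * I a b f.
Proof. by move=> cf; rewrite RintegralZl//; exact: contOn_integrable. Qed.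

Lemma I_ext a b f g : (forall t, a <= t <= b -> f t = g t) -> I a b f = I a b g.
Proof. by move=> fg; apply: eq_Rintegral => t; rewrite inE /= in_itv; exact: fg. Qed.

Lemma I_ge0 a b f : (forall t, a <= t <= b -> 0 <= f t) -> 0 <= I a b f.
Proof. by move=> f0; apply: Rintegral_ge0 => t; rewrite /= in_itv; exact: f0. Qed.

End RealIntegral.

Section Goursat.
Variable R : realType.
Local Notation C := R[i].
Local Notation Re := (@complex.Re R).
Local Notation Im := (@complex.Im R).
Local Notation leb := (@lebesgue_measure R).
Local Notation I a b f := (\int[leb]_(t in `[a, b]) f t).

(** The compactness half of a bisection argument. Only the lower left corner is recorded, since the
    side lengths at level [n] are forced; the dependent choice runs over triples because the step
    depends on [n]. *)
Lemma nested_rectangles (P : nat -> R -> R -> Prop) (w h x0 y0 : R) :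
  0 <= w -> 0 <= h -> P 0%N x0 y0 ->
  (forall n x y, P n x y -> exists x' y', [/\ P n.+1 x' y',
     x <= x' /\ x' + w / 2 ^+ n.+1 <= x + w / 2 ^+ n &
     y <= y' /\ y' + h / 2 ^+ n.+1 <= y + h / 2 ^+ n]) ->
  exists X Y, forall n, exists x y, [/\ P n x y, x <= X <= x + w / 2 ^+ n &
     y <= Y <= y + h / 2 ^+ n].
Proof.
move=> w0 h0 P0 step.
pose T := {t : nat * R * R | P t.1.1 t.1.2 t.2}.
pose rel (s t : T) := [/\ (sval t).1.1 = (sval s).1.1.+1,
  (sval s).1.2 <= (sval t).1.2 /\ (sval t).1.2 + w / 2 ^+ (sval t).1.1 <= (sval s).1.2 + w / 2 ^+ (sval s).1.1 &
  (sval s).2 <= (sval t).2 /\ (sval t).2 + h / 2 ^+ (sval t).1.1 <= (sval s).2 + h / 2 ^+ (sval s).1.1].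
have ex (s : T) : {t : T | rel s t}.
  apply: cid; case: s => -[[n x] y] /= Pn.
  have [x' [y' [P' hx hy]]] := step _ _ _ Pn.
  by exists (exist _ (n.+1, x', y') P').
have [f [f0 fS]] := dependent_choice ex (exist _ (0%N, x0, y0) P0).
have idx n : (sval (f n)).1.1 = n.
  by elim: n => [|n IH]; [rewrite f0 | have [-> _ _] := fS n; rewrite IH].
pose xs n := (sval (f n)).1.2; pose ys n := (sval (f n)).2.
(* One coordinate at a time: left ends increase and right ends decrease, so the supremum of the left
   ends lies in every interval. *)
have gen (zs : nat -> R) (l : R) : 0 <= l ->
    (forall n, zs n <= zs n.+1 /\ zs n.+1 + l / 2 ^+ n.+1 <= zs n + l / 2 ^+ n) ->
    exists Z, forall n, zs n <= Z <= zs n + l / 2 ^+ n.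
  move=> l0 H.
  have mono n k : zs n <= zs (n + k)%N /\ zs (n + k)%N + l / 2 ^+ (n + k) <= zs n + l / 2 ^+ n.
    elim: k => [|k [IH1 IH2]]; first by rewrite addn0.
    by have [] := H (n + k)%N; rewrite addnS => a b; split; lra.
  have pos n : 0 <= l / 2 ^+ n by rewrite divr_ge0// exprn_ge0.
  have ub n : ubound (range zs) (zs n + l / 2 ^+ n).
    move=> _ [m _ <-]; have [nm|mn] := leqP n m.
      by have [_] := mono n (m - n)%N; rewrite subnKC//; have := pos m; lra.
    by have [+ _] := mono m (n - m)%N; rewrite subnKC 1?ltnW//; have := pos n; lra.
  exists (sup (range zs)) => n; apply/andP; split.
    by apply: ub_le_sup; [exists (zs 0%N + l / 2 ^+ 0) | exists n].
  by apply: ge_sup => //; exists (zs 0%N), 0%N.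
have [n|X HX] := gen xs w w0.
  by have [_ + _] := fS n; rewrite /xs !idx.
have [n|Y HY] := gen ys h h0.
  by have [_ _ +] := fS n; rewrite /ys !idx.
exists X, Y => n; exists (xs n), (ys n); split => //.
by have := svalP (f n); rewrite idx.
Qed.

Definition ccont (F : C -> C) z := forall e : R, 0 < e ->
  exists2 r : R, 0 < r & forall h, cabs h < r -> cabs (F (z + h) - F z) < e.

Lemma ccont_path (F : C -> C) (gam : R -> C) (t L : R) : ccont F (gam t) ->
  (forall k, cabs (gam (t + k) - gam t) <= L * `|k|) ->
  {for t, continuous (fun s => Re (F (gam s)))} /\ {for t, continuous (fun s => Im (F (gam s)))}.
Proof.
move=> cF lip.
have L1 : 0 < `|L| + 1 by have := normr_ge0 L; lra.
have H e : 0 < e -> exists2 r : R, 0 < r & forall s, `|t - s| < r -> cabs (F (gam t) - F (gam s)) < e.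
  move=> e0; have [r r0 hr] := cF e e0; exists (r / (`|L| + 1)); first exact: divr_gt0.
  move=> s; rewrite distrC ltr_pdivlMr// => hs.
  have := hr (gam s - gam t); rewrite subrKC [cabs (F _ - _)]cabsB; apply.
  have := lip (s - t); rewrite subrKC => /le_lt_trans; apply.
  apply: le_lt_trans hs; rewrite mulrC; apply: ler_wpM2l => //.
  by have := ler_norm L; lra.
split; apply/cvgrPdist_lt => e /H[r r0 hr]; near=> s.
  apply: le_lt_trans (hr s _); first by rewrite -Re_opp -Re_add normRe.
  by near: s; exists r.
apply: le_lt_trans (hr s _); first by rewrite -Im_opp -Im_add normIm.
by near: s; exists r.
Unshelve. all: by end_near. Qed.

(** The real part of the counterclockwise contour integral of [F] along the boundary. The imaginary
    part is reached by passing from [F] to [i F]. *)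
Definition rect_circulation (F : C -> C) (x y w h : R) : R :=
  I x (x + w) (fun s => Re (F (Complex s y)) - Re (F (Complex s (y + h)))) +
  I y (y + h) (fun t => Im (F (Complex x t)) - Im (F (Complex (x + w) t))).
Local Notation J := rect_circulation.

Section ContRect.
Variables (F : C -> C) (x0 y0 w0 h0 : R).
Hypothesis cF : forall x y, x0 <= x <= x0 + w0 -> y0 <= y <= y0 + h0 -> ccont F (Complex x y).

Lemma slice_h x w y : x0 <= x -> x + w <= x0 + w0 -> y0 <= y <= y0 + h0 ->
  contOn x (x + w) (fun s => Re (F (Complex s y))).
Proof.
move=> hx hw hy t /andP[t1 t2].
apply: (proj1 (@ccont_path F (fun s => Complex s y) t 1 _ _)).
  by apply: cF => //; lra.
move=> k; have -> : Complex (t + k) y - Complex t y = cR k.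
  by apply: complex_ext; rewrite !ReImE /=; ring.
by rewrite cabs_cR mul1r.
Qed.

Lemma slice_v y h x : y0 <= y -> y + h <= y0 + h0 -> x0 <= x <= x0 + w0 ->
  contOn y (y + h) (fun s => Im (F (Complex x s))).
Proof.
move=> hx hw hy t /andP[t1 t2].
apply: (proj2 (@ccont_path F (fun s => Complex x s) t 1 _ _)).
  by apply: cF => //; lra.
move=> k; have -> : Complex x (t + k) - Complex x t = Complex 0 1 * cR k.
  by apply: complex_ext; rewrite !ReImE /=; ring.
by rewrite cabsM cabs_cR cabsE /= expr0n expr1n add0r sqrtr1.
Qed.

Let side_h a b z := I a b (fun s => Re (F (Complex s z))).
Let side_v a b z := I a b (fun s => Im (F (Complex z s))).

Lemma side_h_cat a b c z : a <= b -> b <= c -> x0 <= a -> c <= x0 + w0 ->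
  y0 <= z <= y0 + h0 -> side_h a c z = side_h a b z + side_h b c z.
Proof.
move=> ab bc ha hc hz; apply: I_cat => //.
by have := @slice_h a (c - a) z; rewrite subrKC; apply.
Qed.

Lemma side_v_cat a b c z : a <= b -> b <= c -> y0 <= a -> c <= y0 + h0 ->
  x0 <= z <= x0 + w0 -> side_v a c z = side_v a b z + side_v b c z.
Proof.
move=> ab bc ha hc hz; apply: I_cat => //.
by have := @slice_v a (c - a) z; rewrite subrKC; apply.
Qed.

Lemma circulation_sides x y w h : 0 <= w -> 0 <= h ->
  x0 <= x -> x + w <= x0 + w0 -> y0 <= y -> y + h <= y0 + h0 ->
  J F x y w h = side_h x (x + w) y - side_h x (x + w) (y + h) +
    (side_v y (y + h) x - side_v y (y + h) (x + w)).
Proof.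
move=> w_ge0 h_ge0 x1 x2 y1 y2; rewrite /J !I_B//; first [apply: slice_h | apply: slice_v];
  by [|clear -w_ge0 h_ge0 x1 x2 y1 y2; lra].
Qed.

Lemma circulation_quarters x y w h : 0 <= w -> 0 <= h ->
  x0 <= x -> x + (w + w) <= x0 + w0 -> y0 <= y -> y + (h + h) <= y0 + h0 ->
  J F x y (w + w) (h + h) =
  J F x y w h + J F (x + w) y w h + J F x (y + h) w h + J F (x + w) (y + h) w h.
Proof.
move=> w_ge0 h_ge0 x1 x2 y1 y2; rewrite !circulation_sides; try (clear -w_ge0 h_ge0 x1 x2 y1 y2; lra).
rewrite (@side_h_cat x (x + w) (x + (w + w)) y); try (clear -w_ge0 h_ge0 x1 x2 y1 y2; lra).
rewrite (@side_h_cat x (x + w) (x + (w + w)) (y + (h + h))); try (clear -w_ge0 h_ge0 x1 x2 y1 y2; lra).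
rewrite (@side_v_cat y (y + h) (y + (h + h)) x); try (clear -w_ge0 h_ge0 x1 x2 y1 y2; lra).
rewrite (@side_v_cat y (y + h) (y + (h + h)) (x + (w + w))); try (clear -w_ge0 h_ge0 x1 x2 y1 y2; lra).
rewrite !addrA; move: side_h side_v => H V; ring.
Qed.

Lemma circulation_small x y w h d z e : 0 <= w -> 0 <= h ->
  x0 <= x -> x + w <= x0 + w0 -> y0 <= y -> y + h <= y0 + h0 ->
  (forall a b, x <= a <= x + w -> y <= b <= y + h ->
     cabs (F (Complex a b) - F z - d * (Complex a b - z)) <= e) ->
  `|J F x y w h| <= 2 * e * (w + h).
Proof.
move=> w_ge0 h_ge0 x1 x2 y1 y2 H; rewrite /J.
(* The affine part of [F] contributes [Im d * h * w] along the horizontal sides and the opposite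
   along the vertical ones, so only the error [e] survives. *)
have A : `|I x (x + w) (fun s => Re (F (Complex s y)) - Re (F (Complex s (y + h)))) - Im d * h * (x + w - x)| <= (e + e) * (x + w - x).
  apply: I_near_cst; first lra.
    move=> t ht; apply: continuousB; first by apply: (@slice_h x w y) => //; lra.
    by apply: (@slice_h x w (y + h)) => //; lra.
  move=> t ht.
  have H1 : cabs (F (Complex t y) - F z - d * (Complex t y - z)) <= e by apply: H; lra.
  have H2 : cabs (F (Complex t (y + h)) - F z - d * (Complex t (y + h) - z)) <= e by apply: H; lra.
  have := le_trans (normRe _) H1; have := le_trans (normRe _) H2.
  rewrite !ReImE /= !ler_norml => /andP[? ?] /andP[? ?]; apply/andP; split; nra.
have B : `|I y (y + h) (fun t => Im (F (Complex x t)) - Im (F (Complex (x + w) t))) - (- Im d * w) * (y + h - y)| <= (e + e) * (y + h - y).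
  apply: I_near_cst; first lra.
    move=> t ht; apply: continuousB; first by apply: (@slice_v y h x) => //; lra.
    by apply: (@slice_v y h (x + w)) => //; lra.
  move=> t ht.
  have H1 : cabs (F (Complex x t) - F z - d * (Complex x t - z)) <= e by apply: H; lra.
  have H2 : cabs (F (Complex (x + w) t) - F z - d * (Complex (x + w) t - z)) <= e by apply: H; lra.
  have := le_trans (normIm _) H1; have := le_trans (normIm _) H2.
  rewrite !ReImE /= !ler_norml => /andP[? ?] /andP[? ?]; apply/andP; split; nra.
have comb (P Q a b e1 e2 : R) : `|P - a| <= e1 -> `|Q - b| <= e2 -> a + b = 0 -> `|P + Q| <= e1 + e2.
  by rewrite !ler_norml => /andP[? ?] /andP[? ?] ?; apply/andP; split; lra.
have := comb _ _ _ _ _ _ A B; rewrite (_ : 2 * e * (w + h) = (e + e) * (x + w - x) + (e + e) * (y + h - y)); last by ring.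
by apply; ring.
Qed.

End ContRect.

Theorem goursat (F : C -> C) (x0 y0 w h : R) : 0 <= w -> 0 <= h ->
  (forall x y, x0 <= x <= x0 + w -> y0 <= y <= y0 + h -> exists d, cderiv F (Complex x y) d) ->
  J F x0 y0 w h = 0.
Proof.
move=> w0 h0 H.
have cF x y : x0 <= x <= x0 + w -> y0 <= y <= y0 + h -> ccont F (Complex x y).
  by move=> hx hy; have [d /cderiv_cont] := H x y hx hy.
apply/eqP; rewrite -normr_eq0; apply/negPn/negP => J0.
set m := `|J F x0 y0 w h| in J0; have m0 : 0 < m by rewrite lt_def J0 normr_ge0.
(* One of four quarters keeps a quarter of the circulation, whence powers of 4 against powers of 2
   for the sides. *)
pose P n x y := [/\ x0 <= x, x + w / 2 ^+ n <= x0 + w, y0 <= y, y + h / 2 ^+ n <= y0 + h &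
  m / 4 ^+ n <= `|J F x y (w / 2 ^+ n) (h / 2 ^+ n)|].
have P0 : P 0%N x0 y0 by rewrite /P !expr0 !divr1; split.
have pos l n : 0 <= l -> 0 <= l / 2 ^+ n by move=> l0; rewrite divr_ge0// exprn_ge0.
have half l n : l / 2 ^+ n = l / 2 ^+ n.+1 + l / 2 ^+ n.+1 :> R.
  by rewrite exprS; field; rewrite expf_neq0.
have [n x y [x1 x2 y1 y2 Jn]|X [Y HXY]] := nested_rectangles w0 h0 P0.
  move: Jn x2 y2; rewrite (half w n) (half h n); set w' := w / _; set h' := h / _ => Jn x2 y2.
  have w'0 : 0 <= w' by exact: pos.
  have h'0 : 0 <= h' by exact: pos.
  have sum4 : m / 4 ^+ n <= `|J F x y w' h'| + `|J F (x + w') y w' h'| + `|J F x (y + h') w' h'| + `|J F (x + w') (y + h') w' h'|.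
    apply: le_trans Jn _; rewrite (circulation_quarters cF)//.
    apply: le_trans (ler_normD _ _) _; rewrite lerD2r.
    apply: le_trans (ler_normD _ _) _; rewrite lerD2r.
    exact: ler_normD.
  have m4 : m / 4 ^+ n = 4 * (m / 4 ^+ n.+1).
    by rewrite exprS; field; rewrite expf_neq0.
  have C x' y' : x <= x' <= x + w' -> y <= y' <= y + h' ->
      m / 4 ^+ n.+1 <= `|J F x' y' w' h'| -> exists x' y', [/\ P n.+1 x' y',
     x <= x' /\ x' + w / 2 ^+ n.+1 <= x + (w' + w') &
     y <= y' /\ y' + h / 2 ^+ n.+1 <= y + (h' + h')].
    move=> /andP[xx' x'w] /andP[yy' y'h] J'; exists x', y'.
    have xw : x' + w' <= x + (w' + w') by rewrite addrA lerD2r.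
    have yh : y' + h' <= y + (h' + h') by rewrite addrA lerD2r.
    split => //; split => //.
    - exact: le_trans xx'.
    - exact: le_trans x2.
    - exact: le_trans yy'.
    - exact: le_trans y2.
  have [xr yr] : (x <= x + w') /\ (y <= y + h') by rewrite !lerDl.
  have [|a] := leP (m / 4 ^+ n.+1) `|J F x y w' h'|.
    by apply: C; rewrite ?lexx ?xr ?yr.
  have [|b] := leP (m / 4 ^+ n.+1) `|J F (x + w') y w' h'|.
    by apply: C; rewrite ?lexx ?xr ?yr.
  have [|c] := leP (m / 4 ^+ n.+1) `|J F x (y + h') w' h'|.
    by apply: C; rewrite ?lexx ?xr ?yr.
  apply: (C (x + w') (y + h')); rewrite ?lexx ?xr ?yr//.
  clear -sum4 m4 a b c; lra.
have [x [y [[x1 x2 y1 y2 _] xX yY]]] : exists x y, [/\ P 0%N x y, x <= X <= x + w / 2 ^+ 0 & y <= Y <= y + h / 2 ^+ 0] by exact: HXY.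
have [d dF] : exists d, cderiv F (Complex X Y) d.
  by apply: H; move: x1 x2 y1 y2 xX yY; rewrite !expr0 !divr1; lra.
(* Makes [2 * e * (w + h) ^+ 2] smaller than [m]; the [+ 1] keeps the denominator positive for a
   degenerate rectangle. *)
pose e := m / (4 * (w + h + 1) ^+ 2).
have e0 : 0 < e by rewrite divr_gt0// mulr_gt0// exprn_gt0//; lra.
have [r r0 hr] := dF e e0.
have [n hn] : exists n, (w + h) / 2 ^+ n < r.
  exists (Num.bound ((w + h) / r)).
  rewrite ltr_pdivrMr ?exprn_gt0// mulrC -ltr_pdivrMr//.
  apply: lt_le_trans (archi_boundP _) _; first by rewrite divr_ge0 ?addr_ge0// ltW.
  by rewrite -natrX ler_nat ltnW// ltn_expl.
have [x' [y' [[x1' x2' y1' y2' Jn] xX' yY']]] := HXY n.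
move: Jn x2' y2' xX' yY'; set w' := w / _; set h' := h / _ => Jn x2' y2' xX' yY'.
have w'0 : 0 <= w' by exact: pos.
have h'0 : 0 <= h' by exact: pos.
have D a b : x' <= a <= x' + w' -> y' <= b <= y' + h' -> cabs (Complex a b - Complex X Y) <= w' + h'.
  move=> ha hb; apply: le_trans (cabs_ReIm _) _; rewrite !ReImE /=.
  clear -ha hb xX' yY'; apply: lerD; rewrite ler_norml; apply/andP; split; lra.
have JJ : `|J F x' y' w' h'| <= 2 * (e * (w' + h')) * (w' + h').
  apply: (@circulation_small F x0 y0 w h cF x' y' w' h' d (Complex X Y)) => // a b ha hb.
  have := hr (Complex a b - Complex X Y); rewrite subrKC.
  have := D a b ha hb => Dab.
  move=> /(_ _)/le_trans; apply.
    by apply: le_lt_trans Dab _; rewrite -mulrDl.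
  by apply: ler_wpM2l => //; exact: ltW.
have : m / 4 ^+ n <= 2 * e * (w + h) ^+ 2 / 4 ^+ n.
  apply: le_trans Jn _; apply: le_trans JJ _.
  rewrite -!mulrDl le_eqVlt; apply/orP; left; apply/eqP.
  have -> : 4 ^+ n = 2 ^+ n * 2 ^+ n :> R by rewrite -exprMn; congr (_ ^+ _); ring.
  by field; rewrite expf_neq0.
rewrite ler_pM2r ?invr_gt0 ?exprn_gt0//.
rewrite /e => mm.
have : 2 * (m / (4 * (w + h + 1) ^+ 2)) * (w + h) ^+ 2 = m * ((w + h) ^+ 2 / (2 * (w + h + 1) ^+ 2)).
  by field; lra.
have : (w + h) ^+ 2 / (2 * (w + h + 1) ^+ 2) < 1.
  rewrite ltr_pdivrMr; last by rewrite mulr_gt0// exprn_gt0//; lra.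
  nra.
nra.
Qed.
End Goursat.

(** * Extreme values on compact sets of the plane *)

Section Plane.
Variable R : realType.
Local Notation C := R[i].
Local Notation Re := (@complex.Re R).
Local Notation Im := (@complex.Im R).

Definition rcont (u : C -> R) z := forall e : R, 0 < e ->
  exists2 r : R, 0 < r & forall h, cabs h < r -> `|u (z + h) - u z| < e.

(** Closedness and continuity are phrased with [cabs], in the form in which they are checked later;
    compactness is that of a square in [R * R]. *)
Lemma plane_EVT_min (A : C -> Prop) (u : C -> R) (M : R) :
  (exists z, A z) -> (forall z, A z -> cabs z <= M) ->
  (forall z, ~ A z -> exists2 r : R, 0 < r & forall h, cabs h < r -> ~ A (z + h)) ->
  (forall z, A z -> rcont u z) ->
  exists2 z0, A z0 & forall z, A z -> u z0 <= u z.
Proof.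
move=> [z1 Az1] AM clA cu.
pose A' : set (R * R) := [set p | A (Complex p.1 p.2)].
pose u' (p : R * R) := u (Complex p.1 p.2).
have near_plane (p : R * R) (r : R) (Q : C -> Prop) : 0 < r ->
    (forall h, cabs h < r -> Q (Complex p.1 p.2 + h)) -> \forall q \near p, Q (Complex q.1 q.2).
  (* Half the radius, because the modulus is bounded by the sum of the two coordinates. *)
  move=> r0 H; apply/nbhs_ballP; exists (r / 2) => /=; first by lra.
  move=> q [/= b1 b2].
  have := H (Complex (q.1 - p.1) (q.2 - p.2)).
  have -> : Complex p.1 p.2 + Complex (q.1 - p.1) (q.2 - p.2) = Complex q.1 q.2.
    by apply: complex_ext; rewrite !ReImE /=; ring.
  apply; apply: le_lt_trans (cabs_ReIm _) _ => /=.
  move: b1 b2; rewrite /ball /= [`|p.1 - _|]distrC [`|p.2 - _|]distrC; lra.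
have cA : compact A'.
  have sub : A' `<=` `[- M, M] `*` `[- M, M].
    move=> [x y] /AM; rewrite /= !in_itv /= -!ler_norml => h.
    by split; apply: le_trans h; [exact: (normRe (Complex x y))|exact: (normIm (Complex x y))].
  apply: subclosed_compact sub; last first.
    by apply: compact_setX; exact: segment_compact.
  rewrite -[A']setCK; apply: open_closedC; rewrite openE => p /clA[r r0 hr].
  exact: (near_plane p r (fun z => ~ A z)).
have [||c] := @compact_EVT_min _ R u' A' _ cA.
- by exists (Re z1, Im z1); move: Az1; rewrite /A' /=; case: (z1).
- apply: continuous_in_subspaceT => p; rewrite inE => Ap.
  apply/cvgrPdist_lt => e /(cu _ Ap)[r r0 hr].
  apply: (near_plane p r (fun z => `|u' p - u z| < e) r0) => h /hr.
  by rewrite distrC.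
rewrite inE => Ac cmin; exists (Complex c.1 c.2) => // -[x y] Az.
by apply: (cmin (x, y)); rewrite inE.
Qed.

Lemma ccont_ext_cabs F (z : C) : ccont F z -> rcont (fun w => cabs (F w)) z.
Proof.
move=> cF e /cF[r r0 hr]; exists r => // h /hr; apply: le_lt_trans.
rewrite ler_norml; apply/andP; split.
  by have := cabsD (F (z + h)) (F z - F (z + h)); rewrite subrKC [cabs (F z - _)]cabsB; lra.
by have := cabsD (F z) (F (z + h) - F z); rewrite subrKC; lra.
Qed.

Lemma ccont_bounded F (a : C) r : (forall z, cabs (z - a) <= r -> ccont F z) ->
  exists M, forall z, cabs (z - a) <= r -> cabs (F z) <= M.
Proof.
move=> cF; have [r0|r0] := ltP r 0.
  by exists 0 => z h; have := cabs_ge0 (z - a); lra.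
have [||z Hz|z Hz|z0 Az0 Hmin] := @plane_EVT_min (fun z => cabs (z - a) <= r) (fun z => - cabs (F z)) (r + cabs a).
- by exists a; rewrite subrr cabs0.
- by move=> z h; have := cabsD (z - a) a; rewrite subrK; lra.
- exists (cabs (z - a) - r); first by move/negP: Hz; rewrite -ltNge; lra.
  move=> h hh Hzh; have := cabsD (z + h - a) (- h).
  have -> : z + h - a - h = z - a by ring.
  by rewrite cabsN; lra.
- move=> e /(ccont_ext_cabs (cF _ Hz))[d d0 hd]; exists d => // h /hd.
  by rewrite -opprD normrN.
exists (cabs (F z0)) => z /Hmin; lra.
Qed.

End Plane.

(** * Circle means *)

Section CircleMeans.
Variable R : realType.
Local Notation C := R[i].
Local Notation Re := (@complex.Re R).
Local Notation Im := (@complex.Im R).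
Local Notation leb := (@lebesgue_measure R).
Local Notation I a b f := (\int[leb]_(t in `[a, b]) f t).
Local Notation lo := (@negligible_increment R).

Lemma mean_value (f df : R -> R) (a b : R) : a <= b ->
  (forall t : R, a <= t <= b -> is_derive t 1 f (df t)) ->
  exists2 c, a <= c <= b & f b - f a = df c * (b - a).
Proof.
move=> ab H; have [||c] := @MVT_segment R f df a b ab.
- by move=> t; rewrite in_itv /= => /andP[? ?]; apply: H; rewrite !ltW.
- apply: continuous_in_subspaceT => t; rewrite inE /= in_itv /= => /H[D _].
  by apply: differentiable_continuous; exact/derivable1_diffP.
by rewrite in_itv /= => hc E; exists c.
Qed.

Lemma lipschitz_of_derive (f df : R -> R) (M : R) : (forall t : R, is_derive t 1 f (df t)) ->
  (forall t, `|df t| <= M) -> forall s k : R, `|f (s + k) - f s| <= M * `|k|.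
Proof.
move=> df' H s k; have [k0|k0] := leP 0 k.
  have sk : s <= s + k by rewrite lerDl.
  have [c _ ->] := mean_value sk (fun t _ => df' t).
  by rewrite addrAC subrr add0r normrM ler_wpM2r.
have sk : s + k <= s by rewrite gerDl ltW.
have [c _] := mean_value sk (fun t _ => df' t).
rewrite distrC => ->; rewrite opprD addrA subrr sub0r normrM normrN.
by rewrite ler_wpM2r.
Qed.

Lemma expi_lip (t k : R) : cabs (expi (t + k) - expi t) <= 2 * `|k|.
Proof.
apply: le_trans (cabs_ReIm _) _; rewrite !ReImE /= mulr_natl mulr2n.
apply: lerD; rewrite -[leRHS]mul1r.
  apply: (@lipschitz_of_derive cos (fun t => - sin t)) => s.
  by rewrite normrN ler_norml sin_geN1 sin_le1.
apply: (@lipschitz_of_derive sin (fun t => cos t)) => s.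
by rewrite ler_norml cos_geN1 cos_le1.
Qed.

Lemma circle_lip (a : C) (rho t k : R) :
  cabs (a + cR rho * expi (t + k) - (a + cR rho * expi t)) <= `|rho| * 2 * `|k|.
Proof.
have -> : a + cR rho * expi (t + k) - (a + cR rho * expi t) = cR rho * (expi (t + k) - expi t) by ring.
by rewrite cabsM cabs_cR -mulrA ler_wpM2l// expi_lip.
Qed.

Lemma circle_contOn F a rho : (forall z, cabs (z - a) = `|rho| -> ccont F z) ->
  contOn 0 (2 * pi) (fun t => Re (F (a + cR rho * expi t))) /\
  contOn 0 (2 * pi) (fun t => Im (F (a + cR rho * expi t))).
Proof.
move=> H; have K t : ccont F (a + cR rho * expi t).
  by apply: H; rewrite addrC addKr cabsM cabs_cR cabs_expi mulr1.
by split=> t _; have [? ?] := @ccont_path _ F (fun s => a + cR rho * expi s) t _ (K t) (circle_lip a rho t).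
Qed.

Definition cexp (z : C) : C := cR (expR (Re z)) * expi (Im z).

Lemma cexpD z w : cexp (z + w) = cexp z * cexp w.
Proof. by rewrite /cexp !ReImE expRD cRM expiD mulrACA. Qed.

Lemma cabs_cexp z : cabs (cexp z) = expR (Re z).
Proof. by rewrite /cexp cabsM cabs_cR cabs_expi mulr1 gtr0_norm ?expR_gt0. Qed.

Lemma derive_lo (f : R -> R) (d : R) (p : C -> R) : is_derive (0 : R) 1 f d ->
  (forall h, `|p h| <= cabs h) -> lo (fun h => `|f (p h) - f 0 - d * p h|).
Proof.
move=> df Hp e e0; have [r r0 hr] := derive_eps df e0; exists r => // h hh.
have := hr (p h); rewrite add0r => H.
apply: le_trans (H _) _; first exact: le_lt_trans (Hp h) hh.
by apply: ler_wpM2l => //; exact: ltW.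
Qed.

Lemma cderiv_cexp z : cderiv cexp z (cexp z).
Proof.
(* By the functional equation [cexpD], the differential at 0 determines all others. *)
have L0 : lo (fun h => cabs (cexp h - 1 - h)).
  have l1 : lo (fun h => `|expR (Re h) - expR 0 - 1 * Re h|).
    apply: derive_lo => [|h]; last exact: normRe.
    by rewrite -[X in is_derive _ _ _ X]expR0; exact: is_derive_expR.
  have l2 : lo (fun h => `|cos (Im h) - cos 0 - (- 0) * Im h|).
    apply: derive_lo => [|h]; last exact: normIm.
    by rewrite -[X in is_derive _ _ _ (- X)]sin0; exact: is_derive_cos.
  have l3 : lo (fun h => `|sin (Im h) - sin 0 - 1 * Im h|).
    apply: derive_lo => [|h]; last exact: normIm.
    by rewrite -[X in is_derive _ _ _ X]cos0; exact: is_derive_sin.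
  have l4 : lo (fun h => 1 * cabs h ^+ 2) by apply: (@lo_sq _ 1 1).
  have [r r0 hr] := l1 1 ltr01.
  have m0 : 0 < Num.min r 1 by rewrite lt_min r0 ltr01.
  have k3 : 0 <= 3 :> R by [].
  have k2 : 0 <= 2 :> R by [].
  (* The weight 3 bounds [expR (Re h)] for small [h] with [cabs h < 1]; the quadratic term with
     weight 2 absorbs [(expR (Re h) - 1) * Im h]. *)
  apply: (lo_le m0) (loD (loD (loD l1 (loZ k3 l2)) (loZ k3 l3)) (loZ k2 l4)) => h.
  rewrite lt_min => /andP[/hr + h1].
  move=> + ; rewrite mul1r => EH; apply: le_trans (cabs_ReIm _) _; move: EH.
  rewrite !ReImE /cexp /= expR0 cos0 sin0 oppr0 !mul0r !subr0 !mul1r => EH.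
  have := normRe h; have := normIm h; have := expR_gt0 (Re h).
  move: (cabs h) h1 EH => H H1; move: (Re h) (Im h) => X Y.
  move: (expR X) (cos Y) (sin Y) => E c s EH E0 YH XH.
  have E3 : E <= 3 by move: EH XH; rewrite !ler_norml => /andP[? ?] /andP[? ?]; lra.
  have E1 : `|E - 1| <= 2 * H.
    by move: EH XH; rewrite !ler_norml => /andP[? ?] /andP[? ?]; apply/andP; split; lra.
  have -> : E * c - 1 - X = E * (c - 1) + (E - 1 - X) by ring.
  have -> : E * s + 0 + 0 - Y = E * (s - Y) + (E - 1) * Y by ring.
  have := ler_normD (E * (c - 1)) (E - 1 - X).
  have := ler_normD (E * (s - Y)) ((E - 1) * Y).
  rewrite !normrM (ger0_norm (ltW E0)).
  have : `|E - 1| * `|Y| <= 2 * H * H by apply: ler_pM.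
  have := ler_wpM2r (normr_ge0 (c - 1)) E3.
  have := ler_wpM2r (normr_ge0 (s - Y)) E3.
  rewrite addr0 expr2; lra.
apply: (lo_le ltr01) (loZ (cabs_ge0 (cexp z)) L0) => h _.
rewrite -cabsM cexpD le_eqVlt; apply/orP; left; apply/eqP; congr cabs; ring.
Qed.

(** In the coordinate [z = a + cexp zeta] an annulus becomes a rectangle and [dz / (z - a)] becomes
    [d zeta]. The horizontal sides cancel by periodicity, and Goursat's theorem equates the vertical
    ones, which are the two circle means. *)
Lemma punctured_circle_const_Im (Phi : C -> C) a r rho1 rho2 :
  (forall z, 0 < cabs (z - a) < r -> exists d, cderiv Phi z d) ->
  0 < rho1 -> rho1 <= rho2 -> rho2 < r ->
  I 0 (2 * pi) (fun t => Im (Phi (a + cR rho1 * expi t))) =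
  I 0 (2 * pi) (fun t => Im (Phi (a + cR rho2 * expi t))).
Proof.
move=> H r1 r12 r2; have r20 : 0 < rho2 by lra.
have pi0 := pi_gt0 R.
have lnle : ln rho1 <= ln rho2 by rewrite ler_ln.
pose F (z : C) := Phi (a + cexp z).
have FE s y : F (Complex s y) = Phi (a + cR (expR s) * expi y) by [].
have := @goursat R F (ln rho1) 0 (ln rho2 - ln rho1) (2 * pi).
rewrite /rect_circulation subrKC add0r => /(_ _ _ _) G.
have {G} : I (ln rho1) (ln rho2) (fun s => Re (F (Complex s 0)) - Re (F (Complex s (2 * pi)))) +
  I 0 (2 * pi) (fun t => Im (F (Complex (ln rho1) t)) - Im (F (Complex (ln rho2) t))) = 0.
  apply: G; [lra|lra|move=> x y hx hy].
  have [d dPhi] : exists d, cderiv Phi (a + cexp (Complex x y)) d.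
    apply: H; rewrite addrC addKr cabs_cexp /= expR_gt0 /=.
    apply: le_lt_trans r2; rewrite -[leRHS]lnK// ler_expR; lra.
  exists (d * (0 + cexp (Complex x y))); apply: (@cderiv_comp _ (fun z => a + cexp z)) => //.
  apply: cderivD; [exact: cderiv_cst|exact: cderiv_cexp].
have -> : I (ln rho1) (ln rho2) (fun s => Re (F (Complex s 0)) - Re (F (Complex s (2 * pi)))) = 0.
  rewrite (@I_ext _ _ _ _ (fun=> 0)).
    by rewrite Rintegral_cst ?mul0r.
  move=> s _; rewrite !FE expi0.
  have -> : expi (2 * pi) = 1 :> C by rewrite /expi mulrC mulr_natr cos2pi sin2pi.
  by rewrite subrr.
rewrite add0r.
have FI rho t : 0 < rho -> F (Complex (ln rho) t) = Phi (a + cR rho * expi t).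
  by move=> rho0; rewrite FE lnK.
have cI rho : 0 < rho -> rho < r -> contOn 0 (2 * pi) (fun t => Im (F (Complex (ln rho) t))).
  move=> h1 h2; rewrite (_ : (fun t => _) = (fun t => Im (Phi (a + cR rho * expi t)))).
    apply: (proj2 (@circle_contOn Phi a rho _)) => z zr.
    have [|d /cderiv_cont//] := H z.
    by rewrite zr gtr0_norm// h1.
  by apply/funext => t; rewrite FI.
rewrite I_B; [|by apply: cI => //; lra|by apply: cI => //; lra].
move/eqP; rewrite subr_eq0 => /eqP.
rewrite (@I_ext _ _ _ _ (fun t => Im (Phi (a + cR rho1 * expi t)))); last by move=> t _; rewrite FI.
by rewrite [in X in _ = X](@I_ext _ _ _ _ (fun t => Im (Phi (a + cR rho2 * expi t)))) // => t _; rewrite FI.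
Qed.

(** Only the limit [L] at the centre enters, not the value there, so that the lemma applies to
    difference quotients. The means are independent of the radius and tend to [L] on small
    circles. *)
Lemma circle_mean_Im (Phi : C -> C) a L r rho :
  (forall z, 0 < cabs (z - a) < r -> exists d, cderiv Phi z d) ->
  (forall e : R, 0 < e -> exists2 d : R, 0 < d & forall h, 0 < cabs h < d -> cabs (Phi (a + h) - L) <= e) ->
  0 < rho < r -> I 0 (2 * pi) (fun t => Im (Phi (a + cR rho * expi t))) = 2 * pi * Im L.
Proof.
move=> H lim /andP[rho0 rhor].
have pi0 := pi_gt0 R.
apply/eqP; rewrite -subr_eq0 -normr_eq0; apply/eqP/le_anti; rewrite normr_ge0 andbT.
apply/ler_addgt0Pr => e e0; rewrite add0r.
have e'0 : 0 < e / (2 * pi) by apply: divr_gt0 => //; lra.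
have [d d0 hd] := lim _ e'0.
pose s := Num.min rho (d / 2).
have s0 : 0 < s by rewrite lt_min rho0; lra.
have sd : s < d by apply: (@le_lt_trans _ _ (d / 2)); [rewrite ge_min lexx orbT|lra].
have sr : s <= rho by rewrite ge_min lexx.
rewrite -(punctured_circle_const_Im H s0 sr rhor).
have := @I_near_cst _ 0 (2 * pi) (fun t => Im (Phi (a + cR s * expi t))) (Im L) (e / (2 * pi)).
rewrite subr0 [Im L * _]mulrC divfK; last by rewrite mulf_neq0 ?lt0r_neq0.
apply; first lra.
  apply: (proj2 (@circle_contOn Phi a s _)) => z zr.
  have [|c /cderiv_cont//] := H z.
  by rewrite zr gtr0_norm// s0; lra.
move=> t _; have := hd (cR s * expi t); rewrite cabsM cabs_cR cabs_expi mulr1 gtr0_norm// s0 sd => /(_ isT).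
by apply: le_trans; rewrite -Im_opp -Im_add normIm.
Qed.

Lemma circle_mean_Re (Phi : C -> C) a L r rho :
  (forall z, 0 < cabs (z - a) < r -> exists d, cderiv Phi z d) ->
  (forall e : R, 0 < e -> exists2 d : R, 0 < d & forall h, 0 < cabs h < d -> cabs (Phi (a + h) - L) <= e) ->
  0 < rho < r -> I 0 (2 * pi) (fun t => Re (Phi (a + cR rho * expi t))) = 2 * pi * Re L.
Proof.
move=> H lim hr.
have := @circle_mean_Im (fun z => Complex 0 1 * Phi z) a (Complex 0 1 * L) r rho.
have ReE z : Im (Complex 0 1 * z) = Re z by rewrite Im_mul /= mul0r mul1r add0r.
rewrite ReE => <- //.
- by apply: I_ext => t _; rewrite ReE.
- by move=> z /H[d dz]; exists (Complex 0 1 * d); exact: cderivZ.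
- move=> e /lim[d d0 hd]; exists d => // h /hd.
  by rewrite -mulrBr cabsM [cabs (Complex 0 1)]cabsE /= expr0n expr1n add0r sqrtr1 mul1r.
Qed.

(* The bound on both components costs a factor 2. *)
Lemma circle_mean_bound (Phi : C -> C) a L r rho M :
  (forall z, 0 < cabs (z - a) < r -> exists d, cderiv Phi z d) ->
  (forall e : R, 0 < e -> exists2 d : R, 0 < d & forall h, 0 < cabs h < d -> cabs (Phi (a + h) - L) <= e) ->
  0 < rho < r -> (forall z, cabs (z - a) = rho -> cabs (Phi z) <= M) -> cabs L <= 2 * M.
Proof.
move=> H lim hr HM; have pi0 := pi_gt0 R.
have [rho0 rhor] := andP hr.
have [c1 c2] : contOn 0 (2 * pi) (fun t => Re (Phi (a + cR rho * expi t))) /\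
  contOn 0 (2 * pi) (fun t => Im (Phi (a + cR rho * expi t))).
  apply: circle_contOn => z zr; have [|c /cderiv_cont//] := H z.
  by rewrite zr gtr0_norm.
have b t : cabs (Phi (a + cR rho * expi t)) <= M.
  by apply: HM; rewrite addrC addKr cabsM cabs_cR cabs_expi mulr1 gtr0_norm.
have p2 : 0 <= 2 * pi :> R by lra.
have := I_near_cst (c := 0) p2 c1 (fun t _ => _ : _ <= M).
have := I_near_cst (c := 0) p2 c2 (fun t _ => _ : _ <= M).
rewrite !subr0 (circle_mean_Re H lim hr) (circle_mean_Im H lim hr).
rewrite !mul0r !subr0 !normrM (@ger0_norm _ 2)// (gtr0_norm pi0).
have k t : `|Im (Phi (a + cR rho * expi t)) - 0| <= M.
  by rewrite subr0; apply: le_trans (normIm _) (b t).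
have k' t : `|Re (Phi (a + cR rho * expi t)) - 0| <= M.
  by rewrite subr0; apply: le_trans (normRe _) (b t).
move=> /(_ k); rewrite mulrC ler_pM2r; last lra.
move=> i1 /(_ k'); rewrite mulrC ler_pM2r; last lra.
by move=> i2; apply: le_trans (cabs_ReIm _) _; lra.
Qed.
End CircleMeans.

(** * Cauchy estimates and regularity of the derivative *)

Section HolomorphicDerivative.
Variable R : realType.
Local Notation C := R[i].
Local Notation Re := (@complex.Re R).
Local Notation Im := (@complex.Im R).

(** At [z = b] this is 0 by the convention on inverses, so it is used on punctured discs, with its
    limit at [b]. *)
Definition diff_quotient (G : C -> C) b z := (G z - G b) * (z - b)^-1.

Lemma cderiv_diff_quotient G b z d : z != b -> cderiv G z d ->
  exists d', cderiv (diff_quotient G b) z d'.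
Proof.
move=> zb dG; have := cderivM (cderivB dG (cderiv_cst (G b) z))
  (cderiv_comp (cderivB (cderiv_id z) (cderiv_cst b z)) (cderiv_inv _)).
by rewrite subr_eq0 => /(_ zb) H; eexists; exact: H.
Qed.

Lemma diff_quotient_lim G b d : cderiv G b d ->
  forall e : R, 0 < e -> exists2 r : R, 0 < r &
    forall h, 0 < cabs h < r -> cabs (diff_quotient G b (b + h) - d) <= e.
Proof.
move=> dG e e0; have [r r0 hr] := dG e e0; exists r => // h /andP[h0 /hr].
have h00 : h != 0 by rewrite -cabs_gt0.
have -> : diff_quotient G b (b + h) - d = (G (b + h) - G b - d * h) * h^-1.
  by rewrite /diff_quotient addrAC subrr add0r; field.
by rewrite cabsM cabsV ler_pdivrMr.
Qed.

(** The difference quotient tends to [d] at [b] and is at most [2 * M / rho] on the circle; the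
    other factor 2 is that of [circle_mean_bound]. *)
Lemma cauchy_estimate (G : C -> C) b d r rho M :
  (forall z, cabs (z - b) < r -> exists d, cderiv G z d) -> cderiv G b d ->
  0 < rho < r -> (forall z, cabs (z - b) <= rho -> cabs (G z) <= M) ->
  cabs d <= 4 * M / rho.
Proof.
move=> H dG hr HM; have [rho0 rhor] := andP hr.
have -> : 4 * M / rho = 2 * ((M + M) / rho) by field; lra.
apply: (@circle_mean_bound _ (diff_quotient G b) b d r rho _ _ (diff_quotient_lim dG) hr).
  move=> z /andP[z0 /H[dz Hz]]; apply: cderiv_diff_quotient Hz.
  by rewrite -subr_eq0 -cabs_gt0.
move=> z zr; rewrite /diff_quotient cabsM cabsV zr ler_pM2r ?invr_gt0//.
apply: le_trans (cabsD _ _) _; rewrite cabsN.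
by apply: lerD; apply: HM; rewrite ?zr// subrr cabs0 ltW.
Qed.

Lemma mean_value_ineq (F F' : C -> C) b h M :
  (forall t : R, 0 <= t <= 1 -> cderiv F (b + cR t * h) (F' (b + cR t * h))) ->
  (forall t : R, 0 <= t <= 1 -> cabs (F' (b + cR t * h)) <= M) ->
  cabs (F (b + h) - F b) <= 2 * M * cabs h.
Proof.
move=> dF HM.
have c1 : cR (1 : R) = 1 :> C by [].
have c0 : cR (0 : R) = 0 :> C by [].
(* The real mean value theorem applies to one component at a time: [w = 1] selects the real part and
   [w = -i] the imaginary part, whence the factor 2. *)
have K (w : C) : cabs w = 1 -> `|Re (w * F (b + h)) - Re (w * F b)| <= M * cabs h.
  move=> w1; have [|t t01|c c01] := @mean_value R (fun t => Re (w * F (b + cR t * h)))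
    (fun t => Re (w * F' (b + cR t * h) * h)) 0 1; first exact: ler01.
    by apply: (@rgrad_line R (fun z => Re (w * F z))); apply: cderiv_rgrad; apply: cderivZ; exact: dF.
  rewrite c1 c0 mul1r mul0r addr0 subr0 mulr1 => ->.
  apply: le_trans (normRe _) _; rewrite !cabsM w1 mul1r.
  by rewrite ler_wpM2r ?cabs_ge0// HM.
apply: le_trans (cabs_ReIm _) _.
have := K 1 (cabs1 R); rewrite !mul1r => k1.
have := K (Complex 0 (-1)); rewrite cabsE /= expr0n sqrrN expr1n add0r sqrtr1 => /(_ erefl).
rewrite !ReImE /= !mul0r !mulN1r => k2.
have e2 : 0 - - Im (F (b + h)) - (0 - - Im (F b)) = Im (F (b + h)) + - Im (F b) by ring.
rewrite e2 in k2.
have -> : 2 * M * cabs h = M * cabs h + M * cabs h by ring.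
exact: lerD.
Qed.

Section Derivative.
Variables (f f' : C -> C) (a : C) (r : R).
Hypothesis r0 : 0 < r.
Hypothesis df : forall z, cabs (z - a) < r -> cderiv f z (f' z).

(** Continuity of [f'] is not yet available; but [f] is continuous, so [f - f a] has modulus below 1
    near [a], and a Cauchy estimate on circles of fixed radius bounds [f']. *)
Lemma deriv_bounded : exists rho M, [/\ 0 < rho, rho < r, 0 <= M &
   forall z, cabs (z - a) < rho -> cabs (f' z) <= M].
Proof.
have dfa : cderiv f a (f' a) by apply: df; rewrite subrr cabs0.
have [s s0 hs] := cderiv_cont dfa ltr01.
pose rho := Num.min (r / 4) (s / 4).
have rho0 : 0 < rho by rewrite lt_min !divr_gt0.
have rr : rho <= r / 4 by rewrite ge_min lexx.
have rs : rho <= s / 4 by rewrite ge_min lexx orbT.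
exists rho, (4 * 1 / rho); split; [by []|lra|by rewrite divr_ge0// ltW|].
move=> z hz.
have sub w k : cabs (w - z) < k -> cabs (w - a) < k + rho.
  move=> wz; have -> : w - a = (w - z) + (z - a) by ring.
  by apply: le_lt_trans (cabsD _ _) _; lra.
apply: (@cauchy_estimate (fun w => f w - f a) z _ (2 * rho) rho).
- move=> w /sub wz; exists (f' w - 0); apply: cderivB; last exact: cderiv_cst.
  by apply: df; lra.
- rewrite -[f' z]subr0; apply: cderivB; last exact: cderiv_cst.
  by apply: df; lra.
- by rewrite rho0; lra.
- move=> w wz; apply: ltW; have := hs (w - a); rewrite subrKC; apply.
  have := sub w (2 * rho) _; lra.
Qed.

(** A Cauchy estimate for the increment [w |-> f (w + h) - f w], which is of order [h] by the bound
    on [f'], gives the Lipschitz bound. The mean value inequality for [w |-> f w - f' z * w] then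
    gives the quadratic remainder. *)
Lemma deriv_lipschitz : exists rho K, [/\ 0 < rho, rho < r, 0 <= K &
   forall z h, cabs (z - a) < rho -> cabs h < rho ->
     cabs (f' (z + h) - f' z) <= K * cabs h /\
     cabs (f (z + h) - f z - h * f' z) <= 2 * K * cabs h ^+ 2].
Proof.
have [s [M [s0 sr M0 HM]]] := deriv_bounded.
(* Increments by less than [2 * rho] from points within [6 * rho] of [a] stay in the disc of radius
   [s]. *)
pose rho := s / 8.
have rho0 : 0 < rho by rewrite /rho; lra.
have rs : 8 * rho = s by rewrite /rho; lra.
have near (z h : C) k l : cabs (z - a) < k -> cabs h <= l -> cabs (z + h - a) < k + l.
  move=> zk hl; have -> : z + h - a = (z - a) + h by ring.
  by apply: le_lt_trans (cabsD _ _) _; lra.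
have seg (t : R) (h : C) : 0 <= t <= 1 -> cabs (cR t * h) <= cabs h.
  move=> /andP[t0 t1]; rewrite cabsM cabs_cR ger0_norm//.
  by rewrite ler_piMl ?cabs_ge0.
have lip z h : cabs (z - a) < 6 * rho -> cabs h < 2 * rho -> cabs (f (z + h) - f z) <= 2 * M * cabs h.
  move=> hz hh; apply: (@mean_value_ineq f f') => t /seg th.
    by apply: df; have := near z _ _ _ hz (th h); lra.
  by apply: HM; have := near z _ _ _ hz (th h); lra.
pose K := 4 * (2 * M) / rho.
have K0 : 0 <= K by rewrite /K divr_ge0//; lra.
have lip' z h : cabs (z - a) < 3 * rho -> cabs h < 2 * rho -> cabs (f' (z + h) - f' z) <= K * cabs h.
  move=> hz hh; rewrite [leRHS](_ : _ = 4 * (2 * M * cabs h) / rho); last by rewrite /K; ring.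
  apply: (@cauchy_estimate (fun w => f (w + h) - f w) z _ (2 * rho) rho).
  - move=> w hw.
    have wa : cabs (w - a) < 5 * rho.
      have -> : w - a = w - z + (z - a) by ring.
      by apply: le_lt_trans (cabsD _ _) _; lra.
    exists (f' (w + h) * (1 + 0) - f' w); apply: cderivB; last by apply: df; lra.
    apply: (@cderiv_comp _ (fun w => w + h)); first by apply: cderivD; [exact: cderiv_id|exact: cderiv_cst].
    by apply: df; have := near w h _ _ wa (ltW hh); lra.
  - apply: cderivB; last by apply: df; lra.
    rewrite -[f' (z + h)]mulr1 -[1]addr0.
    apply: (@cderiv_comp _ (fun w => w + h)); first by apply: cderivD; [exact: cderiv_id|exact: cderiv_cst].
    by apply: df; have := near z h _ _ hz (ltW hh); lra.
  - by rewrite rho0; lra.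
  - move=> w hw; apply: lip => //.
    have -> : w - a = w - z + (z - a) by ring.
    by apply: le_lt_trans (cabsD _ _) _; lra.
exists rho, K; split => //; first lra.
move=> z h hz hh; split; first by apply: lip'; lra.
have := @mean_value_ineq (fun w => f w - f' z * w) (fun w => f' w - f' z) z h (K * cabs h).
have -> : f (z + h) - f' z * (z + h) - (f z - f' z * z) = f (z + h) - f z - h * f' z by ring.
rewrite expr2 !mulrA; apply => t /seg th.
  apply: cderivB; last by rewrite -[X in cderiv _ _ X]mulr1; apply: cderivZ; exact: cderiv_id.
  by apply: df; have := near z _ _ _ hz (th h); lra.
have th' := th h.
apply: le_trans (lip' z _ _ _) _; [lra|lra|].
exact: ler_wpM2l.
Qed.

End Derivative.
End HolomorphicDerivative.

Section SecondDerivative.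
Variable R : realType.
Local Notation C := R[i].
Local Notation Re := (@complex.Re R).
Local Notation Im := (@complex.Im R).
Local Notation leb := (@lebesgue_measure R).
Local Notation I a b f := (\int[leb]_(t in `[a, b]) f t).

Lemma ccontM (F G : C -> C) z : ccont F z -> ccont G z -> ccont (fun w => F w * G w) z.
Proof.
move=> cF cG e e0.
pose M := cabs (F z) + cabs (G z) + 1.
have M0 : 0 < M by rewrite /M; have := cabs_ge0 (F z); have := cabs_ge0 (G z); lra.
pose e1 := Num.min 1 (e / M).
have e10 : 0 < e1 by rewrite lt_min ltr01 divr_gt0.
have e11 : e1 <= 1 by rewrite ge_min lexx.
have e1M : e1 * M <= e by rewrite -ler_pdivlMr// ge_min lexx orbT.
have [r r0 hr] := cF _ e10; have [s s0 hs] := cG _ e10.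
exists (Num.min r s) => [|h]; first by rewrite lt_min r0.
rewrite lt_min => /andP[/hr H1 /hs H2].
have -> : F (z + h) * G (z + h) - F z * G z = (F (z + h) - F z) * G z + F z * (G (z + h) - G z) + (F (z + h) - F z) * (G (z + h) - G z) by ring.
apply: lt_le_trans e1M; apply: le_lt_trans (cabsD _ _) _.
apply: le_lt_trans (lerD (cabsD _ _) (lexx _)) _; rewrite !cabsM /M.
move: H1 H2 (cabs_ge0 (F z)) (cabs_ge0 (G z)) (cabs_ge0 (F (z + h) - F z)) (cabs_ge0 (G (z + h) - G z)).
move: (cabs (F z)) (cabs (G z)) (cabs (F (z + h) - F z)) (cabs (G (z + h) - G z)) => A B X Y.
clear -e10 e11; move=> *; nra.
Qed.

Lemma contOn_lin2 (a b x y : R) f g : contOn a b f -> contOn a b g ->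
  contOn a b (fun t => x * f t + y * g t).
Proof.
move=> cf cg t ht; apply: continuousD; apply: continuousM; try exact: cst_continuous.
  exact: cf.
exact: cg.
Qed.

Lemma I_lin3 (a b x y : R) f g k : contOn a b f -> contOn a b g -> contOn a b k ->
  I a b (fun t => k t - (x * f t + y * g t)) = I a b k - (x * I a b f + y * I a b g).
Proof.
move=> cf cg ck; rewrite I_B//; last exact: contOn_lin2.
have cs (z : R) h : contOn a b h -> contOn a b (fun t => z * h t).
  move=> ch t ht; apply: continuousM; [exact: cst_continuous|exact: ch].
by rewrite I_D ?I_Z//; exact: cs.
Qed.

(* The circle means of the difference quotients of [z |-> f (z + h) - f z] give
   [f' (a + h) - f' a]; by the quadratic remainder bound of [deriv_lipschitz] they are linear
   in [h] up to [O (h^2)]. *)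
Theorem holomorphic_deriv (f f' : C -> C) a r : 0 < r ->
  (forall z, cabs (z - a) < r -> cderiv f z (f' z)) -> exists d, cderiv f' a d.
Proof.
move=> r0 df; have [rho [K [rho0 rhor K0 HK]]] := deriv_lipschitz r0 df.
have pi0 := pi_gt0 R.
pose s := rho / 4.
have s0 : 0 < s by rewrite divr_gt0.
have sr : 4 * s = rho by rewrite /s; field.
(* The candidate derivative [D] is the circle mean of the difference quotient of [f'], the value
   that a removable singularity would have. *)
pose q t := diff_quotient f' a (a + cR s * expi t).
pose D := Complex (I 0 (2 * pi) (fun t => Re (q t)) / (2 * pi)) (I 0 (2 * pi) (fun t => Im (q t)) / (2 * pi)).
exists D.
apply: (@lo_sq _ (8 * K / s) s) => //; first by rewrite divr_ge0 ?mulr_ge0// ltW.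
move=> h hs.
pose G z := f (z + h) - f z.
pose p t := diff_quotient G a (a + cR s * expi t).
have dG z : cabs (z - a) < 2 * s -> cderiv G z (f' (z + h) - f' z).
  move=> hz; apply: cderivB; last by apply: df; lra.
  rewrite -[f' (z + h)]mulr1 -[1]addr0.
  apply: (@cderiv_comp _ (fun w => w + h)); first by apply: cderivD; [exact: cderiv_id|exact: cderiv_cst].
  apply: df; have -> : z + h - a = (z - a) + h by ring.
  by apply: le_lt_trans (cabsD _ _) _; lra.
have dGq z : 0 < cabs (z - a) < 2 * s -> exists d, cderiv (diff_quotient G a) z d.
  move=> /andP[z0 /dG dz]; apply: cderiv_diff_quotient dz.
  by rewrite -subr_eq0 -cabs_gt0.
have sr' : 0 < s < 2 * s by rewrite s0; lra.
have dGa : cderiv G a (f' (a + h) - f' a) by apply: dG; rewrite subrr cabs0; lra.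
have pRe : I 0 (2 * pi) (fun t => Re (p t)) = 2 * pi * Re (f' (a + h) - f' a).
  exact: (circle_mean_Re dGq (diff_quotient_lim dGa) sr').
have pIm : I 0 (2 * pi) (fun t => Im (p t)) = 2 * pi * Im (f' (a + h) - f' a).
  exact: (circle_mean_Im dGq (diff_quotient_lim dGa) sr').
have on_circle z : cabs (z - a) = `|s| -> 0 < cabs (z - a) < 2 * s.
  by move=> ->; rewrite gtr0_norm.
have [cp1 cp2] := @circle_contOn R (diff_quotient G a) a s
  (fun z hz => let: ex_intro _ Hd := dGq z (on_circle z hz) in cderiv_cont Hd).
have [cq1 cq2] : contOn 0 (2 * pi) (fun t => Re (q t)) /\ contOn 0 (2 * pi) (fun t => Im (q t)).
  apply: (@circle_contOn R (diff_quotient f' a) a s) => z zs e e0.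
  have zs' : cabs (z - a) < rho by rewrite zs gtr0_norm//; lra.
  have za : z != a by rewrite -subr_eq0 -cabs_gt0 zs gtr0_norm.
  have cf' : ccont f' z.
    move=> e1 e10; exists (Num.min rho (e1 / (K + 1))); first by rewrite lt_min rho0 divr_gt0//; lra.
    move=> k; rewrite lt_min => /andP[k1]; rewrite ltr_pdivlMr; last lra.
    have [+ _] := HK z k zs' k1; have := cabs_ge0 k; nra.
  apply: (@ccontM (fun w => f' w - f' a) (fun w => (w - a)^-1) z) e e0; last first.
    have [d Hd] : exists d, cderiv (fun w => (w - a)^-1) z d.
      eexists; apply: (cderiv_comp (cderivB (cderiv_id z) (cderiv_cst a z)) (cderiv_inv _)).
      by rewrite subr_eq0.
    exact: cderiv_cont Hd.
  by move=> e e0; have [d d0 hd] := cf' e e0; exists d => // k /hd; rewrite opprB addrA subrK.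
(* The numerator is a difference of two first-order remainders of [f], at [z] and at [a], each at
   most [2 * K * cabs h ^+ 2]. *)
have bnd t : cabs (p t - h * q t) <= 4 * K / s * cabs h ^+ 2.
  set z := a + cR s * expi t.
  have za : cabs (z - a) = s by rewrite addrC addKr cabsM cabs_cR cabs_expi mulr1 gtr0_norm.
  have -> : p t - h * q t = (f (z + h) - f z - h * f' z - (f (a + h) - f a - h * f' a)) * (z - a)^-1.
    by rewrite /p /q /diff_quotient /G -/z; ring.
  rewrite cabsM cabsV za.
  have -> : 4 * K / s * cabs h ^+ 2 = (2 * K * cabs h ^+ 2 + 2 * K * cabs h ^+ 2) / s by ring.
  rewrite ler_pM2r ?invr_gt0//.
  apply: le_trans (cabsD _ _) _; rewrite cabsN; apply: lerD.
    by have [] := HK z h _ _ => //; lra.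
  by have [] := HK a h _ _ => //; rewrite ?subrr ?cabs0; lra.
have p20 : 0 <= 2 * pi :> R by lra.
have p2p : 0 < 2 * pi :> R by lra.
have p2n : 2 * pi != 0 :> R by apply: lt0r_neq0; lra.
have scale (T A B x y X : R) : T != 0 -> T * (X - (A / T * x - B / T * y)) = T * X - (x * A + - y * B).
  by move=> T0; field.
have scale' (T A B x y X : R) : T != 0 -> T * (X - (A / T * y + B / T * x)) = T * X - (x * B + y * A).
  by move=> T0; field.
apply: le_trans (cabs_ReIm _) _.
have -> : 8 * K / s * cabs h ^+ 2 = 4 * K / s * cabs h ^+ 2 + 4 * K / s * cabs h ^+ 2 by ring.
apply: lerD.
  have := @I_near_cst R 0 (2 * pi) (fun t => Re (p t) - (Re h * Re (q t) + - Im h * Im (q t))) 0 (4 * K / s * cabs h ^+ 2) p20.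
  rewrite I_lin3// pRe mul0r subr0 subr0 => H.
  have : `|2 * pi * Re (f' (a + h) - f' a - D * h)| <= 4 * K / s * cabs h ^+ 2 * (2 * pi).
    have -> : 2 * pi * Re (f' (a + h) - f' a - D * h) = 2 * pi * Re (f' (a + h) - f' a) - (Re h * I 0 (2 * pi) (fun t => Re (q t)) + - Im h * I 0 (2 * pi) (fun t => Im (q t))).
      by rewrite Re_add Re_opp Re_mul scale.
    apply: H => [t ht|t _].
      by apply: continuousB; [exact: cp1|exact: (contOn_lin2 cq1 cq2)].
    rewrite subr0; apply: le_trans (bnd t); apply: le_trans (normRe _).
    by rewrite !ReImE; clear; rewrite le_eqVlt; apply/orP; left; apply/eqP; congr `|_|; ring.
  by rewrite normrM (ger0_norm p20) [leRHS]mulrC (ler_pM2l p2p).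
have := @I_near_cst R 0 (2 * pi) (fun t => Im (p t) - (Re h * Im (q t) + Im h * Re (q t))) 0 (4 * K / s * cabs h ^+ 2) p20.
rewrite I_lin3// pIm mul0r subr0 subr0 => H.
have : `|2 * pi * Im (f' (a + h) - f' a - D * h)| <= 4 * K / s * cabs h ^+ 2 * (2 * pi).
  have -> : 2 * pi * Im (f' (a + h) - f' a - D * h) = 2 * pi * Im (f' (a + h) - f' a) - (Re h * I 0 (2 * pi) (fun t => Im (q t)) + Im h * I 0 (2 * pi) (fun t => Re (q t))).
    by rewrite Im_add Im_opp Im_mul scale'.
  apply: H => [t ht|t _].
    by apply: continuousB; [exact: cp2|exact: (contOn_lin2 cq2 cq1)].
  rewrite subr0; apply: le_trans (bnd t); apply: le_trans (normIm _).
  by rewrite !ReImE; clear; rewrite le_eqVlt; apply/orP; left; apply/eqP; congr `|_|; ring.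
by rewrite normrM (ger0_norm p20) [leRHS]mulrC (ler_pM2l p2p).
Qed.
End SecondDerivative.

(** * Harmonic functions *)

Section Harmonic.
Variable R : realType.
Local Notation C := R[i].
Local Notation Re := (@complex.Re R).
Local Notation leb := (@lebesgue_measure R).
Local Notation I a b f := (\int[leb]_(t in `[a, b]) f t).

(* Laplace's equation and the equality of mixed partials are the Cauchy-Riemann equations of
   [g = u_x - i u_y]. *)
Definition harmonic_at (u : C -> R) (g : C -> C) z := rgrad u z (g z) /\ exists d, cderiv g z d.

Lemma rgrad_ccont (u : C -> R) z g : rgrad u z g -> ccont (fun w => cR (u w)) z.
Proof.
move=> /rgrad_lip[r r0 H] e e0.
have k0 : 0 < cabs g + 1 by have := cabs_ge0 g; lra.
exists (Num.min r (e / (cabs g + 1))) => [|h]; first by rewrite lt_min r0 divr_gt0.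
rewrite lt_min => /andP[/H hr]; rewrite ltr_pdivlMr// => hd.
have -> : cR (u (z + h)) - cR (u z) = cR (u (z + h) - u z) by rewrite cRD cRN.
by rewrite cabs_cR; apply: le_lt_trans hr _; rewrite mulrC.
Qed.

(* Averaging against [1 + Re (gam * expi t)], which is nonnegative if [|gam| <= 1], captures
   the gradient at the centre besides the value there. *)
Section WeightedMean.
Variables (u : C -> R) (g : C -> C) (a gam : C) (r : R).
Hypothesis harm : forall z, cabs (z - a) < r -> harmonic_at u g z.

Let e t : C := expi t.
Let w t := 1 + Re (gam * e t).
Let B s := I 0 (2 * pi) (fun t => u (a + cR s * e t) * w t).

Lemma cabs_on_circle s t : cabs (a + cR s * e t - a) = `|s|.
Proof. by rewrite addrC addKr cabsM cabs_cR cabs_expi mulr1. Qed.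

Lemma weight_continuous t : {for t, continuous w}.
Proof.
have c1 : ccont (fun z : C => 1 + gam * z) (e t).
  apply: (@cderiv_cont R _ _ (0 + gam * 1)).
  by apply: cderivD; [exact: cderiv_cst|apply: cderivZ; exact: cderiv_id].
have [+ _] := @ccont_path R _ e t 2 c1 (fun k => expi_lip t k).
suff -> : w = (fun s => Re (1 + gam * e s)) by [].
by apply/funext => s; rewrite Re_add.
Qed.

Lemma weight_bound t : `|w t| <= 1 + cabs gam.
Proof.
apply: le_trans (ler_normD _ _) _; rewrite normr1 lerD2l.
by apply: le_trans (normRe _) _; rewrite cabsM cabs_expi mulr1.
Qed.

Lemma weighted_contOn s : `|s| < r -> contOn 0 (2 * pi) (fun t => u (a + cR s * e t) * w t).
Proof.
move=> sr t ht.
have K z : cabs (z - a) = `|s| -> ccont (fun z => cR (u z)) z.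
  by move=> zs; have [|+ _] := @harm z; [rewrite zs|exact: rgrad_ccont].
have [cu _] := circle_contOn K.
by apply: continuousM; [exact: cu|exact: weight_continuous].
Qed.

Lemma weighted_grad s : 0 < s < r ->
  I 0 (2 * pi) (fun t => Re (g (a + cR s * e t) * e t) * w t) = pi * Re (gam^*%C * g a).
Proof.
move=> sr; have [s0 _] := andP sr.
pose Phi z := g z * ((cR s)^-1 * (z - a) + cR (2^-1) * gam * ((cR s)^-1 * (z - a)) ^+ 2 + cR (2^-1) * gam^*%C).
have dPhi z : cabs (z - a) < r -> exists d, cderiv Phi z d.
  move=> /harm[_ [d dg]].
  have d1 : exists d, cderiv (fun z => (cR s)^-1 * (z - a)) z d.
    by eexists; apply: cderivZ; apply: cderivB; [exact: cderiv_id|exact: cderiv_cst].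
  have [d1' H1] := d1.
  eexists; apply: (cderivM dg); apply: cderivD; last exact: cderiv_cst.
  apply: cderivD; first exact: H1.
  by apply: cderivZ; apply: (cderivM H1 H1).
have -> : pi * Re (gam^*%C * g a) = 2 * pi * Re (Phi a).
  rewrite /Phi subrr mulr0 expr0n /= mulr0 addr0 add0r.
  have -> : g a * (cR 2^-1 * gam^*%C) = cR 2^-1 * (gam^*%C * g a) by ring.
  by rewrite [Re (cR _ * _)]Re_mul /= mul0r subr0; field.
rewrite -(@circle_mean_Re R Phi a (Phi a) r s _ _ sr); first last.
- have [|d dPa] := dPhi a; first by rewrite subrr cabs0; lra.
  move=> eps e0; have [d1 d10 hd] := cderiv_cont dPa e0; exists d1 => // h /andP[_ /hd].
  exact: ltW.
- by move=> z /andP[_]; exact: dPhi.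
apply: I_ext => t _; rewrite /Phi.
have s0' : cR s != 0 :> C by rewrite -cabs_eq0 cabs_cR normr_eq0 lt0r_neq0.
have -> : (cR s)^-1 * (a + cR s * e t - a) = e t by field.
have := cos2Dsin2 t; rewrite /w /e.
case: (g _) => x y; case: (gam) => p q.
rewrite expr2 !ReImE /=.
move: (cos t) (sin t) => c d cd.
apply: subr0_eq.
rewrite (_ : _ - _ = (x * p + y * q) / 2 * (c * c + d ^+ 2 - 1)); last by field.
by rewrite cd subrr mulr0.
Qed.

Lemma weighted_derive s : 0 < s < r -> is_derive s 1 B (pi * Re (gam^*%C * g a)).
Proof.
move=> sr; have [s0 sr'] := andP sr.
(* On the closed disc of this intermediate radius [g] is bounded, which dominates the partial
   derivative for all [x] near [s]. *)
pose k := (s + r) / 2.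
have sk : s < k by rewrite /k; lra.
have kr : k < r by rewrite /k; lra.
have [M HM] : exists M, forall z, cabs (z - a) <= k -> cabs (g z) <= M.
  apply: ccont_bounded => z zk; have [|_ [d Hd]] := @harm z; first lra.
  exact: cderiv_cont Hd.
have M0 : 0 <= M by apply: le_trans (HM a _); rewrite ?cabs_ge0 ?subrr ?cabs0//; lra.
pose F x t := u (a + cR x * e t) * w t.
have dF x t : `]- k, k[%classic x -> is_derive x 1 (F^~ t) (Re (g (a + cR x * e t) * e t) * w t).
  rewrite /= in_itv /= -ltr_norml => xk.
  have [|H _] := @harm (a + cR x * e t); first by rewrite cabs_on_circle; lra.
  have -> : F^~ t = (fun x => (fun z => w t * u z) (a + cR x * e t)).
    by apply/funext => y; rewrite /F mulrC.
  have -> : Re (g (a + cR x * e t) * e t) * w t = Re (cR (w t) * g (a + cR x * e t) * e t).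
    by rewrite -mulrA [Re (cR _ * _)]Re_mul /= mul0r subr0 mulrC.
  exact: (rgrad_line (rgradZ (w t) H)).
have dE x t : `]- k, k[%classic x -> partial1of2 F x t = Re (g (a + cR x * e t) * e t) * w t.
  by move=> xk; rewrite partial1of2E; have [_ ->] := dF x t xk.
have kk : `]- k, k[%classic s by rewrite /= in_itv /=; apply/andP; split; lra.
have intF x : `]- k, k[%classic x -> leb.-integrable `[0, 2 * pi] (EFin \o F x).
  rewrite /= in_itv /= -ltr_norml => xk.
  by apply: contOn_integrable; apply: weighted_contOn; lra.
have intG : leb.-integrable `[0, 2 * pi] (EFin \o fun=> M * (1 + cabs gam)).
  by apply: contOn_integrable => t _; exact: cst_continuous.
have G0 (t : R) : 0 <= M * (1 + cabs gam) by rewrite mulr_ge0 ?addr_ge0 ?cabs_ge0.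
have derF x t : `]- k, k[%classic x -> `[0, 2 * pi]%classic t -> derivable (F^~ t) x 1.
  by move=> xk _; have [] := dF x t xk.
have bF x t : `]- k, k[%classic x -> `[0, 2 * pi]%classic t -> `|partial1of2 F x t| <= M * (1 + cabs gam).
  move=> xk _; rewrite dE// normrM; apply: ler_pM => //; last exact: weight_bound.
  apply: le_trans (normRe _) _; rewrite cabsM cabs_expi mulr1; apply: HM.
  by rewrite cabs_on_circle ltW//; move: xk; rewrite /= in_itv /= -ltr_norml.
have D : derivable B s 1 by exact: (derivable_under_integral _ kk intF derF G0 intG bF).
have E : B^`()%classic s = I 0 (2 * pi) (partial1of2 F s)
  by exact: (differentiation_under_integral _ kk intF derF G0 intG bF).
apply: DeriveDef; first exact: D.
rewrite -derive1E E -(weighted_grad sr).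
by apply: eq_Rintegral => t _; exact: dE.
Qed.

(** The derivative is computed for positive radii, where one may divide by [s]; continuity at 0 is
    what the mean value theorem on [[0, s]] still requires. *)
Lemma weighted_continuous_at0 : 0 < r -> {for 0, continuous B}.
Proof.
move=> r0; have pi0 := pi_gt0 R.
have p20 : 0 <= 2 * pi :> R by lra.
have [|/rgrad_lip[d d0 hd] _] := @harm a; first by rewrite subrr cabs0.
pose L := (cabs (g a) + 1) * (1 + cabs gam) * (2 * pi) + 1.
have L0 : 0 < L.
  by apply: ltr_wpDl => //; apply: mulr_ge0 => //; apply: mulr_ge0; rewrite addr_ge0 ?cabs_ge0.
apply/cvgrPdist_lt => eps e0.
exists (Num.min r (Num.min d (eps / L))) => /=.
  by rewrite !lt_min r0 d0 divr_gt0.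
move=> x; rewrite /= sub0r normrN !lt_min => /and3P[xr xd xe].
rewrite distrC /B -I_B; [|exact: weighted_contOn|by apply: weighted_contOn; rewrite normr0].
have := @I_near_cst R 0 (2 * pi) (fun t => u (a + cR x * e t) * w t - u (a + cR 0 * e t) * w t) 0
  ((cabs (g a) + 1) * `|x| * (1 + cabs gam)) p20.
rewrite mul0r !subr0 => H.
apply: le_lt_trans (H _ _) _.
- move=> t ht; apply: continuousB; first exact: weighted_contOn xr t ht.
  by apply: weighted_contOn ht; rewrite normr0.
- move=> t _; rewrite subr0 -mulrBl normrM; apply: ler_pM => //; last exact: weight_bound.
  rewrite (_ : cR 0 * e t = 0) ?addr0; last by rewrite mul0r.
  apply: le_trans (hd _ _) _; rewrite cabsM cabs_cR cabs_expi mulr1//.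
rewrite ltr_pdivlMr// in xe; apply: le_lt_trans xe.
rewrite [leLHS](_ : _ = `|x| * ((cabs (g a) + 1) * (1 + cabs gam) * (2 * pi))); last by ring.
by apply: ler_wpM2l => //; rewrite lerDl.
Qed.

Lemma weight_mean : I 0 (2 * pi) w = 2 * pi.
Proof.
have dP z : cderiv (fun z => 1 + gam * z) z (0 + gam * 1).
  by apply: cderivD; [exact: cderiv_cst|apply: cderivZ; exact: cderiv_id].
have -> : I 0 (2 * pi) w = I 0 (2 * pi) (fun t => Re (1 + gam * (0 + cR 1 * expi t))).
  by apply: I_ext => t _; rewrite add0r mul1r Re_add.
rewrite (@circle_mean_Re R (fun z => 1 + gam * z) 0 1 2 1) /= ?mulr1//.
- by move=> z _; eexists; exact: dP.
- move=> eps e0; have [d d0 hd] := cderiv_cont (dP 0) e0; exists d => // h /andP[_ /hd].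
  by rewrite mulr0 addr0 => /ltW.
- by rewrite ltr01 ltr1n.
Qed.

(** The derivative of [B] does not depend on the radius, so [B] is affine, and its value at 0 is
    [2 * pi * u a]. *)
Theorem weighted_circle_mean s : 0 < s < r ->
  B s = 2 * pi * u a + pi * s * Re (gam^*%C * g a).
Proof.
move=> sr; have [s0 sr'] := andP sr.
have [x||c _] := @MVT R B (fun=> pi * Re (gam^*%C * g a)) 0 s s0.
- by rewrite in_itv /= => /andP[x0 xs]; apply: weighted_derive; rewrite x0; lra.
- apply: continuous_in_subspaceT => x; rewrite inE /= in_itv /= => /andP[].
  rewrite le_eqVlt => /predU1P[<- _|x0 xs]; first by apply: weighted_continuous_at0; lra.
  have [|D _] := @weighted_derive x; first by rewrite x0; lra.
  by apply: differentiable_continuous; exact/derivable1_diffP.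
have -> : B 0 = 2 * pi * u a.
  rewrite /B (@I_ext _ _ _ _ (fun t => u a * w t)); last by move=> t _; rewrite mul0r addr0.
  rewrite I_Z ?weight_mean 1?mulrC// => t _; exact: weight_continuous.
rewrite subr0 => /eqP; rewrite subr_eq => /eqP ->; ring.
Qed.
End WeightedMean.

Theorem harmonic_mean_value (u : C -> R) g a r s :
  (forall z, cabs (z - a) < r -> harmonic_at u g z) -> 0 < s < r ->
  I 0 (2 * pi) (fun t => u (a + cR s * expi t)) = 2 * pi * u a.
Proof.
move=> harm sr; have := weighted_circle_mean 0 harm sr.
rewrite conjc0 mul0r mulr0 addr0 => <-.
by apply: I_ext => t _; rewrite mul0r addr0 mulr1.
Qed.

(** With [gam = - g a / |g a|] the weight is nonnegative and the gradient term of the weighted mean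
    is [- pi * s * |g a|]; nonnegativity of the mean is the claim. *)
Theorem harmonic_gradient_bound (u : C -> R) g a r s :
  (forall z, cabs (z - a) < r -> harmonic_at u g z) -> 0 < s < r ->
  (forall z, cabs (z - a) < r -> 0 <= u z) -> s * cabs (g a) <= 2 * u a.
Proof.
move=> harm sr u0; have [s0 sr'] := andP sr; have pi0 := pi_gt0 R.
have [->|ga0] := eqVneq (g a) 0.
  by rewrite cabs0 mulr0 mulr_ge0// u0// subrr cabs0; lra.
have c0 : 0 < cabs (g a) by rewrite cabs_gt0.
pose gam : C := - (cR (cabs (g a))^-1 * g a).
have gam1 : cabs gam = 1.
  by rewrite cabsN cabsM cabs_cR ger0_norm ?invr_ge0 ?cabs_ge0// mulVf// gt_eqF.
have E : Re (gam^*%C * g a) = - cabs (g a).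
  have := cabs_sqr (g a); rewrite /gam; move: c0; move: (cabs (g a)) => c c0.
  case: (g a) => x y /= E.
  have -> : - c = - (c^-1 * (x ^+ 2 + y ^+ 2)) by rewrite -E; field; rewrite gt_eqF.
  ring.
have := weighted_circle_mean gam harm sr; rewrite E => W.
have : 0 <= 2 * pi * u a + pi * s * - cabs (g a).
  rewrite -W; apply: I_ge0 => t _; apply: mulr_ge0.
    by apply: u0; rewrite addrC addKr cabsM cabs_cR cabs_expi mulr1 gtr0_norm.
  have := normRe (gam * expi t); rewrite cabsM cabs_expi gam1 mulr1 ler_norml => /andP[+ _]; lra.
have -> : 2 * pi * u a + pi * s * - cabs (g a) = pi * (2 * u a - s * cabs (g a)) by ring.
by rewrite pmulr_rge0// subr_ge0.
Qed.
End Harmonic.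

(** * Logarithms, the minimum principle and Harnack's inequality *)

Section HarmonicTools.
Variable R : realType.
Local Notation C := R[i].
Local Notation Re := (@complex.Re R).

Lemma ln_le_sub1 (x : R) : 0 < x -> ln x <= x - 1.
Proof. by move=> x0; have := @le_ln1Dx R (x - 1); rewrite subrKC; apply; lra. Qed.

Lemma ln_ge_1sub_inv (x : R) : 0 < x -> 1 - x^-1 <= ln x.
Proof. by move=> x0; have := @ln_le_sub1 x^-1; rewrite invr_gt0 => /(_ x0); rewrite lnV ?posrE//; lra. Qed.

Lemma ln_cabs (z : C) : z != 0 -> ln (cabs z) = ln (cabs z ^+ 2) / 2.
Proof. by move=> z0; rewrite lnXn ?cabs_gt0//; lra. Qed.

(** From [1 - 1/X <= ln X <= X - 1] with [X = |1 + s|^2 >= 1/4]. Writing [X = 1 + T], the lower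
    bound loses at most [4 T^2] with [T^2 <= 25/4 |s|^2]; half of this is [25/2 |s|^2], rounded up
    to 13. *)
Lemma ln_cabs1D (s : C) : cabs s <= 2^-1 -> `|ln (cabs (1 + s)) - Re s| <= 13 * cabs s ^+ 2.
Proof.
move=> s2; have s0 := cabs_ge0 s.
have X4 : 4^-1 <= cabs (1 + s) ^+ 2.
  have := cabsD (1 + s) (- s); rewrite addrK cabs1 cabsN; nra.
have X0 : 0 < cabs (1 + s) ^+ 2 by lra.
have n0 : 1 + s != 0 by rewrite -cabs_gt0; have := cabs_ge0 (1 + s); nra.
have XE : cabs (1 + s) ^+ 2 = 1 + (2 * Re s + cabs s ^+ 2).
  by rewrite !cabs_sqr !ReImE /=; ring.
rewrite ln_cabs//; have := ln_le_sub1 X0; have := ln_ge_1sub_inv X0.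
move: X4 X0; rewrite {}XE; set X := 1 + _ => X4 X0 lo up.
have := normRe s; rewrite ler_norml => /andP[r1 r2].
pose T := 2 * Re s + cabs s ^+ 2.
have T2 : T ^+ 2 <= 25 / 4 * cabs s ^+ 2.
  have : - (5 / 2 * cabs s) <= T <= 5 / 2 * cabs s by rewrite /T; apply/andP; split; nra.
  by move=> /andP[? ?]; nra.
have Xi : 1 - X^-1 >= T - 4 * T ^+ 2.
  have -> : 1 - X^-1 = T - T ^+ 2 / X by rewrite /X /T; field; rewrite -/X; lra.
  rewrite lerD2l lerN2 ler_pdivrMr//; have := sqr_ge0 T; nra.
rewrite ler_norml; apply/andP; split; rewrite /T in T2 Xi; rewrite /X in up; nra.
Qed.

Lemma rgrad_ln_cabs (c z : C) : z != c -> rgrad (fun z => ln (cabs (z - c))) z (z - c)^-1.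
Proof.
move=> zc; have zc0 : z - c != 0 by rewrite subr_eq0.
have c0 : 0 < cabs (z - c) by rewrite cabs_gt0.
apply: (@lo_sq _ (13 / cabs (z - c) ^+ 2) (cabs (z - c) / 2)) => [||h hh].
- by rewrite divr_gt0.
- by rewrite divr_ge0// exprn_ge0// ltW.
have := @ln_cabs1D ((z - c)^-1 * h); rewrite cabsM cabsV exprMn exprVn mulrA.
have -> : 1 + (z - c)^-1 * h = (z + h - c) * (z - c)^-1 by field.
have h0 : 0 < cabs (z + h - c).
  have := cabsD (z + h - c) (- h); have -> : z + h - c - h = z - c by ring.
  by rewrite cabsN; lra.
rewrite cabsM cabsV lnM ?posrE ?invr_gt0// lnV ?posrE//; apply.
by rewrite mulrC ler_pdivrMr// mulrC; lra.
Qed.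

Lemma harmonic_ln_cabs (c z : C) : z != c ->
  harmonic_at (fun z => ln (cabs (z - c))) (fun z => (z - c)^-1) z.
Proof.
move=> zc; split; first exact: rgrad_ln_cabs.
eexists; apply: (cderiv_comp (cderivB (cderiv_id z) (cderiv_cst c z)) (cderiv_inv _)).
by rewrite subr_eq0.
Qed.

Lemma harmonicD (u v : C -> R) g h (z : C) : harmonic_at u g z -> harmonic_at v h z ->
  harmonic_at (fun z => u z + v z) (fun z => g z + h z) z.
Proof.
move=> [u1 [d1 g1]] [v1 [d2 h1]]; split; first exact: rgradD.
by exists (d1 + d2); exact: cderivD.
Qed.

Lemma harmonicZ (c : R) (u : C -> R) g (z : C) : harmonic_at u g z ->
  harmonic_at (fun z => c * u z) (fun z => cR c * g z) z.
Proof.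
move=> [u1 [d1 g1]]; split; first exact: rgradZ.
by exists (cR c * d1); exact: cderivZ.
Qed.

Lemma harmonic_affine (c : R) (b z : C) : harmonic_at (fun z => c + Re (b * z)) (fun=> 0 + b) z.
Proof.
split; last by exists 0; exact: cderiv_cst.
apply: rgradD; first exact: rgrad_cst.
rewrite -[b in rgrad _ _ b]mulr1.
by apply: cderiv_rgrad; apply: cderivZ; exact: cderiv_id.
Qed.

Lemma harmonic_sum (T : eqType) (D : seq T) (u : T -> C -> R) (g : T -> C -> C) (z : C) :
  (forall p, p \in D -> harmonic_at (u p) (g p) z) ->
  harmonic_at (fun z => \sum_(p <- D) u p z) (fun z => \sum_(p <- D) g p z) z.
Proof.
elim: D => [|p D IH] H.
  have -> : (fun z => \sum_(p <- [::]) u p z) = (fun=> 0) by apply/funext => w; rewrite big_nil.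
  have -> : (fun z => \sum_(p <- [::]) g p z) = (fun=> 0) by apply/funext => w; rewrite big_nil.
  by split; [exact: rgrad_cst | exists 0; exact: cderiv_cst].
have -> : (fun z => \sum_(q <- p :: D) u q z) = (fun z => u p z + \sum_(q <- D) u q z).
  by apply/funext => w; rewrite big_cons.
have -> : (fun z => \sum_(q <- p :: D) g q z) = (fun z => g p z + \sum_(q <- D) g q z).
  by apply/funext => w; rewrite big_cons.
apply: harmonicD; first by apply: H; rewrite mem_head.
by apply: IH => q qD; apply: H; rewrite inE qD orbT.
Qed.

Lemma rgrad_rcont (u : C -> R) z g : rgrad u z g -> rcont u z.
Proof.
move=> /rgrad_ccont H e /H[r r0 hr]; exists r => // h /hr.
have -> : cR (u (z + h)) - cR (u z) = cR (u (z + h) - u z) by rewrite cRD cRN.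
by rewrite cabs_cR.
Qed.

Lemma cabs_sqrD (z h : C) : cabs (z + h) ^+ 2 = cabs z ^+ 2 + Re (2 * z^*%C * h) + cabs h ^+ 2.
Proof.
have -> : 2 * z^*%C * h = cR 2 * (z^*%C * h).
  by rewrite mulrA; congr (_ * _ * _); apply: complex_ext; rewrite /= ?addr0.
by rewrite !cabs_sqr !ReImE; case: z h => [x y] [p q] /=; ring.
Qed.

Lemma rgrad_cabs_sqr (z : C) : rgrad (fun z => cabs z ^+ 2) z (2 * z^*%C).
Proof.
apply: (@lo_sq _ 1 1) => // h _.
rewrite cabs_sqrD mul1r.
have -> : cabs z ^+ 2 + Re (2 * z^*%C * h) + cabs h ^+ 2 - cabs z ^+ 2 - Re (2 * z^*%C * h) = cabs h ^+ 2 by ring.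
by rewrite ger0_norm// sqr_ge0.
Qed.

(* [u - e |z|^2] with small [e > 0] would attain its minimum over [A] at an interior point,
   against the mean value property. *)
Theorem min_principle (A bdry : C -> Prop) (u : C -> R) g M :
  (forall z, A z -> cabs z <= M) ->
  (forall z, ~ A z -> exists2 r : R, 0 < r & forall h, cabs h < r -> ~ A (z + h)) ->
  (forall z, A z -> harmonic_at u g z) ->
  (forall z, A z -> bdry z \/ exists2 r : R, 0 < r & forall w, cabs (w - z) < r -> A w) ->
  (forall z, A z -> bdry z -> 0 <= u z) ->
  forall z, A z -> 0 <= u z.
Proof.
move=> AM clA harm bd ub z1 Az1; rewrite leNgt; apply/negP => uz1.
have pi0 := pi_gt0 R.
have M1 : 0 < M ^+ 2 + 1 by have := sqr_ge0 M; lra.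
(* Ensures [e * M ^+ 2 < - u z1], so that the perturbed function cannot attain its minimum at a
   boundary point; the [+ 1] covers [M = 0]. *)
pose e := - u z1 / (2 * (M ^+ 2 + 1)).
have e0 : 0 < e by rewrite divr_gt0//; lra.
have eM : e * M ^+ 2 < - u z1.
  have -> : - u z1 = e * (2 * (M ^+ 2 + 1)) by rewrite /e; field; lra.
  by rewrite ltr_pM2l//; have := sqr_ge0 M; lra.
pose v z := u z + (- e) * cabs z ^+ 2.
have [||||z0 Az0 vmin] := @plane_EVT_min R A v M.
- by exists z1.
- exact: AM.
- exact: clA.
- by move=> z /harm[H _]; apply: rgrad_rcont; apply: rgradD H _; apply: rgradZ; exact: rgrad_cabs_sqr.
have := vmin _ Az1; rewrite /v => v01.
have z1sq := sqr_ge0 (cabs z1).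
have z0M : cabs z0 ^+ 2 <= M ^+ 2.
  by have := AM _ Az0; have := cabs_ge0 z0; nra.
have [bz0|[r r0 rA]] := bd _ Az0.
  by have := ub _ Az0 bz0; nra.
(* Here [e |z|^2] is replaced by its linear part at [z0], which is harmonic; the omitted
   [e |z - z0|^2] becomes a strict gain on the circle, against the mean value of [h]. *)
pose h z := u z + (0 + Re ((- (cR e) * (2 * z0^*%C)) * z)).
have harmh z : cabs (z - z0) < r -> harmonic_at h (fun z => g z + (0 + - (cR e) * (2 * z0^*%C))) z.
  by move=> /rA/harm H; apply: harmonicD H (harmonic_affine _ _ _).
have rr : 0 < r / 2 < r by lra.
have mean := harmonic_mean_value harmh rr.
have low t : h z0 + e * (r / 2) ^+ 2 <= h (z0 + cR (r / 2) * expi t).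
  set k := cR (r / 2) * expi t.
  have kr : cabs k = r / 2 by rewrite cabsM cabs_cR cabs_expi mulr1 gtr0_norm; lra.
  have : v z0 <= v (z0 + k) by apply: vmin; apply: rA; rewrite addrC addKr kr; lra.
  have Rb (b w y : C) : Re (b * (w + y)) = Re (b * w) + Re (b * y) by rewrite mulrDr Re_add.
  rewrite /v cabs_sqrD kr /h Rb.
  have -> : Re (- cR e * (2 * z0^*%C) * k) = - e * Re (2 * z0^*%C * k).
    rewrite -mulrA -cRN [LHS]Re_mul /= mul0r subr0//.
  lra.
have ch : contOn 0 (2 * pi) (fun t => h (z0 + cR (r / 2) * expi t)).
  have K z : cabs (z - z0) = `|r / 2| -> ccont (fun z => cR (h z)) z.
    move=> zr; have [|H _] := harmh z; last exact: rgrad_ccont H.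
    by rewrite zr gtr0_norm; lra.
  exact: (proj1 (circle_contOn K)).
have := @I_ge0 R 0 (2 * pi) (fun t => h (z0 + cR (r / 2) * expi t) - (h z0 + e * (r / 2) ^+ 2)).
rewrite I_B//; last by move=> t _; exact: cst_continuous.
rewrite mean Rintegral_cst//= fine_itv; last lra.
move=> /(_ _) H; have : 0 <= 2 * pi * h z0 - (h z0 + e * (r / 2) ^+ 2) * (2 * pi - 0).
  by apply: H => t _; rewrite subr_ge0.
have : 0 < e * (r / 2) ^+ 2 * pi by apply: mulr_gt0 => //; apply: mulr_gt0 => //; apply: exprn_gt0; lra.
lra.
Qed.

(** The gradient bound on discs of radius [rho / 2] about the points of the segment, used with
    radius [rho / 4], reads [|g| * (rho / 2) <= 4 u]; a Gronwall argument along the segment then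
    loses a factor [expR 4]. *)
Theorem harnack (u : C -> R) g b rho : 0 < rho ->
  (forall z, cabs (z - b) < rho -> harmonic_at u g z) ->
  (forall z, cabs (z - b) < rho -> 0 <= u z) ->
  forall z, cabs (z - b) <= rho / 2 -> expR (- 4) * u b <= u z.
Proof.
move=> rho0 harm u0 z zb.
pose e := z - b.
have seg (t : R) : 0 <= t <= 1 -> cabs (b + cR t * e - b) <= rho / 2.
  move=> /andP[t0 t1]; rewrite addrC addKr cabsM cabs_cR ger0_norm//.
  by apply: le_trans zb; rewrite ler_piMl ?cabs_ge0.
have grad w : cabs (w - b) <= rho / 2 -> cabs (g w) * cabs e <= 4 * u w.
  move=> wb.
  have sub y : cabs (y - w) < rho / 2 -> cabs (y - b) < rho.
    move=> yw; have -> : y - b = (y - w) + (w - b) by ring.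
    by apply: le_lt_trans (cabsD _ _) _; lra.
  have s12 : 0 < rho / 4 < rho / 2 by lra.
  have := harmonic_gradient_bound (fun y yw => harm y (sub y yw)) s12 (fun y yw => u0 y (sub y yw)).
  have : cabs (g w) * cabs e <= cabs (g w) * (rho / 2) by apply: ler_wpM2l; rewrite ?cabs_ge0.
  lra.
(* [|grad u| |e| <= 4 u] along the segment, so [psi] is nondecreasing. *)
pose psi t := u (b + cR t * e) * expR (4 * t).
have dpsi (t : R) : 0 <= t <= 1 -> is_derive t 1 psi
   (u (b + cR t * e) * (expR (4 * t) * 4) + expR (4 * t) * Re (g (b + cR t * e) * e)).
  move=> t01; have [|H _] := harm (b + cR t * e); first by have := seg t t01; lra.
  have D1 := rgrad_line H.
  have D2 : is_derive t 1 (fun t : R => expR (4 * t)) (expR (4 * t) * 4).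
    apply: (@is_derive1_comp R expR (fun t => 4 * t)).
    by have := is_deriveZ 4 (is_derive_id t (1:R)); rewrite /GRing.scale /= mulr1.
  exact: (is_deriveM D1 D2).
have [c c01] := mean_value (ler01) dpsi.
rewrite /psi => E.
have : 0 <= u (b + cR c * e) * (expR (4 * c) * 4) + expR (4 * c) * Re (g (b + cR c * e) * e).
  have := grad _ (seg c c01); rewrite -cabsM => G.
  have := le_trans (normRe _) G; rewrite ler_norml => /andP[G1 _].
  have -> : u (b + cR c * e) * (expR (4 * c) * 4) + expR (4 * c) * Re (g (b + cR c * e) * e) =
    expR (4 * c) * (4 * u (b + cR c * e) + Re (g (b + cR c * e) * e)) by ring.
  by rewrite mulr_ge0 ?expR_ge0//; lra.
move: E; rewrite subr0 [X in _ = X]mulr1 => <-.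
have -> : b + cR 1 * e = z by rewrite mul1r subrKC.
have -> : b + cR 0 * e = b by rewrite mul0r addr0.
rewrite mulr0 expR0 !mulr1 subr_ge0 => H.
by rewrite expRN mulrC ler_pdivrMr ?expR_gt0.
Qed.

End HarmonicTools.

(** * Green functions of the half plane *)

Section GreenFunction.
Variable R : realType.
Local Notation C := R[i].
Local Notation Re := (@complex.Re R).
Local Notation Im := (@complex.Im R).
Local Notation leb := (@lebesgue_measure R).

Lemma leb_itvoo (a b : R) : a <= b -> leb `]a, b[%classic = (b - a)%:E.
Proof.
move=> ab; rewrite lebesgue_measure_itv /= lte_fin; move: ab; rewrite le_eqVlt => /predU1P[->|->].
  by rewrite ltxx subrr.
by rewrite EFinB.
Qed.

(** A pair is a centre with a half-length, and at the same time the pole at that height above the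
    centre. *)
Definition disjoint_intervals (D : seq (R * R)) :=
  forall p q, p \in D -> q \in D -> p != q -> p.1 + p.2 <= q.1 - q.2 \/ q.1 + q.2 <= p.1 - p.2.

Lemma sum_increments (D : seq (R * R)) (f : R -> R) (m M : R) : uniq D ->
  disjoint_intervals D -> (forall p, p \in D -> 0 < p.2) ->
  (forall x y, x <= y -> f x <= f y) -> (forall x, m <= f x <= M) ->
  \sum_(p <- D) (f (p.1 + p.2) - f (p.1 - p.2)) <= M - m.
Proof.
move=> uD dD D0 fmono fb.
pose J (p : R * R) : set R := `]f (p.1 - p.2), f (p.1 + p.2)[%classic.
have mM : m <= M by have /andP[] := fb 0; apply: le_trans.
have Jle p : p \in D -> f (p.1 - p.2) <= f (p.1 + p.2).
  by move=> /D0 p0; apply: fmono; lra.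
suff key : forall D' : seq (R * R), uniq D' -> {subset D' <= D} ->
    measurable (\big[setU/set0]_(p <- D') J p : set R) /\
    leb (\big[setU/set0]_(p <- D') J p) = (\sum_(p <- D') (f (p.1 + p.2) - f (p.1 - p.2)))%:E.
  have [mU EU] := key D uD (fun p pD => pD).
  rewrite -lee_fin -EU -(leb_itvoo mM).
  apply: le_measure; rewrite ?inE//.
  rewrite -bigcup_seq => x [p /= pD]; rewrite /J /= !in_itv /= => /andP[h1 h2].
  by have /andP[? _] := fb (p.1 - p.2); have /andP[_ ?] := fb (p.1 + p.2); apply/andP; split; lra.
elim=> [|p D' IH]; first by rewrite !big_nil measure0.
rewrite /= => /andP[pD' uD'] sub.
have [mU EU] := IH uD' (fun q qD => sub q (mem_behead (s := p :: D') qD)).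
have pD : p \in D by apply: sub; rewrite mem_head.
rewrite !big_cons; split; first by apply: measurableU; [exact: measurable_itv|exact: mU].
rewrite EFinD -EU -(leb_itvoo (Jle _ pD)).
apply: measureU; [exact: measurable_itv|exact: mU|].
apply/seteqP; split => // x [/=]; rewrite /J /= in_itv /= => /andP[h1 h2].
rewrite -bigcup_seq => -[q /= qD']; rewrite in_itv /= => /andP[h3 h4].
have qD : q \in D by apply: sub; rewrite inE qD' orbT.
have pq : p != q by apply: contraNneq pD' => ->.
by case: (dD p q pD qD pq) => /fmono; lra.
Qed.

Definition tau (p : R * R) : C := Complex p.1 p.2.
Definition taubar (p : R * R) : C := Complex p.1 (- p.2).

(* The Green function of the upper half plane with pole [p]. *)
Definition green (p : R * R) (z : C) := ln (cabs (z - taubar p)) - ln (cabs (z - tau p)).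

Lemma cabs_taubar p z : cabs (z - taubar p) ^+ 2 = cabs (z - tau p) ^+ 2 + 4 * Im z * p.2.
Proof. by rewrite !cabs_sqr !ReImE /=; ring. Qed.

(** [green] is half the logarithm of [1 + 4 Im z p.2 / |z - tau p|^2], to which
    [1 - 1/X <= ln X <= X - 1] applies. *)
Lemma green_bounds p z : 0 < p.2 -> 0 < Im z -> z != tau p ->
  2 * Im z * p.2 / (cabs (z - tau p) ^+ 2 + 4 * Im z * p.2) <= green p z <= 2 * Im z * p.2 / cabs (z - tau p) ^+ 2.
Proof.
move=> p0 z0 zp.
have X0 : 0 < cabs (z - tau p) ^+ 2 by rewrite exprn_gt0// cabs_gt0 subr_eq0.
have Y0 : 0 < cabs (z - taubar p) ^+ 2 by rewrite cabs_taubar; have := mulr_gt0 z0 p0; lra.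
have nb : z - taubar p != 0 by apply: contraTneq Y0 => ->; rewrite cabs0 expr0n /= ltxx.
rewrite /green ln_cabs// [in ln (cabs (z - tau p))]ln_cabs ?subr_eq0//.
have E : ln (cabs (z - taubar p) ^+ 2) - ln (cabs (z - tau p) ^+ 2) = ln (cabs (z - taubar p) ^+ 2 / cabs (z - tau p) ^+ 2).
  by rewrite ln_div ?posrE.
have Q0 : 0 < cabs (z - taubar p) ^+ 2 / cabs (z - tau p) ^+ 2 by apply: divr_gt0.
have := ln_le_sub1 Q0; have := ln_ge_1sub_inv Q0; rewrite -E invf_div.
move: Y0; rewrite cabs_taubar; move: X0; move: (cabs (z - tau p) ^+ 2) => X X0 Y0.
have -> : 1 - X / (X + 4 * Im z * p.2) = 2 * (2 * Im z * p.2 / (X + 4 * Im z * p.2)) by field; lra.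
have -> : (X + 4 * Im z * p.2) / X - 1 = 2 * (2 * Im z * p.2 / X) by field; lra.
by move=> lo up; apply/andP; split; lra.
Qed.

(** The difference of arctangents is the angle under which [z] sees the interval, that is [pi] times
    its harmonic measure. Any [c] in the interval is within [3/2 p.2 <= 3 |z - tau p|] of the pole,
    so [|z - c| <= 4 |z - tau p|], and 16 is the square of 4. *)
Lemma green_atan p z : 0 < p.2 -> 0 < Im z -> p.2 / 2 <= cabs (z - tau p) ->
  green p z <= 16 * (atan ((p.1 + p.2 - Re z) / Im z) - atan ((p.1 - p.2 - Re z) / Im z)).
Proof.
move=> p0 y0 zp.
have c0 : 0 < cabs (z - tau p) by lra.
have X0 : 0 < cabs (z - tau p) ^+ 2 by rewrite exprn_gt0.
have zt : z != tau p by rewrite -subr_eq0 -cabs_gt0.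
have /andP[_ up] := green_bounds p0 y0 zt.
apply: le_trans up _.
have ab : p.1 - p.2 <= p.1 + p.2 by lra.
have D (t : R) : p.1 - p.2 <= t <= p.1 + p.2 -> is_derive t 1 (fun t => atan ((t - Re z) / Im z))
   ((1 + ((t - Re z) / Im z) ^+ 2)^-1 * (Im z)^-1).
  move=> _; apply: (@is_derive1_comp R atan (fun t => (t - Re z) / Im z)).
  apply: is_derive_eps => e e0; exists 1 => // h _.
  have -> : (t + h - Re z) / Im z - (t - Re z) / Im z - (Im z)^-1 * h = 0 by field; lra.
  by rewrite normr0 mulr_ge0// ltW.
have [c c01 ->] := mean_value ab D.
have Y0 : 0 < Im z ^+ 2 + (c - Re z) ^+ 2 by have := sqr_ge0 (c - Re z); have := mulr_gt0 y0 y0; rewrite -expr2; lra.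
have -> : 16 * ((1 + ((c - Re z) / Im z) ^+ 2)^-1 * (Im z)^-1 * (p.1 + p.2 - (p.1 - p.2))) =
  2 * Im z * p.2 * (16 / (Im z ^+ 2 + (c - Re z) ^+ 2)).
  by field; apply/andP; split; rewrite gt_eqF.
apply: ler_wpM2l; first by rewrite !mulr_ge0//; lra.
rewrite -[16 / _]invf_div lef_pV2 ?posrE//; last by rewrite divr_gt0.
rewrite ler_pdivrMr//.
have : cabs (z - Complex c 0) <= 4 * cabs (z - tau p).
  have -> : z - Complex c 0 = (z - tau p) + (tau p - Complex c 0) by ring.
  apply: le_trans (cabsD _ _) _.
  have : cabs (tau p - Complex c 0) <= 3 / 2 * p.2.
    rewrite -(ler_pXn2r (ltn0Sn 1)) ?nnegrE ?cabs_ge0//; last by lra.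
    rewrite cabs_sqr !ReImE /=.
    have : (p.1 - c) ^+ 2 <= p.2 ^+ 2 by move: c01 => /andP[? ?]; nra.
    have := sqr_ge0 p.2; lra.
  lra.
move=> /(lerXn2r 2); rewrite !nnegrE => /(_ (cabs_ge0 _)) H.
have := H (mulr_ge0 (ler0n _ 4) (cabs_ge0 _)).
by rewrite exprMn [cabs (z - Complex c 0) ^+ 2]cabs_sqr !ReImE /=; lra.
Qed.
End GreenFunction.

(** * Comparison of a positive harmonic function with a sum of Green functions *)

Section Barrier.
Variable R : realType.
Local Notation C := R[i].
Local Notation Re := (@complex.Re R).
Local Notation Im := (@complex.Im R).

Lemma finite_pos_lb (T : eqType) (D : seq T) (f : T -> R) : (forall p, p \in D -> 0 < f p) ->
  exists2 r : R, 0 < r & forall p, p \in D -> r <= f p.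
Proof.
elim: D => [|p D IH] H; first by exists 1.
have [|r r0 hr] := IH; first by move=> q qD; apply: H; rewrite inE qD orbT.
exists (Num.min r (f p)); first by rewrite lt_min r0 H// mem_head.
move=> q; rewrite inE => /predU1P[->|/hr]; first by rewrite ge_min lexx orbT.
by rewrite ge_min => ->.
Qed.

Variables (u : C -> R) (g : C -> C) (x1 s lam : R) (D : seq (R * R)).
Hypothesis s0 : 0 < s.
Hypothesis lam0 : 0 <= lam.
Let Om z := `|Re z - x1| < 5 * s /\ 0 < Im z < 5 * s.
Hypothesis harm : forall z, Om z -> harmonic_at u g z.
Hypothesis u_ge0 : forall z, Om z -> 0 <= u z.
Hypothesis uD : uniq D.
Hypothesis dD : disjoint_intervals D.
Hypothesis hD : forall p, p \in D -> [/\ `|p.1 - x1| <= s, 0 < p.2, p.2 <= s / 4 & lam <= u (tau p)].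

Let S := \sum_(p <- D) p.2.
Let V z := \sum_(p <- D) green p z.
Let x1c : C := Complex x1 0.

Lemma S_ge0 : 0 <= S.
Proof. by rewrite /S big_seq; apply: sumr_ge0 => p /hD[_ + _ _]; exact: ltW. Qed.

Lemma Om_of z : cabs (z - x1c) <= 4 * s -> 0 < Im z -> Om z.
Proof.
have s0' := s0; move=> zx z0; have := le_trans (normRe _) zx; have := le_trans (normIm _) zx.
rewrite !ReImE /= subr0 => h1 h2; split; first lra.
by move: h1; rewrite ler_norml => /andP[_ ?]; apply/andP; split; lra.
Qed.

(** The bound depends neither on the number nor on the sizes of the intervals: being disjoint, they
    are seen from [z] under a total angle of at most [pi < 4], and [64 = 16 * 4]. *)
Lemma green_sum_le64 z : 0 < Im z -> (forall p, p \in D -> p.2 / 2 <= cabs (z - tau p)) -> V z <= 64.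
Proof.
move=> z0 zD.
pose f t := atan ((t - Re z) / Im z).
have := @sum_increments R D f (-2) 2 uD dD _ _ _.
have -> : 2 - -2 = 4 :> R by ring.
move=> H; apply: (@le_trans _ _ (16 * \sum_(p <- D) (f (p.1 + p.2) - f (p.1 - p.2)))).
  rewrite mulr_sumr /V !big_seq; apply: ler_sum => p pD.
  by apply: green_atan => //; [have [] := hD pD|exact: zD].
have -> : 64 = 16 * 4 :> R by ring.
apply: ler_wpM2l => //; apply: H.
- by move=> p /hD[].
- move=> x y xy; rewrite /f; have : (x - Re z) / Im z <= (y - Re z) / Im z.
    by rewrite ler_pM2r ?invr_gt0// lerD2r.
  by rewrite le_eqVlt => /predU1P[->//|/lt_atan/ltW].
- move=> x; have := pihalf_lt2 R; have := atan_ltpi2 ((x - Re z) / Im z).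
  by have := atan_gtNpi2 ((x - Re z) / Im z); rewrite /f => *; apply/andP; split; lra.
Qed.

(** The bound keeps the factor [Im z] because on the outer arc it is to be offset by a multiple of
    the harmonic function [Im z]. *)
Lemma green_sum_le z (c : R) : 0 < c -> 0 < Im z -> (forall p, p \in D -> c <= cabs (z - tau p)) ->
  V z <= 2 * Im z * S / c ^+ 2.
Proof.
move=> c0 z0 zD; rewrite [leRHS]mulrAC mulrC /S mulr_suml /V !big_seq; apply: ler_sum => p pD.
have pc := zD p pD; have [_ p0 _ _] := hD pD.
have zt : z != tau p by rewrite -subr_eq0 -cabs_gt0; lra.
have /andP[_ /le_trans] := green_bounds p0 z0 zt; apply.
have -> : p.2 * (2 * Im z / c ^+ 2) = 2 * Im z * p.2 * (c ^+ 2)^-1 by ring.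
apply: ler_wpM2l; first by rewrite !mulr_ge0// ltW.
have t0' : 0 < cabs (z - tau p) by lra.
by rewrite lef_pV2 ?posrE ?exprn_gt0// lerXn2r ?nnegrE//; exact: ltW.
Qed.

(** The minimum principle is applied to [u - kap * V] plus a correction, in a half disc of radius
    [4 * s] without the discs of radius [p.2 / 2] about the poles. On those discs Harnack gives [u
    >= expR (- 4) * lam = 64 * kap >= kap * V]. *)
Theorem barrier : expR (- 4) * lam / 64 * (S / (6 * s)) <= u (Complex x1 s).
Proof.
have s0' := s0; have lam0' := lam0.
pose kap := expR (- 4) * lam / 64.
have kap0 : 0 <= kap by rewrite divr_ge0// mulr_ge0// expR_ge0.
(* On the outer arc all poles are at distance at least [2 * s], so there [V z <= k * Im z]. *)
pose k := S / (2 * s ^+ 2).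
have k0 : 0 <= k by rewrite divr_ge0 ?S_ge0// mulr_ge0// exprn_ge0// ltW.
(* On the line [Im z = d], outside the discs, each Green function is at most
   [2 * d * p.2 / (p.2 / 2) ^+ 2]. *)
pose c1 := \sum_(p <- D) 8 / p.2.
have c10 : 0 <= c1.
  by rewrite /c1 big_seq; apply: sumr_ge0 => p /hD[_ p0 _ _]; rewrite divr_ge0// ltW.
pose t0 := Complex x1 s.
have t0D p : p \in D -> 3 / 4 * s <= cabs (t0 - tau p) /\ cabs (t0 - tau p) ^+ 2 <= 2 * s ^+ 2.
  move=> /hD[px p0 ps _]; split.
    by have := normIm (t0 - tau p); rewrite !ReImE /=; have := ler_norm (s - p.2); lra.
  rewrite cabs_sqr !ReImE /=.
  by move: px; rewrite ler_norml => /andP[? ?]; nra.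
(* The denominator in [green_bounds] is at most [2 s^2 + s^2]. This must beat the correction
   [k * s = S / (2 * s)], and it leaves [S / (6 * s)]. *)
have Vt0 : 2 / 3 * S / s <= V t0.
  rewrite mulrAC mulrC /S mulr_suml /V !big_seq; apply: ler_sum => p pD.
  have [_ p0 ps _] := hD pD; have [h1 h2] := t0D p pD.
  have zt : t0 != tau p by rewrite -subr_eq0 -cabs_gt0; lra.
  have /andP[+ _] := green_bounds p0 (z := t0) s0' zt; apply: le_trans.
  have X0 : 0 < cabs (t0 - tau p) ^+ 2 by rewrite exprn_gt0//; lra.
  have -> : p.2 * (2 / 3 / s) = 2 * s * p.2 / (3 * s ^+ 2) by field; lra.
  rewrite /=; apply: ler_wpM2l; first by rewrite !mulr_ge0// ltW.
  have sp := mulr_gt0 s0' p0.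
  have P1 : 0 < 3 * s ^+ 2 by rewrite mulr_gt0// exprn_gt0.
  have P2 : 0 < cabs (t0 - tau p) ^+ 2 + 4 * s * p.2 by lra.
  rewrite lef_pV2 ?posrE//.
  by move: h2 ps sp; rewrite expr2; nra.
(* No boundary values on the real axis are at hand, so the region is cut at height [d]; there
   [u >= 0], and the constant that offsets [V] vanishes with [d]. *)
have key d : 0 < d < s -> 0 <= u t0 + (- kap) * V t0 + (kap * d * c1 + kap * k * s).
  move=> /andP[d0 ds].
  pose b := Complex 0 (- (kap * k)).
  pose A z := [/\ cabs (z - x1c) <= 4 * s, d <= Im z & forall p, p \in D -> p.2 / 2 <= cabs (z - tau p)].
  pose bdry z := [\/ cabs (z - x1c) = 4 * s, Im z = d | exists2 p, p \in D & cabs (z - tau p) = p.2 / 2].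
  pose w z := u z + (- kap) * V z + (kap * d * c1 + Re (b * z)).
  pose gw z := g z + cR (- kap) * (\sum_(p <- D) ((z - taubar p)^-1 + cR (-1) * (z - tau p)^-1)) + (0 + b).
  have bE z : Re (b * z) = kap * k * Im z by rewrite !ReImE /=; ring.
  have AOm z : A z -> Om z by move=> [z1 z2 _]; apply: Om_of => //; lra.
  suff : 0 <= w t0 by rewrite /w bE.
  have perturb (z h c : C) (r : R) : cabs h < r -> `|cabs (z + h - c) - cabs (z - c)| < r.
    move=> hr; have := cabsD (z - c) h; have := cabsD (z + h - c) (- h).
    have -> : z + h - c - h = z - c by ring.
    have -> : z - c + h = z + h - c by ring.
    by rewrite cabsN ltr_norml => *; apply/andP; split; lra.
  have perturbI (z h : C) (r : R) : cabs h < r -> `|Im (z + h) - Im z| < r.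
    by move=> hr; rewrite Im_add addrC addKr; apply: le_lt_trans (normIm _) hr.
  apply: (@min_principle R A bdry w gw (4 * s + cabs x1c)).
  - by move=> z [z1 _ _]; have := cabsD (z - x1c) x1c; rewrite subrK; lra.
  - move=> z nA; have [z1|z1] := leP (cabs (z - x1c)) (4 * s); last first.
      exists (cabs (z - x1c) - 4 * s) => [|h hh [z2 _ _]]; first lra.
      by have := perturb z h x1c _ hh; rewrite ltr_norml => /andP[? ?]; lra.
    have [z2|z2] := leP d (Im z); last first.
      exists (d - Im z) => [|h hh [_ z3 _]]; first lra.
      by have := perturbI z h _ hh; rewrite ltr_norml => /andP[? ?]; lra.
    have [p pD zp] : exists2 p, p \in D & cabs (z - tau p) < p.2 / 2.
      apply: contrapT => H; apply: nA; split => // p pD; rewrite leNgt; apply/negP => zp.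
      by apply: H; exists p.
    exists (p.2 / 2 - cabs (z - tau p)) => [|h hh [_ _ /(_ _ pD) z3]]; first lra.
    by have := perturb z h (tau p) _ hh; rewrite ltr_norml => /andP[? ?]; lra.
  - move=> z Az; have [z1 z2 z3] := Az.
    apply: harmonicD; last exact: harmonic_affine.
    apply: harmonicD; first exact/harm/AOm.
    apply: harmonicZ; apply: harmonic_sum => p pD.
    have [_ p0 _ _] := hD pD.
    have -> : green p = (fun z => ln (cabs (z - taubar p)) + (-1) * ln (cabs (z - tau p))).
      by apply/funext => y; rewrite mulN1r.
    apply: harmonicD; last apply: harmonicZ; apply: harmonic_ln_cabs.
      by apply/eqP => zE; move: z2; rewrite zE /=; lra.
    by rewrite -subr_eq0 -cabs_gt0; have := z3 p pD; lra.
  - move=> z [z1 z2 z3]; have [nb|nb] := pselect (bdry z); [by left|right].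
    have b1 : cabs (z - x1c) < 4 * s by rewrite lt_neqAle z1 andbT; apply/eqP => E; apply: nb; constructor 1.
    have b2 : d < Im z by rewrite lt_neqAle z2 andbT; apply/eqP => E; apply: nb; constructor 2.
    have [|r r0 hr] := @finite_pos_lb _ D (fun p => cabs (z - tau p) - p.2 / 2).
      move=> p pD; rewrite subr_gt0 lt_neqAle z3// andbT; apply/eqP => E; apply: nb.
      by constructor 3; exists p.
    exists (Num.min r (Num.min (4 * s - cabs (z - x1c)) (Im z - d))).
      by rewrite !lt_min r0 !subr_gt0 b1.
    move=> y; rewrite !lt_min => /and3P[y1 y2 y3].
    have yE : y = z + (y - z) by rewrite subrKC.
    rewrite yE; split.
    + by have := perturb z (y - z) x1c _ y2; rewrite ltr_norml => /andP[? ?]; lra.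
    + by have := perturbI z (y - z) _ y3; rewrite ltr_norml => /andP[? ?]; lra.
    + move=> p pD; have := perturb z (y - z) (tau p) _ y1; have := hr p pD.
      by rewrite ltr_norml => ? /andP[? ?]; lra.
  - move=> z Az; have [z1 z2 z3] := Az.
    have z0 : 0 < Im z by lra.
    rewrite /w bE; have uz := u_ge0 (AOm _ Az).
    have kdc : 0 <= kap * d * c1 by apply: mulr_ge0 => //; apply: mulr_ge0 => //; exact: ltW.
    have kkz : 0 <= kap * k * Im z by apply: mulr_ge0; [exact: mulr_ge0|exact: ltW].
    case => [zb|zb|[p pD zb]].
    + have : V z <= k * Im z.
        have -> : k * Im z = 2 * Im z * S / (2 * s) ^+ 2 by rewrite /k; field; lra.
        apply: green_sum_le => //; first lra.
        move=> p pD; have [px p0 ps _] := hD pD.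
        have := cabsD (z - tau p) (tau p - x1c); rewrite addrA subrK zb.
        have := cabs_ReIm (tau p - x1c); rewrite !ReImE /= subr0 [`|p.2|]ger0_norm; last lra.
        lra.
      by move=> /(ler_wpM2l kap0); lra.
    + have : V z <= d * c1.
        rewrite /V /c1 mulr_sumr !big_seq; apply: ler_sum => p pD.
        have [_ p0 _ _] := hD pD; have z3p := z3 p pD.
        have zt : z != tau p by rewrite -subr_eq0 -cabs_gt0; lra.
        have /andP[_ /le_trans] := green_bounds p0 z0 zt; apply.
        have -> : d * (8 / p.2) = 2 * Im z * p.2 * ((p.2 / 2) ^+ 2)^-1.
          by rewrite zb; field; lra.
        apply: ler_wpM2l; first by rewrite !mulr_ge0// ltW.
        have z3' : 0 < cabs (z - tau p) by lra.
        have p2 : 0 < p.2 / 2 by lra.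
        by rewrite lef_pV2 ?posrE ?exprn_gt0// lerXn2r ?nnegrE//; exact: ltW.
      by move=> /(ler_wpM2l kap0); lra.
    + have [px p0 ps lp] := hD pD.
      have : kap * V z <= expR (- 4) * lam.
        have -> : expR (- 4) * lam = kap * 64 by rewrite /kap; field.
        by apply: ler_wpM2l => //; exact: green_sum_le64.
      have := @harnack R u g (tau p) p.2 p0 _ _ z.
      have sub y : cabs (y - tau p) < p.2 -> Om y.
        move=> yp; have := le_lt_trans (normRe _) yp; have := le_lt_trans (normIm _) yp.
        rewrite /Om !ReImE /=; clear -px p0 ps s0' lam0 harm u_ge0 uD dD hD.
        rewrite !ltr_norml => /andP[? ?] /andP[? ?]; move: px; rewrite ler_norml => /andP[? ?].
        by split; apply/andP; split; lra.
      move=> /(_ (fun y yp => harm (sub y yp)) (fun y yp => u_ge0 (sub y yp))).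
      rewrite zb => /(_ (lexx _)) H.
      have : expR (- 4) * lam <= expR (- 4) * u (tau p) by apply: ler_wpM2l lp; exact: expR_ge0.
      lra.
  - split => /=; [|lra|].
      have := cabs_ReIm (t0 - x1c); rewrite !ReImE /= subrr subr0 normr0 add0r gtr0_norm//; lra.
    move=> p pD; have [px p0 ps _] := hD pD; have [+ _] := t0D p pD; lra.
have key' : 0 <= u t0 + (- kap) * V t0 + kap * k * s.
  apply/ler_addgt0Pr => e e0.
  have kc0 : 0 < kap * c1 + 1 by rewrite ltr_wpDl// mulr_ge0.
  pose d := Num.min (s / 2) (e / (kap * c1 + 1)).
  have d0 : 0 < d by rewrite lt_min !divr_gt0.
  have ds : d <= s / 2 by rewrite ge_min lexx.
  have de : d * (kap * c1 + 1) <= e by rewrite -ler_pdivlMr// ge_min lexx orbT.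
  have /key : 0 < d < s by rewrite d0; lra.
  by lra.
have : kap * (2 / 3 * S / s) <= kap * V t0 by exact: ler_wpM2l.
have E : kap * k * s = kap * (S / s) / 2 by rewrite /k; field; lra.
rewrite E in key'.
have -> : kap * (S / (6 * s)) = kap * (S / s) / 6 by field; lra.
have -> : kap * (2 / 3 * S / s) = kap * (S / s) * (2 / 3) by field; lra.
rewrite -/t0; lra.
Qed.
End Barrier.

(** * Harmonic functions unbounded on almost all lines *)

Section Vitali.
Variable R : realType.
Local Notation C := R[i].
Local Notation Re := (@complex.Re R).
Local Notation Im := (@complex.Im R).
Local Notation leb := (@lebesgue_measure R).

Lemma leb_balls_le (D : seq R) (r : R -> R) : (forall t, 0 <= r t) ->
  measurable (\big[setU/set0]_(t <- D) ball t (r t) : set R) /\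
  (leb (\big[setU/set0]_(t <- D) ball t (r t)) <= (\sum_(t <- D) 2 * r t)%:E)%E.
Proof.
move=> r0; elim: D => [|t D [mU IH]]; first by rewrite !big_nil measure0.
rewrite !big_cons; have mb : measurable (ball t (r t) : set R) by rewrite ball_itv; exact: measurable_itv.
split; first by apply: measurableU.
apply: le_trans (measureU2 _ _ _) _ => //.
rewrite EFinD; apply: leeD => //.
by rewrite mulr_natl -(lebesgue_measure_ball t (r0 t)).
Qed.

(** Since [y] may be nonmeasurable, the compact base is covered by the intervals about its good
    points together with an open [W] containing [N], of measure at most [s]. A finite subcover and
    Vitali's threefold enlargement give [2 * s <= s + 6 * sum y]. *)
Lemma vitali_selection (N : set R) (x1 s : R) (y : R -> R) : 0 < s -> leb.-negligible N ->
  (forall t, 0 < y t) ->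
  exists D : seq R, [/\ uniq D, forall t, t \in D -> `|t - x1| <= s /\ ~ N t,
     disjoint_intervals [seq (t, y t) | t <- D] & s / 6 <= \sum_(t <- D) y t].
Proof.
move=> s0 [Z [mZ Z0 NZ]] y0.
have Zfin : (leb Z < +oo)%E by rewrite Z0.
have [W [oO ZO OZ]] := lebesgue_regularity_outer mZ Zfin s0.
have mO : measurable (W : set R) by exact: measurable_realfun.open_measurable.
have O_s : (leb W <= s%:E)%E.
  rewrite -(setDUK ZO); apply: (@le_trans _ _ (leb Z + leb (W `\` Z))%E).
    by apply: measureU2 => //; exact: measurableD.
  by rewrite Z0 add0e; exact: ltW.
(* [None] indexes the open set [W], and [Some t] the interval about [t]. *)
pose T : set (option R) := [set o | if o is Some t then `|t - x1| <= s /\ ~ N t else True].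
pose F (o : option R) : set R := if o is Some t then ball t (y t) else W.
have cc : cover_compact `[x1 - s, x1 + s]%classic by rewrite -compact_cover; exact: segment_compact.
have [||D' D'T cov] := cc _ T F.
- by case=> [t|] _ //=; exact: ball_open.
- move=> x; rewrite /= in_itv /= => /andP[xl xr].
  have [Nx|Nx] := pselect (N x); first by exists None => //=; apply/ZO/NZ.
  exists (Some x) => /=; last exact: ballxx.
  by split => //; rewrite ler_norml; apply/andP; split; lra.
pose l := pmap id (finmap.enum_fset D').
have lP t : t \in l -> `|t - x1| <= s /\ ~ N t.
  rewrite mem_pmap map_id => tD'.
  by have := D'T (Some t) tD'; rewrite inE.
have [D [uD Dl trD covD]] := vitali_lemma_finite_cover
  (fun t : R => is_ball_ball t (y t)) (fun t => ex_intro _ t (ballxx _ (y0 t))) l.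
exists D; split => //.
- by move=> t /Dl; exact: lP.
- move=> _ _ /mapP[a aD ->] /mapP[b bD ->] /= ab.
  have {}ab : a != b by apply: contraNneq ab => ->.
  have [h|h] := leP (a + y a) (b - y b); first by left.
  have [h'|h'] := leP (b + y b) (a - y a); first by right.
  exfalso; move/eqP: ab; apply; apply: (trD a b) => //.
  have ya := y0 a; have yb := y0 b.
  (* Overlapping intervals would share the midpoint of their overlap, but the selected ones are
     pairwise disjoint as sets. *)
  pose lo := Num.max (a - y a) (b - y b); pose hi := Num.min (a + y a) (b + y b).
  have lohi : lo < hi by rewrite lt_min !gt_max; apply/andP; split; apply/andP; split; lra.
  have [l1 l2] : a - y a <= lo /\ b - y b <= lo by rewrite !le_max !lexx orbT.
  have [l3 l4] : hi <= a + y a /\ hi <= b + y b by rewrite !ge_min !lexx orbT.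
  exists ((lo + hi) / 2); split; rewrite ball_itv /= in_itv /=; apply/andP; split; lra.
- have y3 t : 0 <= 3 * y t by rewrite mulr_ge0// ltW.
  have [mU leU] := leb_balls_le D y3.
  pose J : set R := `[x1 - s, x1 + s]%classic.
  have : (leb J <= s%:E + (\sum_(t <- D) 2 * (3 * y t))%:E)%E.
    apply: (@le_trans _ _ (leb (W `|` \big[setU/set0]_(t <- D) ball t (3 * y t)))).
      apply: le_measure; rewrite ?inE; [exact: measurable_itv|exact: measurableU|].
      move=> x /cov[[t|] /= tD' xt]; last by left.
      right; rewrite -bigcup_seq.
      have [|t' /= t'D] := covD x; first by exists t => //=; rewrite mem_pmap map_id.
      by rewrite scale_ballE// => ?; exists t'.
    by apply: le_trans (measureU2 _ _ _) _ => //; exact: leeD.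
  rewrite /J lebesgue_measure_itv /= lte_fin (_ : x1 - s < x1 + s); last lra.
  rewrite -EFinB -EFinD lee_fin -!mulr_sumr; lra.
Qed.

Theorem harmonic_not_radially_unbounded (u : C -> R) g (x1 s : R) (N : set R) : 0 < s ->
  leb.-negligible N ->
  (forall z, `|Re z - x1| < 5 * s /\ 0 < Im z < 5 * s -> harmonic_at u g z) ->
  (forall z, `|Re z - x1| < 5 * s /\ 0 < Im z < 5 * s -> 0 <= u z) ->
  ~ (forall t M, `|t - x1| <= s -> ~ N t -> exists2 y, 0 < y <= s / 4 & M <= u (Complex t y)).
Proof.
move=> s0 N0 harm u0 unb.
have t0 : 0 <= u (Complex x1 s) by apply: u0; rewrite /= subrr normr0; split; lra.
(* Inverts the constants of [barrier]: as the half-lengths add up to at least [s / 6], the last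
   factor there is at least [1 / 36], and the conclusion becomes [u + 1 <= u] at the fixed point. *)
pose lam := expR 4 * (36 * 64 * (u (Complex x1 s) + 1)).
have lam0 : 0 <= lam by rewrite mulr_ge0 ?expR_ge0//; lra.
have /choice[y Hy] : forall t, exists y, 0 < y /\ (`|t - x1| <= s -> ~ N t -> y <= s / 4 /\ lam <= u (Complex t y)).
  move=> t; have [[h1 h2]|h] := pselect (`|t - x1| <= s /\ ~ N t).
    by have [y /andP[y0 ys] uy] := unb t lam h1 h2; exists y.
  (* A default half-length: such points are never selected, but [y] has to be positive
     everywhere. *)
  by exists 1; split => // h1 h2; case: h.
have [D [uD DP dD sD]] := vitali_selection x1 s0 N0 (fun t => proj1 (Hy t)).
have := @barrier R u g x1 s lam [seq (t, y t) | t <- D] s0 lam0 harm u0.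
rewrite map_inj_uniq => [|a b []//].
move=> /(_ uD dD); have hD p : p \in [seq (t, y t) | t <- D] ->
    [/\ `|p.1 - x1| <= s, 0 < p.2, p.2 <= s / 4 & lam <= u (tau p)].
  move=> /mapP[t /DP[h1 h2] ->] /=; have [yt /(_ h1 h2)[ys lu]] := Hy t.
  by split.
move=> /(_ hD); rewrite big_map /= => H.
have e4 := expR_gt0 (4 : R).
have E1 : expR (- 4) * lam / 64 = 36 * (u (Complex x1 s) + 1).
  by rewrite expRN /lam; field; rewrite gt_eqF.
move: H; rewrite E1.
have : 36^-1 <= (\sum_(t <- D) y t) / (6 * s).
  by rewrite ler_pdivlMr; lra.
move: (\sum_(t <- D) y t / (6 * s)) (u _) t0 => Q U U0; nra.
Qed.
End Vitali.

(** * Logarithmic potentials *)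

Section BorelPlane.
Variable R : realType.
Local Notation C := R[i].
Local Notation Re := (@complex.Re R).
Local Notation Im := (@complex.Im R).
Local Notation B := (Cborel R).

Lemma nbhs_cabs (z : C) (A : set C) : nbhs z A <->
  exists2 e : R, 0 < e & forall w, cabs (w - z) < e -> A w.
Proof.
split.
  move=> /nbhs_ballP[r /= r0 hr].
  have [r1 rE] : exists r1, r = cR r1.
    by move: r0; rewrite ltcE /= => /andP[/eqP i0 _]; exists (Re r); case: (r) i0 => a b /= ->.
  exists r1; first by move: r0; rewrite rE ltcE /= => /andP[].
  by move=> w hw; apply: hr; rewrite -ball_normE /= normc_cabs rE ltcE /= eqxx /= cabsB.
move=> [e e0 H]; apply/nbhs_ballP; exists (cR e) => /=; first by rewrite ltcE /= eqxx.
by move=> w; rewrite -ball_normE /= normc_cabs ltcE /= eqxx /= cabsB => /H.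
Qed.

Lemma compact_dist (K : set C) w : compact K -> ~ K w ->
  exists2 d : R, 0 < d & forall z, K z -> d <= cabs (w - z).
Proof.
move=> cK Kw; have clK := compact_closed (@norm_hausdorff _ _) cK.
have : nbhs w (~` K) by apply: open_nbhs_nbhs; split => //; exact: closed_openC.
move=> /nbhs_cabs[d d0 hd]; exists d => // z Kz; rewrite leNgt; apply/negP => zw.
by apply: (hd z) Kz; rewrite cabsB.
Qed.

Lemma compact_cabs_bounded (K : set C) : compact K -> exists M : R, forall z, K z -> cabs z <= M.
Proof.
rewrite compact_cover => cK.
have [||D _ cov] := cK nat setT (fun n => [set z : C | cabs z < n%:R]).
- move=> n _; rewrite openE => z /= zn; apply/nbhs_cabs; exists (n%:R - cabs z); first by rewrite subr_gt0.
  by move=> w wz /=; have := cabsD (w - z) z; rewrite subrK; lra.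
- move=> z _; exists (Num.bound (cabs z)) => //=; exact: archi_boundP (cabs_ge0 z).
pose M : R := \sum_(n <- finmap.enum_fset D) n%:R.
exists M => z /cov[n /= nD zn]; apply: le_trans (ltW zn) _.
by rewrite /M (big_rem n)//= lerDl sumr_ge0.
Qed.

Lemma measurable_open (U : set C) : open U -> measurable (U : set B).
Proof. by move=> oU; exact: sub_sigma_algebra. Qed.

Lemma measurable_compact (K : set C) : compact K -> measurable (K : set B).
Proof.
move=> cK; rewrite -[K]setCK; apply: measurableC; apply: measurable_open.
by apply: closed_openC; apply: compact_closed cK; exact: norm_hausdorff.
Qed.

Lemma measurable_lip (h : C -> R) : (forall z w, `|h z - h w| <= cabs (z - w)) ->
  measurable_fun setT (h : B -> R).
Proof.
move=> lip; apply: (measurability _ (RGenOInfty.measurableE R)) => //.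
move=> _ [_ [x ->] <-]; rewrite setTI; apply: measurable_open.
rewrite openE => z; rewrite /= in_itv /= andbT => xz.
apply/nbhs_cabs; exists (h z - x); first by rewrite subr_gt0.
move=> w wz; rewrite /= in_itv /= andbT.
have := lip z w; rewrite cabsB ler_norml => /andP[_]; lra.
Qed.

Lemma measurable_Re : measurable_fun setT (Re : B -> R).
Proof. by apply: measurable_lip => z w; rewrite -Re_opp -Re_add; exact: normRe. Qed.

Lemma measurable_Im : measurable_fun setT (Im : B -> R).
Proof. by apply: measurable_lip => z w; rewrite -Im_opp -Im_add; exact: normIm. Qed.

Lemma measurable_cabsB w : measurable_fun setT (fun z : B => cabs (w - z)).
Proof.
apply: (@measurable_lip (fun z => cabs (w - z))) => y z.
rewrite ler_norml; apply/andP; split.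
  have := cabsD (w - y) (y - z); rewrite addrA subrK; lra.
by have := cabsD (w - z) (z - y); rewrite addrA subrK [cabs (z - y)]cabsB; lra.
Qed.

(** A polynomial in the coordinates is measurable for the product sigma-algebra, without comparing
    the latter with the Borel sets of the product. *)
Definition sqdist (x : B * B) : R := (Re x.1 - Re x.2) ^+ 2 + (Im x.1 - Im x.2) ^+ 2.

Lemma sqdistE z w : sqdist (z, w) = cabs (z - w) ^+ 2.
Proof. by rewrite cabs_sqr !ReImE. Qed.

Lemma measurable_sqdist : measurable_fun setT sqdist.
Proof.
apply: measurable_funD; apply: measurable_funX; apply: measurable_funB.
- exact: (measurableT_comp measurable_Re measurable_fst).
- exact: (measurableT_comp measurable_Re measurable_snd).
- exact: (measurableT_comp measurable_Im measurable_fst).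
- exact: (measurableT_comp measurable_Im measurable_snd).
Qed.

Lemma logkernelE z w : logkernel z w = if sqdist (z, w) == 0 then -oo%E else (ln (sqdist (z, w)) / 2)%:E.
Proof.
rewrite /logkernel sqdistE sqrf_eq0 cabs_eq0 subr_eq0; case: ifPn => // zw.
by rewrite ln_cabs ?subr_eq0.
Qed.

Lemma measurable_logkernel : measurable_fun setT (fun x : B * B => logkernel x.1 x.2).
Proof.
have -> : (fun x : B * B => logkernel x.1 x.2) =
    (fun q : R => if q == 0 then -oo%E else (ln q / 2)%:E) \o sqdist.
  by apply/funext => -[z w]; rewrite /= logkernelE.
apply: measurableT_comp measurable_sqdist.
apply: measurable_fun_ifT.
- exact: measurable_fun_eqr.
- exact: measurable_cst.
- apply/measurable_EFinP; apply: measurable_funM => //.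
Qed.

Lemma Re_inv (z : C) : Re z^-1 = Re z / cabs z ^+ 2.
Proof. by rewrite cabs_sqr; case: z. Qed.
Lemma Im_inv (z : C) : Im z^-1 = - Im z / cabs z ^+ 2.
Proof. by rewrite cabs_sqr; case: z => x y /=; rewrite mulNr. Qed.

Section FiniteEnergy.
Variable mu : {measure set B -> \bar R}.
Hypothesis mufin : (mu setT < +oo)%E.

(** The measure [mu] itself, repackaged as a finite measure so that Tonelli's theorem applies. *)
Let nu : {finite_measure set B -> \bar R} := mfrestr measurableT mufin.

Lemma integral_nu (f : B -> \bar R) : (\int[nu]_w f w = \int[mu]_w f w)%E.
Proof.
apply: eq_measure_integral => A mA _.
by rewrite /nu /= /mfrestr /mrestr setIT.
Qed.

Definition negative_log_potential z := (\int[mu]_w (logkernel z)^\- w)%E.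
Local Notation N := negative_log_potential.

Lemma measurable_negative_log_potential : measurable_fun setT (N : B -> \bar R).
Proof.
have m : measurable_fun setT (fun x : B * B => (logkernel x.1)^\- x.2)%E.
  have -> : (fun x : B * B => (logkernel x.1)^\- x.2)%E = ((fun x : B * B => logkernel x.1 x.2)^\-)%E.
    by apply/funext => x; rewrite !funenegE.
  exact: (measurable_funeneg measurable_logkernel).
have := @measurable_fun_fubini_tonelli_F _ _ _ _ R nu _ m (fun x => funeneg_ge0 _ _).
by congr measurable_fun; apply/funext => z; rewrite /fubini_F integral_nu.
Qed.

Lemma measurable_log_potential : measurable_fun setT (fun z : B => \int[mu]_w logkernel z w)%E.
Proof.
have m : measurable_fun setT (fun x : B * B => (logkernel x.1)^\+ x.2)%E.
  have -> : (fun x : B * B => (logkernel x.1)^\+ x.2)%E = ((fun x : B * B => logkernel x.1 x.2)^\+)%E.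
    by apply/funext => x; rewrite !funeposE.
  exact: (measurable_funepos measurable_logkernel).
have mp := @measurable_fun_fubini_tonelli_F _ _ _ _ R nu _ m (fun x => funepos_ge0 _ _).
have -> : (fun z : B => \int[mu]_w logkernel z w)%E =
    (fun z => fubini_F nu (fun x : B * B => (logkernel x.1)^\+ x.2) z - N z)%E.
  by apply/funext => z; rewrite /fubini_F integral_nu [LHS]integralE.
by apply: emeasurable_funB => //; exact: measurable_negative_log_potential.
Qed.

(** If every sublevel set of [N] were null, [N] would be [+oo] almost everywhere, hence the inner
    integral and the energy would be [-oo]. Intersecting a sublevel set with [K] loses no mass. *)
Lemma finite_energy_set (K : set C) : mu setT != 0%E -> compact K -> mu (~` K) = 0%E ->
  energy mu != -oo%E ->
  exists (A : set B) (M : R), [/\ measurable A, A `<=` K, mu A != 0%E &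
    forall z, A z -> (N z <= M%:E)%E].
Proof.
move=> mu0 cK muK En.
have mK := measurable_compact cK.
have mN := measurable_negative_log_potential.
pose L (n : nat) : set B := [set z | (N z <= n%:R%:E)%E].
have mL n : measurable (L n).
  by rewrite -[L n]setTI; exact: emeasurable_fun_infty_c.
have [n Ln] : exists n, mu (L n) != 0%E.
  apply: contrapT => H.
  have {}H n : mu (L n) = 0%E by apply/eqP/negPn/negP => ?; apply: H; exists n.
  have LU : mu (\bigcup_n L n) = 0%E.
    apply/negligibleP; first exact: bigcup_measurable.
    by apply: negligible_bigcup => n; apply/negligibleP; [exact: mL|exact: H].
  move/eqP: En; apply.
  rewrite /energy (@ae_eq_integral _ _ _ mu setT (cst -oo%E)) //.
  - by rewrite integral_cst//; apply: gt0_mulNye; rewrite lt0e mu0 measure_ge0.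
  - exact: measurable_log_potential.
  exists (\bigcup_n L n); split => //; first exact: bigcup_measurable.
  move=> z /= Hz; apply: contrapT => nz; apply: Hz => _.
  have N0 : (0 <= N z)%E by apply: integral_ge0 => w _; exact: funeneg_ge0.
  have Nz : N z = +oo%E.
    case E : (N z) N0 => [x| |]// x0; exfalso; apply: nz.
    exists (Num.bound x) => //=; rewrite /L /= E lee_fin ltW//.
    exact: archi_boundP.
  (* By convention [-oo] absorbs [+oo], so the sum is [-oo] whatever the positive part. *)
  by rewrite [LHS]integralE -/(N z) Nz /= addeNy.
exists (L n `&` K), n%:R; split.
- exact: measurableI.
- by move=> z [].
- apply: contra Ln => /eqP LK; rewrite -measure_le0.
  apply: (@le_trans _ _ (mu (L n `&` K) + mu (~` K))%E); last by rewrite LK muK adde0.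
  apply: (@le_trans _ _ (mu ((L n `&` K) `|` ~` K))).
    apply: le_measure; rewrite ?inE//.
      by apply: measurableU; [exact: measurableI|exact: measurableC].
    by move=> z Lz; have [Kz|Kz] := pselect (K z); [left|right].
  by apply: measureU2; [exact: measurableI|exact: measurableC].
- by move=> z [].
Qed.

End FiniteEnergy.
End BorelPlane.

(** * The logarithmic potential of the restricted measure, off the compact set *)

Section Potential.
Variable R : realType.
Local Notation C := R[i].
Local Notation Re := (@complex.Re R).
Local Notation Im := (@complex.Im R).
Local Notation B := (Cborel R).
Variables (mu : {measure set B -> \bar R}) (A : set B) (K : set C).
Hypothesis mA : measurable A.
Hypothesis Afin : (mu A < +oo)%E.
Hypothesis AK : A `<=` K.
Hypothesis cK : compact K.

Let m := fine (mu A).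
Let RI (f : C -> R) : R := \int[mu]_(z in A) f z.
Let CI (f : C -> C) : C := Complex (RI (fun z => Re (f z))) (RI (fun z => Im (f z))).

(** Bounded on [A] only: the kernels [ln |w - z|] and [1 / (w - z)] are unbounded near [z = w],
    which stays away from [A]. *)
Definition bounded_measurable (f : C -> R) :=
  measurable_fun setT (f : B -> R) /\ exists M, forall z, A z -> `|f z| <= M.
Local Notation bm := bounded_measurable.

Lemma bm_integrable f : bm f -> mu.-integrable A (EFin \o f).
Proof.
move=> [mf [M HM]]; apply: measurable_bounded_integrable => //.
  exact: measurable_funTS.
exists M; split; first exact: num_real.
by move=> x Mx z Az /=; apply: le_trans (HM z Az) (ltW Mx).
Qed.

Lemma bmD f g : bm f -> bm g -> bm (fun z => f z + g z).
Proof.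
move=> [mf [M HM]] [mg [N HN]]; split; first exact: measurable_funD.
by exists (M + N) => z Az; apply: le_trans (ler_normD _ _) (lerD (HM z Az) (HN z Az)).
Qed.

Lemma bmZ (c : R) f : bm f -> bm (fun z => c * f z).
Proof.
move=> [mf [M HM]]; split; first exact: measurable_funM.
by exists (`|c| * M) => z Az; rewrite normrM ler_wpM2l// HM.
Qed.

Lemma RI_D f g : bm f -> bm g -> RI (fun z => f z + g z) = RI f + RI g.
Proof. by move=> bf bg; apply: RintegralD => //; exact: bm_integrable. Qed.

Lemma RI_Z c f : bm f -> RI (fun z => c * f z) = c * RI f.
Proof. by move=> bf; apply: RintegralZl => //; exact: bm_integrable. Qed.

Lemma RI_bound f M : bm f -> (forall z, A z -> `|f z| <= M) -> `|RI f| <= M * m.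
Proof.
move=> bf HM; have := @Rintegral_near_cst R _ _ mu A f 0 M mA Afin (bm_integrable bf).
by rewrite mul0r subr0; apply => z Az; rewrite subr0 HM.
Qed.

Lemma m_ge0 : 0 <= m. Proof. by rewrite /m fine_ge0. Qed.

Lemma bm_inv w (d : R) : 0 < d -> (forall z, A z -> d <= cabs (w - z)) ->
  bm (fun z => (cabs (w - z) ^+ 2)^-1).
Proof.
move=> d0 dA; split.
  have -> : (fun z : B => (cabs (w - z) ^+ 2)^-1) = (fun z => (cabs (w - z) ^+ 2) `^ (-1)).
    by apply/funext => z; rewrite powR_inv1// sqr_ge0.
  apply: (measurableT_comp (measurable_powR _)).
  exact: measurable_funX (measurable_cabsB w).
exists (d ^+ 2)^-1 => z Az; have dz := dA z Az; have c0 : 0 < cabs (w - z) by lra.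
rewrite ger0_norm ?invr_ge0 ?sqr_ge0//.
by rewrite lef_pV2 ?posrE ?exprn_gt0// lerXn2r ?nnegrE ?cabs_ge0// ltW.
Qed.

Lemma bmM f g : bm f -> bm g -> bm (fun z => f z * g z).
Proof.
move=> [mf [M HM]] [mg [N HN]]; split; first exact: measurable_funM.
by exists (M * N) => z Az; rewrite normrM; apply: ler_pM => //; [exact: HM|exact: HN].
Qed.

Lemma A_bounded : exists M, forall z, A z -> cabs z <= M.
Proof. by have [M HM] := compact_cabs_bounded cK; exists M => z /AK/HM. Qed.

Lemma bm_ReB w : bm (fun z => Re (w - z)).
Proof.
have [M HM] := A_bounded; split.
  have -> : (fun z : B => Re (w - z)) = (fun z => Re w - Re z) by apply/funext => z; rewrite !ReImE.
  by apply: measurable_funB => //; exact: measurable_Re.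
exists (cabs w + M) => z Az; apply: le_trans (normRe _) _.
by apply: le_trans (cabsD _ _) _; rewrite cabsN lerD2l HM.
Qed.

Lemma bm_ImB w : bm (fun z => - Im (w - z)).
Proof.
have [M HM] := A_bounded; split.
  have -> : (fun z : B => - Im (w - z)) = (fun z => Im z - Im w).
    by apply/funext => z; rewrite !ReImE opprD opprK addrC.
  by apply: measurable_funB => //; exact: measurable_Im.
exists (cabs w + M) => z Az; rewrite normrN; apply: le_trans (normIm _) _.
by apply: le_trans (cabsD _ _) _; rewrite cabsN lerD2l HM.
Qed.

Definition cbm (f : C -> C) := bm (fun z => Re (f z)) /\ bm (fun z => Im (f z)).

Lemma cbm_inv w (d : R) : 0 < d -> (forall z, A z -> d <= cabs (w - z)) ->
  cbm (fun z => (w - z)^-1).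
Proof.
move=> d0 dA; split.
  have -> : (fun z => Re (w - z)^-1) = (fun z => Re (w - z) * (cabs (w - z) ^+ 2)^-1).
    by apply/funext => z; rewrite Re_inv.
  by apply: bmM; [exact: bm_ReB|exact: bm_inv dA].
have -> : (fun z => Im (w - z)^-1) = (fun z => - Im (w - z) * (cabs (w - z) ^+ 2)^-1).
  by apply/funext => z; rewrite Im_inv.
by apply: bmM; [exact: bm_ImB|exact: bm_inv dA].
Qed.

Lemma bmN f : bm f -> bm (fun z => - f z).
Proof.
move=> bf; have -> : (fun z => - f z) = (fun z => (-1) * f z) by apply/funext => z; rewrite mulN1r.
exact: bmZ.
Qed.

Lemma cbmM f g : cbm f -> cbm g -> cbm (fun z => f z * g z).
Proof.
move=> [f1 f2] [g1 g2]; split.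
  have -> : (fun z => Re (f z * g z)) = (fun z => Re (f z) * Re (g z) + - (Im (f z) * Im (g z))).
    by apply/funext => z; rewrite Re_mul.
  by apply: bmD; [exact: bmM|apply: bmN; exact: bmM].
have -> : (fun z => Im (f z * g z)) = (fun z => Re (f z) * Im (g z) + Im (f z) * Re (g z)).
  by apply/funext => z; rewrite Im_mul.
by apply: bmD; exact: bmM.
Qed.

Lemma bm_ln w (d : R) : 0 < d -> (forall z, A z -> d <= cabs (w - z)) ->
  bm (fun z => ln (cabs (w - z))).
Proof.
move=> d0 dA; split; first exact: (measurableT_comp (@measurable_ln R) (measurable_cabsB w)).
have [M HM] := A_bounded; exists (`|ln d| + `|ln (cabs w + M)|) => z Az.
have dz := dA z Az; have c0 : 0 < cabs (w - z) by lra.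
have zM : cabs (w - z) <= cabs w + M.
  by apply: le_trans (cabsD _ _) _; rewrite cabsN lerD2l HM.
have l1 : ln d <= ln (cabs (w - z)) by rewrite ler_ln.
have l2 : ln (cabs (w - z)) <= ln (cabs w + M) by rewrite ler_ln ?posrE//; lra.
have := ler_norm (ln (cabs w + M)); have := ler_norm (- ln d); rewrite normrN.
have := normr_ge0 (ln d); have := normr_ge0 (ln (cabs w + M)).
by move=> *; rewrite ler_norml; apply/andP; split; lra.
Qed.

Definition potential w := RI (fun z => ln (cabs (w - z))).
Definition cauchy_transform w := CI (fun z => (w - z)^-1).

Lemma dist_perturb w (d : R) h : (forall z, A z -> d <= cabs (w - z)) -> cabs h < d / 2 ->
  forall z, A z -> d / 2 <= cabs (w + h - z).
Proof.
move=> dA hd z Az; have := cabsD (w + h - z) (- h).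
by have -> : w + h - z - h = w - z by [ring]; rewrite cabsN; have := dA z Az; lra.
Qed.

Lemma Re_CI_lin f (h : C) : cbm f -> Re (CI f * h) = RI (fun z => Re (f z * h)).
Proof.
move=> [f1 f2].
have -> : (fun z => Re (f z * h)) = (fun z => Re h * Re (f z) + (- Im h) * Im (f z)).
  by apply/funext => z; rewrite Re_mul; ring.
rewrite RI_D; [|exact: bmZ|exact: bmZ].
by rewrite !RI_Z// Re_mul /=; ring.
Qed.

Lemma Im_CI_lin f (h : C) : cbm f -> Im (CI f * h) = RI (fun z => Im (f z * h)).
Proof.
move=> [f1 f2].
have -> : (fun z => Im (f z * h)) = (fun z => Im h * Re (f z) + Re h * Im (f z)).
  by apply/funext => z; rewrite Im_mul; ring.
rewrite RI_D; [|exact: bmZ|exact: bmZ].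
by rewrite !RI_Z// Im_mul /=; ring.
Qed.

Lemma RI_B2 f g k : bm f -> bm g -> bm k -> RI f - RI g - RI k = RI (fun z => f z - g z - k z).
Proof.
move=> bf bg bk; rewrite RI_D; [|by apply: bmD bf (bmN bg)|exact: bmN].
rewrite RI_D//; last exact: bmN.
have N (l : C -> R) : bm l -> RI (fun z => - l z) = - RI l.
  by move=> bl; rewrite -mulN1r -RI_Z//; congr RI; apply/funext => z; rewrite mulN1r.
by rewrite !N.
Qed.

Lemma cbm_cst (c : C) : cbm (fun=> c).
Proof.
split; split=> //.
  by exists (cabs c) => z _; exact: normRe.
by exists (cabs c) => z _; exact: normIm.
Qed.

(** The positive distance [d] from [w] to [K] makes the quadratic remainders of the kernels uniform
    over [A], so they can be integrated as they stand. *)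
Theorem potential_harmonic w : ~ K w -> harmonic_at potential cauchy_transform w.
Proof.
move=> Kw; have [d d0 dK] := compact_dist cK Kw.
have dA z : A z -> d <= cabs (w - z) by move=> /AK/dK.
have d2 : 0 < d / 2 by lra.
have m0 := m_ge0.
have ci := cbm_inv d0 dA.
have wz z : A z -> w - z != 0 by move=> /dA dz; rewrite -cabs_gt0; lra.
split.
  apply: (@lo_sq _ (13 / d ^+ 2 * m) (d / 2)) => // [|h hh].
    by rewrite mulr_ge0// divr_ge0// sqr_ge0.
  have dh := dist_perturb dA hh.
  have [ch _] := cbmM ci (cbm_cst h).
  rewrite Re_CI_lin// RI_B2//; [|exact: bm_ln dh|exact: bm_ln dA].
  rewrite mulrAC; apply: RI_bound => [|z Az].
    by apply: bmD; [apply: bmD; [exact: bm_ln dh|apply: bmN; exact: bm_ln dA]|exact: bmN].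
  have zw := dA z Az; have zh := dh z Az.
  have c0 : 0 < cabs (w - z) by lra.
  have ch0 : 0 < cabs (w + h - z) by lra.
  have := @ln_cabs1D R ((w - z)^-1 * h).
  have -> : 1 + (w - z)^-1 * h = (w + h - z) * (w - z)^-1 by field; exact: wz.
  rewrite !cabsM cabsV lnM ?posrE ?invr_gt0// lnV ?posrE// => H.
  apply: le_trans (H _) _; first by rewrite mulrC ler_pdivrMr//; lra.
  rewrite exprMn mulrA ler_wpM2r ?sqr_ge0// ler_wpM2l// exprVn.
  by rewrite lef_pV2 ?posrE ?exprn_gt0// lerXn2r ?nnegrE ?cabs_ge0// ltW.
have ci2 : cbm (fun z => (-1) * ((w - z)^-1 * (w - z)^-1)) by apply: cbmM (cbm_cst _) (cbmM ci ci).
exists (CI (fun z => (-1) * ((w - z)^-1 * (w - z)^-1))).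
(* The pointwise remainder [h^2 / ((w - z)^2 (w + h - z))] is at most [2 |h|^2 / d^3], since
   [|w + h - z| >= d / 2]; the two components double it. *)
apply: (@lo_sq _ (4 / d ^+ 3 * m) (d / 2)) => // [|h hh].
  by rewrite mulr_ge0// divr_ge0// exprn_ge0// ltW.
have dh := dist_perturb dA hh.
have [cw1 cw2] := ci.
have [ch1 ch2] := cbm_inv d2 dh.
have [k1 k2] := cbmM ci2 (cbm_cst h).
have bound z : A z -> cabs ((w + h - z)^-1 - (w - z)^-1 - (-1) * ((w - z)^-1 * (w - z)^-1) * h) <= 2 / d ^+ 3 * cabs h ^+ 2.
  move=> Az; have zw := dA z Az; have zh := dh z Az.
  have wz0 := wz z Az.
  have wh0 : w + h - z != 0 by rewrite -cabs_gt0; lra.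
  have -> : (w + h - z)^-1 - (w - z)^-1 - (-1) * ((w - z)^-1 * (w - z)^-1) * h =
    h * h * ((w - z) * (w - z) * (w + h - z))^-1 by field; rewrite wz0 wh0.
  rewrite !cabsM cabsV !cabsM mulrC expr2 ler_wpM2r ?mulr_ge0 ?cabs_ge0//.
  have P1 : 0 < cabs (w - z) * cabs (w - z) * cabs (w + h - z) by rewrite !mulr_gt0//; lra.
  have P2 : 0 < d ^+ 3 / 2 by rewrite divr_gt0// exprn_gt0.
  rewrite -[2 / _]invf_div lef_pV2 ?posrE//.
  have -> : d ^+ 3 / 2 = d * d * (d / 2) by rewrite !exprS expr0; field.
  by apply: ler_pM => //; [rewrite mulr_ge0// ltW|exact: ltW|apply: ler_pM => //; exact: ltW].
apply: le_trans (cabs_ReIm _) _.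
have -> : 4 / d ^+ 3 * m * cabs h ^+ 2 = 2 / d ^+ 3 * cabs h ^+ 2 * m + 2 / d ^+ 3 * cabs h ^+ 2 * m by ring.
apply: lerD.
  rewrite [Re (_ - _)]Re_add Re_opp [Re (_ - _)]Re_add Re_opp Re_CI_lin//= RI_B2//.
  apply: RI_bound => [|z Az].
    by apply: bmD; [apply: bmD; [exact: ch1|exact: bmN]|exact: bmN].
  by apply: le_trans (bound z Az); apply: le_trans (normRe _); rewrite !Re_add !Re_opp.
rewrite [Im (_ - _)]Im_add Im_opp [Im (_ - _)]Im_add Im_opp Im_CI_lin//= RI_B2//.
apply: RI_bound => [|z Az].
  by apply: bmD; [apply: bmD; [exact: ch2|exact: bmN]|exact: bmN].
by apply: le_trans (bound z Az); apply: le_trans (normIm _); rewrite !Im_add !Im_opp.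
Qed.

Theorem potential_unbounded : mu A != 0%E -> forall M, exists B0 : R, forall w, ~ K w -> B0 <= cabs w -> M <= potential w.
Proof.
move=> A0 M; have [b Hb] := A_bounded.
have m0 : 0 < m by rewrite /m fine_gt0// Afin lt0e A0 measure_ge0.
(* Far enough for [|w - z| >= expR (M / m)] on [A], so that the integrand is at least [M / m]. *)
exists (2 * `|b| + 2 * expR (M / m)) => w Kw wB.
have [d d0 dK] := compact_dist cK Kw.
have dA z : A z -> d <= cabs (w - z) by move=> /AK/dK.
have bmw := bm_ln d0 dA.
have : (M / m) * fine (mu A) <= RI (fun z => ln (cabs (w - z))).
  rewrite -(Rintegral_cst mu mA); apply: le_Rintegral => //.
    exact: (bm_integrable (proj1 (cbm_cst (cR (M / m))))).
    exact: bm_integrable.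
  move=> z Az; have e0 := expR_gt0 (M / m).
  have zw : expR (M / m) <= cabs (w - z).
    have := cabsD (w - z) z; rewrite subrK; have := Hb z Az; have := ler_norm b; have := normr_ge0 b; lra.
  by rewrite -[leLHS]expRK ler_ln ?posrE//; lra.
by rewrite -/m divfK ?gt_eqF.
Qed.

(** A maximum principle for potentials up to a constant: for [zs] in [A] almost nearest to [w],
    [|zs - z| <= 3 |w - z|] on [A], so the negative part at [w] exceeds that at [zs] by at most
    [ln 3 * m]. *)
Theorem potential_bounded_below (n : R) : (forall z, A z -> (negative_log_potential mu z <= n%:E)%E) ->
  exists c : R, forall w, ~ K w -> c <= potential w.
Proof.
move=> NA; exists (- (`|n| + ln 3 * m)) => w Kw.
have ln3 : 0 <= ln 3 :> R by rewrite ln_ge0//; lra.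
have m0 := m_ge0.
have [d d0 dK] := compact_dist cK Kw.
have dA z : A z -> d <= cabs (w - z) by move=> /AK/dK.
have bmw := bm_ln d0 dA.
have [[a Aa]|A0] := pselect (A !=set0); last first.
  rewrite /potential /RI (_ : A = set0) ?Rintegral_set0.
    by rewrite oppr_le0 addr_ge0// mulr_ge0.
  by apply/seteqP; split => // z Az; apply: A0; exists z.
pose E : set R := [set cabs (w - z) | z in A].
have iE : has_inf E.
  by split; [exists (cabs (w - a)), a|exists d => _ [z Az <-]; exact: dA].
have iE0 : 0 < inf E.
  by apply: (lt_le_trans d0); apply: lb_le_inf; [by case: iE|move=> _ [z Az <-]; exact: dA].
(* [A] may have no nearest point; with [inf E] itself as tolerance, [|w - zs| < 2 * inf E], which
   accounts for the factor 3. *)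
have [_ [zs Azs <-] zs2] := inf_adherent iE0 iE.
have near z : A z -> cabs (zs - z) <= 3 * cabs (w - z).
  move=> Az; have : inf E <= cabs (w - z) by apply: ge_inf; [by case: iE|exists z].
  have := cabsD (w - z) (zs - w).
  have -> : w - z + (zs - w) = zs - z by ring.
  by rewrite [cabs (zs - w)]cabsB; lra.
pose f z : R := Num.max (- ln (cabs (w - z))) 0.
have bf : bm f.
  have [_ [M HM]] := bmN bmw; split.
    by apply: measurable_maxr => //; exact: (proj1 (bmN bmw)).
  exists M => z Az; have := HM z Az; rewrite /f.
  have [h|h] := leP 0 (- ln (cabs (w - z))); first by [].
  by rewrite normr0 => H; apply: le_trans H.
have le1 : - potential w <= RI f.
  have -> : - potential w = RI (fun z => - ln (cabs (w - z))).
    by rewrite -mulN1r -RI_Z//; congr RI; apply/funext => z; rewrite mulN1r.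
  apply: le_Rintegral => //; [exact: bm_integrable (bmN bmw)|exact: bm_integrable|].
  by move=> z _; rewrite /f le_max lexx.
pose g := ((logkernel zs)^\-)%E.
have mg : measurable_fun setT (g : B -> \bar R).
  apply: measurable_funeneg.
  exact: (measurableT_comp (@measurable_logkernel R) (measurable_pair1 zs)).
have g0 z : (0 <= g z)%E by exact: funeneg_ge0.
have gA : (\int[mu]_(z in A) g z <= n%:E)%E.
  by apply: le_trans (NA zs Azs); apply: ge0_subset_integral.
have le2 : ((RI f)%:E <= `|n|%:E + (ln 3 * m)%:E)%E.
  rewrite /RI /Rintegral fineK; last exact: (integrable_fin_num mA (bm_integrable bf)).
  apply: (@le_trans _ _ (\int[mu]_(z in A) (g z + (ln 3)%:E))%E).
    apply: ge0_le_integral => //.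
    - by move=> z _; rewrite lee_fin /f le_max lexx orbT.
    - by apply/measurable_EFinP; apply: measurable_funTS; exact: (proj1 bf).
    - by apply: emeasurable_funD => //; exact: (measurable_funTS mg).
    move=> z Az; rewrite /g funenegE /logkernel.
    (* At [z = zs] the right-hand side is [+oo]. *)
    have [_|zz] := eqVneq zs z; first by rewrite /= max_l ?leey// addye// leey.
    rewrite -EFinN -EFin_max -EFinD lee_fin /f ge_max; apply/andP; split; last first.
      by rewrite addr_ge0// le_max lexx orbT.
    apply: (@le_trans _ _ (- ln (cabs (zs - z)) + ln 3)); last by rewrite lerD2r le_max lexx.
    have zz0 : 0 < cabs (zs - z) by rewrite cabs_gt0 subr_eq0.
    have wz0 : 0 < cabs (w - z) by have := dA z Az; lra.
    have : ln (cabs (zs - z)) <= ln (3 * cabs (w - z)) by rewrite ler_ln ?posrE// ?near// mulr_gt0.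
    by rewrite lnM ?posrE//; lra.
  rewrite ge0_integralD//; last exact: measurable_funTS.
  apply: leeD; first by apply: le_trans gA _; rewrite lee_fin ler_norm.
  by rewrite integral_cst// /m EFinM fineK// ge0_fin_numE.
by rewrite -EFinD lee_fin in le2; lra.
Qed.
End Potential.

(** * Boundary behaviour *)

Section RadialBehaviour.
Variable R : realType.
Local Notation C := R[i].
Local Notation Re := (@complex.Re R).
Local Notation Im := (@complex.Im R).
Local Notation leb := (@lebesgue_measure R).

(* Maps the upper half plane onto the punctured disc and the real axis onto the circle. *)
Definition covering (z : C) : C := cexp (Complex 0 1 * z).

Lemma covering_polar (x y : R) : covering (Complex x y) = cR (expR (- y)) * expi x.
Proof. by rewrite /covering /cexp !ReImE /= !mul0r !mul1r sub0r add0r. Qed.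

Lemma cabs_covering z : cabs (covering z) = expR (- Im z).
Proof. by rewrite /covering cabs_cexp Re_mul /= mul0r mul1r sub0r. Qed.

Lemma cderiv_covering z : cderiv covering z (covering z * Complex 0 1).
Proof.
rewrite -[X in covering z * X]mulr1; apply: (@cderiv_comp R (fun z => Complex 0 1 * z)).
  by apply: cderivZ; exact: cderiv_id.
exact: cderiv_cexp.
Qed.

(** The half of [[0, 2 pi]] that contains [t0] is recorded because it tells in which direction [t0]
    can be moved into the interior. *)
Lemma unit_circle_arg (zeta : C) : cabs zeta = 1 ->
  exists2 t0 : R, zeta = expi t0 & (0 <= t0 <= pi) \/ (pi <= t0 <= 2 * pi).
Proof.
move=> z1; have := cabs_sqr zeta; rewrite z1 expr1n; case: zeta {z1} => x y /= E.
have x1 : -1 <= x <= 1.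
  by rewrite -ler_norml -(ler_pXn2r (ltn0Sn 1)) ?nnegrE// real_normK ?num_real// expr1n E lerDl sqr_ge0.
have [a0 cx] := acos_def x1.
have y2 : y ^+ 2 = sin (acos x) ^+ 2 by have := cos2Dsin2 (acos x); rewrite cx E => /addrI.
have s0 : 0 <= sin (acos x) by exact: sin_ge0_pi.
have [y0|y0] := leP 0 y.
  exists (acos x); last by left.
  by rewrite /expi cx; congr Complex; apply/eqP; rewrite -(eqrXn2 (ltn0Sn 1))// y2.
exists (2 * pi - acos x); last by right; move: a0 => /andP[? ?]; apply/andP; split; lra.
have Ny : - y = sin (acos x).
  by apply/eqP; rewrite -(eqrXn2 (ltn0Sn 1))// ?sqrrN ?y2// oppr_ge0 ltW.
rewrite /expi; have -> : 2 * pi - acos x = - acos x + pi *+ 2 by rewrite mulr_natl addrC.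
by rewrite cosD2pi sinD2pi cosN sinN cx -Ny opprK.
Qed.

(** The almost everywhere hypothesis concerns angles in [[0, 2 pi)], so the base of the box must lie
    there even for [zeta = 1]; hence the shift of [t0] by at most [r / 8]. *)
Lemma boundary_box (zeta : C) (r : R) : cabs zeta = 1 -> 0 < r ->
  exists t1 s : R, [/\ 0 < s, 0 < t1 - s, t1 + s < 2 * pi &
    forall z, `|Re z - t1| < 5 * s /\ 0 < Im z < 5 * s -> Dzr zeta r (covering z)].
Proof.
move=> z1 r0; have pi2 := pi_ge2 R.
have [t0 zE ht0] := unit_circle_arg z1.
pose del := Num.min (r / 8) 1.
have d0 : 0 < del by rewrite lt_min ltr01 divr_gt0.
have dr : del <= r / 8 by rewrite ge_min lexx.
have d1 : del <= 1 by rewrite ge_min lexx orbT.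
have [t1 [t10 t12 tt]] : exists t1, [/\ 0 < t1, t1 < 2 * pi & `|t1 - t0| <= del].
  case: ht0 => /andP[h1 h2].
    by exists (t0 + del); split; [lra|lra|rewrite addrC addKr ger0_norm// ltW].
  by exists (t0 - del); split; [lra|lra|rewrite addrC addKr normrN ger0_norm// ltW].
have near1 : cabs (expi t1 - zeta) <= r / 4.
  have := expi_lip t0 (t1 - t0); rewrite subrKC -zE; lra.
have cE : covering (Complex t1 0) = expi t1 by rewrite covering_polar oppr0 expR0 mul1r.
have r2 : 0 < r / 2 by lra.
have [rho rho0 hrho] := cderiv_cont (cderiv_covering (Complex t1 0)) r2.
(* Points of the box are within [10 * s <= rho / 2] of [t1]; the other two bounds keep the base
   inside []0, 2 pi[]. *)
pose s := Num.min (rho / 20) (Num.min (t1 / 2) ((2 * pi - t1) / 2)).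
have s0 : 0 < s by rewrite !lt_min !divr_gt0//; lra.
have s1 : s <= rho / 20 by rewrite ge_min lexx.
have s2 : s <= t1 / 2 by rewrite !ge_min lexx !orbT.
have s3 : s <= (2 * pi - t1) / 2 by rewrite !ge_min lexx !orbT.
exists t1, s; split; [by []|lra|lra|move=> z [zx /andP[z0 zy]]].
split; first by rewrite cabs_covering -expR0 ltr_expR; lra.
have := hrho (z - Complex t1 0); rewrite subrKC cE => H.
have : cabs (covering z - expi t1) < r / 2.
  apply: H; apply: le_lt_trans (cabs_ReIm _) _; rewrite !ReImE /= subr0 [`|Im z|]gtr0_norm//; lra.
have := cabsD (covering z - expi t1) (expi t1 - zeta); rewrite addrA subrK; lra.
Qed.

Lemma holo_chain (f : C -> C) : holomorphic_on_disc f ->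
  exists f' : C -> C, forall z, cabs z < 1 -> cderiv f z (f' z) /\ exists d, cderiv f' z d.
Proof.
move=> hf.
have /choice[f' Hf'] : forall z, exists d, cabs z < 1 -> cderiv f z d.
  move=> z; have [z1|z1] := pselect (cabs z < 1); last by exists 0.
  by have [d Hd] := cderiv_holo (hf z z1); exists d.
exists f' => z z1; split; first exact: Hf'.
apply: (@holomorphic_deriv R f f' z (1 - cabs z)); first by rewrite subr_gt0.
move=> w wz; apply: Hf'; have := cabsD (w - z) z; rewrite subrK; lra.
Qed.

(** By the chain rule the complex gradient of [p] composed with a holomorphic [F] is [q(F) * F']; it
    is holomorphic because [f'] is. *)
Lemma pullback_harmonic (f f' : C -> C) (p : C -> R) (q : C -> C) z : 0 < Im z ->
  (forall z, cabs z < 1 -> cderiv f z (f' z) /\ exists d, cderiv f' z d) ->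
  harmonic_at p q (f (covering z)) ->
  harmonic_at (fun z => p (f (covering z)))
    (fun z => q (f (covering z)) * (f' (covering z) * (covering z * Complex 0 1))) z.
Proof.
move=> z0 df [dp [d dq]].
have [df1 [d' df']] : cderiv f (covering z) (f' (covering z)) /\ exists d, cderiv f' (covering z) d.
  by apply: df; rewrite cabs_covering -expR0 ltr_expR; lra.
have dE := cderiv_covering z.
have dF := cderiv_comp dE df1.
split; first exact: (rgrad_comp dF dp).
eexists; apply: cderivM; first exact: (cderiv_comp dF dq).
apply: cderivM; first exact: (cderiv_comp dE df').
apply: cderivM; first exact: dE.
exact: cderiv_cst.
Qed.

Theorem radially_unbounded_polar (f : C -> C) (zeta : C) (r : R) :
  holomorphic_on_disc f -> radially_unbounded_ae f -> cabs zeta = 1 -> 0 < r ->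
  polar (~` (f @` Dzr zeta r)).
Proof.
move=> hf unb z1 r0 mu mufin mu0 [K [cK [KD muK]]].
apply/eqP/negPn/negP => En.
have [A [M [mA AK A0 NA]]] := finite_energy_set mufin mu0 cK muK En.
have Afin : (mu A < +oo)%E.
  by apply: le_lt_trans mufin; apply: le_measure; rewrite ?inE.
have [c Hc] := potential_bounded_below mA Afin AK cK NA.
have [f' df] := holo_chain hf.
have [t1 [s [s0 ts1 ts2 box]]] := boundary_box z1 r0.
have nK z : `|Re z - t1| < 5 * s /\ 0 < Im z < 5 * s -> ~ K (f (covering z)).
  by move=> /box Dz /KD; apply; exists (covering z).
pose p z := potential mu A z + (- c).
pose q z := cauchy_transform mu A z + 0.
have hp w : ~ K w -> harmonic_at p q w.
  move=> Kw; have [h1 [d h2]] := potential_harmonic mA Afin AK cK Kw.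
  split; first by apply: rgradD h1 (rgrad_cst _ _).
  by exists (d + 0); apply: cderivD h2 (cderiv_cst _ _).
(* [unb] is itself the negligibility of the exceptional set of angles, which serves as [N]. *)
have := @harmonic_not_radially_unbounded R (fun z => p (f (covering z)))
  (fun z => q (f (covering z)) * (f' (covering z) * (covering z * Complex 0 1))) t1 s _ s0 unb.
apply.
- by move=> z Oz; apply: pullback_harmonic => //; [case: Oz => _ /andP[]|exact/hp/nK].
- by move=> z Oz; rewrite /p subr_ge0; exact/Hc/nK.
(* If no height up to [s / 4] works, [f] is bounded on the whole radius: by compactness up to
   [expR (- (s / 4))], and beyond it because a large [|f|] would make the potential large. *)
move=> t M' ts Nt; apply: contrapT => H.
have [b Hb] := potential_unbounded mA Afin AK cK A0 (M' + c).
move: Nt => /contrapT /=.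
have t02 : 0 <= t < 2 * pi by move: ts; rewrite ler_norml => /andP[? ?]; apply/andP; split; lra.
move=> /(_ t02); apply.
have e1 : expR (- (s / 4)) < 1 by rewrite expR_lt1; lra.
have [b' Hb'] : exists b', forall z, cabs (z - 0) <= expR (- (s / 4)) -> cabs (f z) <= b'.
  apply: ccont_bounded => z; rewrite subr0 => ze.
  by have [|h _] := df z; [lra|exact: cderiv_cont h].
exists (Num.max b b') => rho /andP[rho0 rho1].
have [rs|rs] := leP rho (expR (- (s / 4))).
  by rewrite le_max Hb' ?orbT// subr0 cabsM cabs_cR cabs_expi mulr1 ger0_norm.
have rho0' : 0 < rho by apply: lt_trans rs; exact: expR_gt0.
pose y := - ln rho.
have ye : expR (- y) = rho by rewrite opprK lnK.
have y0 : 0 < y by rewrite oppr_gt0 ln_lt0// rho0'.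
have ys : y < s / 4 by move: rs; rewrite -ye ltr_expR; lra.
have E : cR rho * expi t = covering (Complex t y) by rewrite covering_polar ye.
have Oy : `|Re (Complex t y) - t1| < 5 * s /\ 0 < Im (Complex t y) < 5 * s.
  by clear -ts y0 ys s0; split => /=; [lra|apply/andP; split; lra].
rewrite le_max E leNgt; apply/orP; left; apply/negP => bf.
apply: H; exists y; first by rewrite y0 ltW.
by rewrite /p lerBrDr; apply: Hb; [exact: nK|exact: ltW].
Qed.

Lemma Uae_radially_unbounded (f : C -> C) : Uae f -> radially_unbounded_ae f.
Proof.
move=> [hf uf].
have step (n : nat) : ae_T (fun w => exists r : R, 0 <= r < 1 /\ n%:R <= cabs (f (cR r * w))).
  (* The target [n + 1] leaves room for the error 1 taken from the convergence. *)
  have [|rn [rn01 ae]] := uf (fun=> cR (n.+1)%:R).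
    move=> U _; apply: sub_caratheodory.
    have [UN|UN] := pselect (U (cR n.+1%:R)).
      rewrite (_ : [set _ | _] = `[0, 2 * pi[%classic); first exact: measurable_itv.
      by apply/seteqP; split => t /=; rewrite in_itv /= => // -[].
    rewrite (_ : [set _ | _] = set0); first exact: measurable0.
    by apply/seteqP; split => // t [].
  move: ae; apply: negligibleS; apply: subsetC => t H t02; have := H t02 => /cvgrPdist_lt /(_ 1 ltr01)[k _ hk].
  exists (rn k); split => //.
  have := hk k (leqnn k); rewrite normc_cabs ltcE => /andP[_] /=.
  set x := cabs _ => h; have {}h : x < 1 by [].
  move: h; rewrite /x => h.
  have := cabsD (cR n.+1%:R - f (cR (rn k) * expi t)) (f (cR (rn k) * expi t)).
  have n1 : n.+1%:R = n%:R + 1 :> R by rewrite natr1.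
  rewrite subrK cabs_cR ger0_norm// n1; move: h; rewrite n1; lra.
rewrite /radially_unbounded_ae /ae_T.
(* The null sets of the individual [n] are united, because the bound to be refuted depends on the
   point. *)
have : {ae leb, forall t, forall n : nat, 0 <= t < 2 * pi -> exists r : R, 0 <= r < 1 /\ n%:R <= cabs (f (cR r * expi t))}.
  by apply: ae_foralln => n; exact: step.
apply: negligibleS; apply: subsetC => t H t02 [M HM].
have [r [r01 h]] := H (Num.bound `|M|) t02.
have := archi_boundP (normr_ge0 M); have := HM r r01; have := ler_norm M; lra.
Qed.

End RadialBehaviour.

Theorem theorem5p2 (R : realType) :
  (forall f : R[i] -> R[i],
     holomorphic_on_disc f -> radially_unbounded_ae f ->
     forall (zeta : R[i]) (r : R), cabs zeta = 1 -> 0 < r ->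
       polar (~` (f @` Dzr zeta r)))
  /\
  (forall f : R[i] -> R[i], Uae f ->
     forall (zeta : R[i]) (r : R), cabs zeta = 1 -> 0 < r ->
       polar (~` (f @` Dzr zeta r))).
Proof.
split=> f; first by move=> hf unb zeta r; exact: radially_unbounded_polar.
move=> uf zeta r; apply: radially_unbounded_polar; first exact: (proj1 uf).
exact: Uae_radially_unbounded.
Qed.
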